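(* Let $n\ge 1$ and $\pi\in S_n$. There is a weight-preserving injection $\varphi:\mathrm{TSSCPP}^{red}(\pi)\to \mathrm{ASM}^{red}(\pi)$, i.e. $\mathrm{wt}(\varphi(b))=\mathrm{wt}(b)$ for all $b\in\mathrm{TSSCPP}^{red}(\pi)$. If moreover $\pi$ avoids the pattern $1432$, then $\varphi$ is a bijection.
   Context: Pattern avoidance: $\pi$ avoids $1432$ if there are no indices $a<b<c<d$ with $\pi(a)<\pi(d)<\pi(c)<\pi(b)$. TSSCPP. A totally symmetric self-complementary plane partition in a $2n\times2n\times2n$ box is identified, via a standard bijection, with a TSSCPP boolean triangle of order $n$: an array $b=(b_{i,j})$, $1\le i\le n-1$, $n-i\le j\le n-1$, with entries in $\{0,1\}$ such that for all $1\le j<i\le n-1$: $1+\sum_{k=j+1}^{i} b_{k,n-j-1}\ge \sum_{k=j}^{i} b_{k,n-j}$. We work with these triangles. The weight of $b$ is $\mathrm{wt}(b)=\prod_{(i,j):\,b_{i,j}=1} x_{n-i}$. Pipe dreams. A pipe dream of size $n$ is a tiling of the $n\times n$ grid (rows $1,\dots,n$ top to bottom, columns $1,\dots,n$ left to right) by cross tiles and elbow tiles (an elbow tile has one arc joining its north and west edges and one joining its south and east edges), such that every position $(i,j)$ with $i+j\ge n+1$ is an elbow tile. Pipes labelled $1,\dots,n$ enter through the north border (pipe $j$ above column $j$) and exit through the west border. It is reduced if no two pipes cross twice; then its permutation $\pi$ is given by letting $\pi(i)$ be the label of the pipe exiting the west edge of row $i$. The associated pipe dream of a TSSCPP boolean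 triangle $b$ is the pipe dream having, for $1\le i\le n-1$, $1\le j\le n-i$, a cross tile at $(i,j)$ iff $b_{n-i,\,i+j-1}=1$, and elbow tiles elsewhere. $\mathrm{TSSCPP}^{red}(\pi)$ is the set of TSSCPP boolean triangles of order $n$ whose associated pipe dream is reduced with permutation $\pi$. Bumpless pipe dreams. A bumpless pipe dream (BPD) of size $n$ is a tiling of the $n\times n$ grid by six tiles: cross, horizontal segment, vertical segment, r-tile (elbow joining south and east edges), j-tile (elbow joining north and west edges), and blank, such that $n$ pipes are formed, each entering through the south border (bottom of a column) and exiting through the east border (right of a row). It is reduced if no two pipes cross twice; then, labelling the pipes $1,\dots,n$ from left to right along the south border, its permutation $\pi$ has $\pi(i)$ equal to the label of the pipe exiting row $i$. Its weight is $\prod x_i$ over blank tiles $(i,j)$. ASM. An alternating sign matrix is an $n\times n$ matrix with entries in $\{0,1,-1\}$ whose rows and columns each sum to $1$ and whose nonzero entries alternate in sign along each row and column. Each ASM $A$ corresponds to the unique BPD whose r-tiles are exactly at the entries $1$ and whose j-tiles are exactly at the entries $-1$. $\mathrm{ASM}^{red}(\pi)$ is the set of ASMs whose BPD is reduced with permutation $\pi$. The weight is $\mathrm{wt}(A)=\prod x_i$ over positions $(i,j)$ with $A_{ij}=0$, $\sum_{i'\le i}A_{i'j}=0$ and $\sum_{j'\le j}A_{ij'}=0$ (this equals the weight of its BPD). *)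

(* Defs.v *)
From HB Require Import structures.
From mathcomp Require Import all_boot all_order all_algebra all_fingroup.
From mathcomp Require Import mpoly.

Set Implicit Arguments.
Unset Strict Implicit.
Unset Printing Implicit Defensive.

Import Order.TTheory GRing.Theory Num.Theory.
Local Open Scope ring_scope.

(* Cells, rows, columns, pipe labels and the variables x_i are all indexed by
   'I_n, so the k of the usual 1-based conventions is the ordinal of value
   k - 1.  A cell is (row, column), rows going down and columns to the right. *)

Inductive side := North | South | East | West.

Definition side_code (s : side) : nat :=
  match s with North => 0 | South => 1 | East => 2 | West => 3 end.
Definition side_decode (k : nat) : option side :=
  nth None [:: Some North; Some South; Some East; Some West] k.
Fact side_codeK : pcancel side_code side_decode. Proof. by case. Qed.
HB.instance Definition _ := Countable.copy side (pcan_type side_codeK).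
Fact side_enumP : Finite.axiom [:: North; South; East; West].
Proof. by case. Qed.
HB.instance Definition _ := isFinite.Build side side_enumP.

Definition opposite (s : side) : side :=
  match s with North => South | South => North | East => West | West => East end.

(* [Elbows] is the two-arc tile of pipe dreams; the other tiles, including the
   shared [Cross], are those of bumpless pipe dreams. *)
Inductive tile := Cross | Horizontal | Vertical | RTile | JTile | Blank | Elbows.

Definition tile_code (t : tile) : nat :=
  match t with
  | Cross => 0 | Horizontal => 1 | Vertical => 2 | RTile => 3 | JTile => 4
  | Blank => 5 | Elbows => 6
  end.
Definition tile_decode (k : nat) : option tile :=
  nth None [:: Some Cross; Some Horizontal; Some Vertical; Some RTile;
               Some JTile; Some Blank; Some Elbows] k.
Fact tile_codeK : pcancel tile_code tile_decode. Proof. by case. Qed.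
HB.instance Definition _ := Countable.copy tile (pcan_type tile_codeK).
Fact tile_enumP :
  Finite.axiom [:: Cross; Horizontal; Vertical; RTile; JTile; Blank; Elbows].
Proof. by case. Qed.
HB.instance Definition _ := isFinite.Build tile tile_enumP.

(* [link t s] is the side to which the pipe segment of [t] meeting side [s]
   leads, if there is such a segment. *)
Definition link (t : tile) (s : side) : option side :=
  match t, s with
  | Cross, s => Some (opposite s)
  | Horizontal, East => Some West
  | Horizontal, West => Some East
  | Vertical, North => Some South
  | Vertical, South => Some North
  | RTile, South => Some East
  | RTile, East => Some South
  | JTile, North => Some West
  | JTile, West => Some North
  | Elbows, North => Some West
  | Elbows, West => Some North
  | Elbows, South => Some East
  | Elbows, East => Some South
  | _, _ => None
  end.

Definition meets (t : tile) (s : side) : bool := link t s != None.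

Definition cell (n : nat) : finType := ('I_n * 'I_n)%type.
Definition tiling (n : nat) : finType := {ffun cell n -> tile}.

(* [neighbor c s c']: the cell c' lies just across the side s of c. *)
Definition neighbor n (c : cell n) (s : side) (c' : cell n) : bool :=
  match s with
  | North => (c'.1.+1 == c.1 :> nat) && (c'.2 == c.2)
  | South => (c'.1 == c.1.+1 :> nat) && (c'.2 == c.2)
  | East => (c'.1 == c.1) && (c'.2 == c.2.+1 :> nat)
  | West => (c'.1 == c.1) && (c'.2.+1 == c.2 :> nat)
  end.

Definition on_border n (c : cell n) (s : side) : bool :=
  match s with
  | North => c.1 == 0%N :> nat
  | South => c.1.+1 == n
  | East => c.2.+1 == n
  | West => c.2 == 0%N :> nat
  end.

(* A pipe state (c, s) means that the pipe enters the cell c through side s. *)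
Definition state (n : nat) : finType := (cell n * side)%type.

Definition next n (T : tiling n) : rel (state n) := fun x y =>
  if link (T x.1) x.2 is Some s
  then neighbor x.1 s y.1 && (y.2 == opposite s) else false.

Definition pipe_visits n (T : tiling n) (x : state n) (c : cell n) : bool :=
  [exists s : side, connect (next T) x (c, s)].

Definition pipe_exits n (T : tiling n) (x : state n) (c : cell n) (s : side)
  : bool :=
  on_border c s &&
  [exists s' : side, connect (next T) x (c, s') && (link (T c) s' == Some s)].

(* The pipe labelled j of a tiling whose pipes enter through the [ent] border:
   it starts in column j. *)
Definition starts n (ent : side) (j : 'I_n) (x : state n) : bool :=
  [&& on_border x.1 ent, x.1.2 == j & x.2 == ent].

(* In a tile [Cross], two distinct pipes necessarily run along its two
   different strands. *)
Definition crossings n (T : tiling n) (ent : side) (j k : 'I_n)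
  : {set cell n} :=
  [set c | (T c == Cross) &&
     [exists x, exists y, [&& starts ent j x, starts ent k y,
                              pipe_visits T x c & pipe_visits T y c]]].

Definition reduced n (T : tiling n) (ent : side) : bool :=
  [forall j : 'I_n, forall k : 'I_n,
     (j != k) ==> (#|crossings T ent j k| <= 1)%N].

Definition has_perm n (T : tiling n) (ent ext : side) (pi : 'S_n) : bool :=
  [forall i : 'I_n,
     [exists x, exists c, [&& starts ent (pi i) x, c.1 == i
                            & pipe_exits T x c ext]]].

(** Pipe dreams *)

Definition is_pipe_dream n (T : tiling n) : bool :=
  [forall c, ((T c == Cross) || (T c == Elbows)) &&
             ((n.+1 <= c.1.+1 + c.2.+1)%N ==> (T c == Elbows))].

Definition pd_reduced_with n (T : tiling n) (pi : 'S_n) : bool :=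
  reduced T North && has_perm T North West pi.

(** Bumpless pipe dreams *)

(* The n pipes are formed, each entering from the south and exiting to the
   east, when segments match across every inner edge, all south and east border
   edges are used, and no north or west border edge is. *)
Definition is_bpd n (T : tiling n) : bool :=
  [&& [forall c, T c != Elbows],
      [forall c, forall s, forall c',
         neighbor c s c' ==> (meets (T c) s == meets (T c') (opposite s))]
    & [forall c, forall s, on_border c s ==>
         (meets (T c) s == ((s == South) || (s == East)))]].

Definition bpd_reduced_with n (T : tiling n) (pi : 'S_n) : bool :=
  reduced T South && has_perm T South East pi.

(** TSSCPP boolean triangles *)

(* For p : tri_index n, the pair (i, j) of numbers val p satisfies
   1 <= i <= n - 1 and n - i <= j <= n - 1.  Unlike elsewhere, these are the
   customary indices, not shifted by one. *)
Definition tri_index (n : nat) : finType :=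
  {p : 'I_n * 'I_n | (0 < p.1)%N && (n - p.1 <= p.2)%N}.

Definition triangle (n : nat) : finType := {ffun tri_index n -> bool}.

(* The entry b_(i,j), and false when (i, j) is outside the index set. *)
Definition entry n (b : triangle n) (i j : nat) : bool :=
  [exists p : tri_index n,
     [&& b p, (val p).1 == i :> nat & (val p).2 == j :> nat]].

Definition is_tsscpp n (b : triangle n) : bool :=
  [forall i : 'I_n, forall j : 'I_n, (1 <= j < i)%N ==>
     (\sum_(j <= k < i.+1) entry b k (n - j)
      <= 1 + \sum_(j.+1 <= k < i.+1) entry b k (n - j - 1))%N].

(* With i = c.1 + 1 and j = c.2 + 1, the cell (i, j) is a cross iff
   1 <= i <= n - 1, 1 <= j <= n - i and b_(n-i, i+j-1) = 1. *)
Definition tsscpp_pd n (b : triangle n) : tiling n :=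
  [ffun c : cell n =>
     if [&& (c.1.+1 <= n - 1)%N, (c.2.+1 <= n - c.1.+1)%N
          & entry b (n - c.1.+1) (c.1.+1 + c.2.+1 - 1)]
     then Cross else Elbows].

Lemma tsscpp_pdP n (b : triangle n) : is_pipe_dream (tsscpp_pd b).
Proof.
apply/forallP=> -[i j]; rewrite ffunE /=.
case: ifP => [/and3P[_ ltj _] | _]; last by rewrite eqxx !implybT.
rewrite eqxx /= implybF -ltnNge ltnS.
by rewrite -leq_subRL ?(ltn_ord i).
Qed.

(* rev_ord i is the index of x_(n-i): its value is n - i - 1. *)
Definition tsscpp_wt n (b : triangle n) : {mpoly int[n]} :=
  \prod_(p : tri_index n | b p) 'X_(rev_ord (val p).1).

Definition tsscpp_red n (pi : 'S_n) : pred (triangle n) :=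
  fun b => is_tsscpp b && pd_reduced_with (tsscpp_pd b) pi.

(** Alternating sign matrices *)

(* Entries being 0, 1 or -1, consecutive nonzero entries of opposite signs are
   opposite numbers. *)
Definition alternates n (f : 'I_n -> int) : bool :=
  [forall j : 'I_n, forall k : 'I_n,
     [&& (j < k)%N, f j != 0, f k != 0
       & [forall l : 'I_n, (j < l < k)%N ==> (f l == 0)]] ==>
     (f k == - f j)].

Definition is_asm n (A : 'M[int]_n) : bool :=
  [&& [forall i, forall j, A i j \in [:: 0; 1; -1]],
      [forall i, \sum_j A i j == 1],
      [forall j, \sum_i A i j == 1],
      [forall i, alternates (fun j => A i j)]
    & [forall j, alternates (fun i => A i j)]].

Definition asm_bpd n (A : 'M[int]_n) (T : tiling n) : bool :=
  is_bpd T &&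
  [forall c, ((T c == RTile) == (A c.1 c.2 == 1)) &&
             ((T c == JTile) == (A c.1 c.2 == -1))].

Definition asm_wt n (A : 'M[int]_n) : {mpoly int[n]} :=
  \prod_(c : cell n | [&& A c.1 c.2 == 0,
                          \sum_(i < n | (i <= c.1)%N) A i c.2 == 0
                        & \sum_(j < n | (j <= c.2)%N) A c.1 j == 0])
    'X_(c.1).

(* The BPD of an ASM is unique, whence the existential quantifier. *)
Definition asm_red n (pi : 'S_n) : pred 'M[int]_n :=
  fun A => is_asm A && [exists T, asm_bpd A T && bpd_reduced_with T pi].

Definition TSSCPPred n (pi : 'S_n) : Type := {b : triangle n | tsscpp_red pi b}.
Definition ASMred n (pi : 'S_n) : Type := {A : 'M[int]_n | asm_red pi A}.

Definition avoids1432 n (pi : 'S_n) : Prop :=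
  ~ exists a b c d : 'I_n,
      [/\ (a < b)%N, (b < c)%N & (c < d)%N] /\
      [/\ (pi a < pi d)%N, (pi d < pi c)%N & (pi c < pi b)%N].

(* Main.v *)
Require Import Defs.
From mathcomp Require Import all_boot all_order all_algebra all_fingroup.
From mathcomp Require Import mpoly.
From mathcomp Require Import zify ring.
From Stdlib Require Import FunctionalExtensionality.

(** Both kinds of objects are counted by weight: for every permutation [pi] the
    reduced pipe dreams and the reduced bumpless pipe dreams have the same
    weight enumerator (the Schubert polynomial of [pi]), and a triangle is
    determined by its pipe dream, so comparing coefficients of monomials gives
    the injection.

    The pipe dream enumerators are the coefficients of a product of factors
    [1 + x_i u_k] in the nilCoxeter algebra.  Such a product is a joint
    eigenvector of the operators summing signed Bruhat covers (multiplication
    by [1 + (e_(k+1) - e_k) u_k] exchanges the eigenvalues [e_k] and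
    [e_(k+1)]), which is Monk's rule.  For bumpless pipe dreams, inspecting the
    last row that is not forced gives the transition recursion directly.  With
    [r] the last descent of [pi], [s] the largest index with [pi s < pi r] and
    [v = pi t_(r,s)], both say that the enumerator of [pi] is [x_r] times that
    of [v] plus the sum of those of the covers [v t_(i,r)], [i < r].

    If a triangle with reduced pipe dream is not a TSSCPP triangle, then some
    letter [m] crosses in two rows [p < q] with no crossing of letter [m - 1]
    between them.  The three pipes meeting there cross pairwise, and since the
    first [m - p] pipes are still to their left while only [m - q] positions
    there are not yet final, one of these pipes completes a pattern 1432. *)

Set Implicit Arguments.
Unset Strict Implicit.
Unset Printing Implicit Defensive.

Import Order.TTheory GRing.Theory Num.Theory.
Local Open Scope ring_scope.

(** * Transpositions and Bruhat covers *)

(** Reducedness is a condition on whole pipes, while both enumerators are to be handled crossing by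
    crossing. The bridge is a common model: a list of labels, initially increasing, that changes by
    swaps of neighbours, one per cross tile. No pair is swapped twice exactly when every swap meets
    its two labels in increasing order, so a sum over reduced objects becomes an iterated sum with
    local rules. The diagonal term [y (v r)] of [monk] provides the start of the eigenvector
    argument: the indicator of the identity has the eigenvalues [y], and cross factors only permute
    these. The variables must thus be present in [y] from the beginning and yet vanish from the
    final rule; they are stored at positions from [n] on, out of reach of values [v r] below [n].
    This is why the size is doubled to [n.*2]. The two recursions meet by induction on the value
    [pi r]: every other permutation in the transition has a smaller value at [r]. *)

Definition sw (a b x : nat) : nat :=
  if x == a then b else if x == b then a else x.

Lemma swK a b : involutive (sw a b).
Proof. by move=> x; rewrite /sw; do !case: eqP => //; lia. Qed.

Lemma sw_inj a b : injective (sw a b). Proof. exact: inv_inj (swK a b). Qed.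

Lemma swC a b : sw a b = sw b a.
Proof. by apply: functional_extensionality => x; rewrite /sw; do !case: eqP => //; lia. Qed.

Lemma sw_conj (s : nat -> nat) a b : injective s ->
  sw (s a) (s b) \o s = s \o sw a b.
Proof.
move=> sI; apply: functional_extensionality => x; rewrite /sw /=.
by rewrite !(inj_eq sI); do !case: eqP => //.
Qed.

Lemma comp_swK (v : nat -> nat) a b : (v \o sw a b) \o sw a b = v.
Proof. by apply: functional_extensionality => x /=; rewrite swK. Qed.

Lemma swl a b : sw a b a = b. Proof. by rewrite /sw eqxx. Qed.

Lemma swr a b : sw a b b = a. Proof. by rewrite swC swl. Qed.

Lemma sw_lt N a b x : (a < N)%N -> (b < N)%N -> (sw a b x < N)%N = (x < N)%N.
Proof. by move=> aN bN; rewrite /sw; do !case: eqP; lia. Qed.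

Definition covers (v : nat -> nat) (a b : nat) : bool :=
  (v a < v b)%N &&
  all (fun m => ~~ ((v a < v m)%N && (v m < v b)%N)) (iota a.+1 (b - a.+1)).

Lemma coversP v a b :
  reflect ((v a < v b)%N /\
           forall m, (a < m < b)%N -> ~ ((v a < v m)%N /\ (v m < v b)%N))
          (covers v a b).
Proof.
apply: (iffP andP) => -[lt_ab H]; split => //.
  move=> m m_ab [h1 h2]; have /(allP H): m \in iota a.+1 (b - a.+1).
    by rewrite mem_iota; lia.
  by rewrite h1 h2.
apply/allP => m; rewrite mem_iota => hm; apply/negP => /andP[h1 h2].
by apply: (H m) => //; lia.
Qed.

Definition descent (v : nat -> nat) k : bool := (v k.+1 < v k)%N.

Lemma swE a b x :
  [\/ x = a /\ sw a b x = b, [/\ x <> a, x = b & sw a b x = a]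
    | [/\ x <> a, x <> b & sw a b x = x]].
Proof.
rewrite /sw; case: eqP => [->|xa]; first by apply: Or31.
by case: eqP => [xb|xb]; [apply: Or32 | apply: Or33].
Qed.

Ltac case_sw a b x :=
  case: (swE a b x) => [[? ->]|[? ? ->]|[? ? ->]].

(* Both sides say that [v \o sw a b \o sw k k.+1] is reached from [v]
   by a Bruhat cover and a descent, in either order. *)
Lemma covers_descent v k a b : injective v -> (a < b)%N ->
  (a, b) != (k, k.+1) ->
  covers v a b && descent (v \o sw a b) k =
  descent v k && covers (v \o sw k k.+1) (sw k k.+1 a) (sw k k.+1 b).
Proof.
move=> vI ab; rewrite /descent xpair_eqE /= => nk.
have vk : v k <> v k.+1 by move/vI; lia.
apply/andP/andP.
- case=> /coversP[vab H] D.
  have Hk := H k; have Hk1 := H k.+1.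
  have D' : (v k.+1 < v k)%N.
    by clear H; move: D; case_sw a b k; case_sw a b k.+1; subst; lia.
  split=> //; apply/coversP; rewrite /= !swK; split=> // m.
  have Hm := H (sw k k.+1 m); have Hm' := H m.
  clear H Hk Hk1; move: Hm D; case_sw a b k; case_sw a b k.+1;
  case_sw k k.+1 a; case_sw k k.+1 b; case_sw k k.+1 m; subst; lia.
- case=> D /coversP[]; rewrite /= !swK => vab H.
  have Hk := H k; have Hk1 := H k.+1; rewrite /= swl in Hk; rewrite /= swr in Hk1.
  have va : a <> k.+1 -> v a <> v k.+1 by move=> ? /vI.
  have vb : b <> k -> v b <> v k by move=> ? /vI.
  split.
    apply/coversP; split=> // m; have := H (sw k k.+1 m); rewrite swK.
    by clear Hk Hk1 va vb; case_sw k k.+1 a; case_sw k k.+1 b; case_sw k k.+1 m;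
       subst; lia.
  by clear H; move: Hk Hk1; case_sw a b k; case_sw a b k.+1; case_sw k k.+1 a;
     case_sw k k.+1 b; subst; lia.
Qed.

(** * Monk's rule for pipe dreams *)

Section Monk.
Variable R : comRingType.
Implicit Types (v : nat -> nat) (F : (nat -> nat) -> R) (e y : nat -> R).

Definition cover_sign v r j : R :=
  if (r < j)%N then (covers v r j)%:R
  else if (j < r)%N then - (covers v j r)%:R else 0.

(** The shape is that of Monk's rule for double Schubert polynomials, cut off at [N], with [e r] in
    the role of the variable x_r. *)
Definition monk N y F e : Prop := forall v r, injective v -> (r < N)%N ->
  e r * F v =
  y (v r) * F v + \sum_(j < N) cover_sign v r j * F (v \o sw r j).

(** Multiplication by 1 + z u_k in the nilCoxeter algebra, an element being recorded by its
    coefficients [F]: u_k feeds the coefficient of [v] from the shorter permutation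
    [v \o sw k k.+1], hence the descent. *)
Definition cross_factor z k F v : R :=
  F v + (if descent v k then z * F (v \o sw k k.+1) else 0).

Lemma sum_sw N k (f : nat -> R) : (k.+1 < N)%N ->
  \sum_(j < N) f j = \sum_(j < N) f (sw k k.+1 j).
Proof.
move=> kN; have sN (j : 'I_N) : (sw k k.+1 j < N)%N by rewrite sw_lt //; lia.
rewrite (reindex_inj (h := fun j => Ordinal (sN j))) //=.
by move=> i j /(congr1 val) /= /sw_inj /val_inj.
Qed.

(** The signed form of [covers_descent]. At the excluded pairs the two sides differ by 1 or -1,
    which is the origin of [corr] in [monk_cross]. *)
Lemma cover_sign_descent v k r j : injective v ->
  r <> j -> ~ (r = k /\ j = k.+1) -> ~ (r = k.+1 /\ j = k) ->
  cover_sign v r j *+ descent (v \o sw r j) k =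
  cover_sign (v \o sw k k.+1) (sw k k.+1 r) (sw k k.+1 j) *+ descent v k.
Proof.
move=> vI rj n1 n2; wlog lt_rj: r j rj n1 n2 / (r < j)%N => [W|].
  case: (ltnP r j) => h; first exact: W.
  have := W j r; rewrite (swC j r) => {}W.
  have {}W : cover_sign v j r *+ descent (v \o sw r j) k =
    cover_sign (v \o sw k k.+1) (sw k k.+1 j) (sw k k.+1 r) *+ descent v k
    by apply: W; lia.
  have E w a b : cover_sign w a b = - cover_sign w b a.
    by rewrite /cover_sign; case: ltngtP; rewrite ?opprK ?oppr0.
  by rewrite E [in RHS]E !mulNrn W.
have nk : (r, j) != (k, k.+1).
  by apply/eqP => -[? ?]; apply: n1.
have lt' : (sw k k.+1 r < sw k k.+1 j)%N.
  by clear nk; case_sw k k.+1 r; case_sw k k.+1 j; subst; lia.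
rewrite /cover_sign lt_rj lt'; have := covers_descent vI lt_rj nk.
case: (covers v r j); case: (descent (v \o sw r j) k); case: (descent v k);
case: (covers (v \o sw k k.+1) _ _) => //= _; by rewrite ?mulr0n ?mul0rn.
Qed.

(** Conjugation by [sw k k.+1] matches the cover terms of both sides, except the one that swaps [k]
    and [k.+1] themselves. That one leaves [F v] with a sign, and its product with [e k.+1 - e k] is
    exactly the change from the eigenvalue [e r] to [e (sw k k.+1 r)]. *)
Lemma monk_cross N y F e k : (k.+1 < N)%N -> monk N y F e ->
  monk N y (cross_factor (e k.+1 - e k) k F) (e \o sw k k.+1).
Proof.
move=> kN MF v r vI rN; rewrite /cross_factor.
set z := _ - _; set s := sw k k.+1.
have vsI : injective (v \o s) by apply: inj_comp => //; exact: sw_inj.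
have ssr : s (s r) = r by rewrite /s swK.
have srN : (s r < N)%N by rewrite sw_lt //; lia.
have vk : v k <> v k.+1 by move/vI; lia.
have sw_s j : (v \o s) \o sw (s r) (s j) = v \o sw r j \o s.
  have -> : (v \o s) \o sw (s r) (s j) = v \o (s \o sw (s r) (s j)) by [].
  by rewrite -(sw_conj _ _ (@sw_inj k k.+1)) /s !swK.
pose corr : R := if r == k then 1 else if r == k.+1 then -1 else 0.
have term j :
  cover_sign v r j * F (v \o sw r j \o s) *+ descent (v \o sw r j) k =
  cover_sign (v \o s) (s r) (s j) * F ((v \o s) \o sw (s r) (s j))
    *+ descent v k + (if j == s r then corr * F v else 0).
  rewrite sw_s -!mulrnAl.
  have [[? ?]|n1] : (r = k /\ j = k.+1) \/ ~ (r = k /\ j = k.+1) by lia.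
    subst r j; rewrite /s !swl swr eqxx comp_swK /corr eqxx.
    rewrite /cover_sign ltnSn ltnNge leqnSn /= mul1r.
    have -> : covers v k k.+1 = ~~ descent v k.
      apply/coversP/idP => [[]|]; rewrite /descent; first lia.
      by move=> ?; split; lia.
    have -> : descent (v \o sw k k.+1) k = ~~ descent v k.
      by rewrite /descent /= swl swr; lia.
    have -> : covers (v \o sw k k.+1) k k.+1 = descent v k.
      apply/coversP/idP => [[]|]; rewrite /descent /= swl swr //.
      by move=> ?; split; lia.
    by case: (descent v k) => /=; rewrite ?mulr0n ?mulr1n; ring.
  have [[? ?]|n2] : (r = k.+1 /\ j = k) \/ ~ (r = k.+1 /\ j = k) by lia.
    subst r j; rewrite /s !swl swr eqxx (swC k.+1) comp_swK /corr eqxx.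
    rewrite /cover_sign ltnSn ltnNge leqnSn /= (_ : k.+1 == k = false); last by lia.
    have -> : covers v k k.+1 = ~~ descent v k.
      apply/coversP/idP => [[]|]; rewrite /descent; first lia.
      by move=> ?; split; lia.
    have -> : descent (v \o sw k k.+1) k = ~~ descent v k.
      by rewrite /descent /= swl swr; lia.
    have -> : covers (v \o sw k k.+1) k k.+1 = descent v k.
      apply/coversP/idP => [[]|]; rewrite /descent /= swl swr //.
      by move=> ?; split; lia.
    by case: (descent v k) => /=; rewrite ?mulr0n ?mulr1n; ring.
  have [rj|rj] := eqVneq r j.
    subst j; rewrite /cover_sign !ltnn /= !mul0rn !mul0r add0r /corr.
    case: eqP => // rs; case: eqP => [rk|_]; first by move: rs; rewrite /s rk swl; lia.
    case: eqP => [rk|_]; last by rewrite mul0r.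
    by move: rs; rewrite /s rk swr; lia.
  have -> : (if j == s r then corr * F v else 0) = 0.
    case: eqP => // js; rewrite /corr; move: js n1 n2; rewrite /s.
    by case_sw k k.+1 r => js n1 n2; subst; [lia|lia|move: rj; rewrite eqxx].
  by rewrite addr0 cover_sign_descent //; apply/eqP.
have desc_ifE (b : bool) (a : R) : (if b then a else 0) = a *+ b by case: b.
have -> : \sum_(j < N) cover_sign v r j * (F (v \o sw r j) +
    (if descent (v \o sw r j) k then z * F (v \o sw r j \o s) else 0)) =
  \sum_(j < N) cover_sign v r j * F (v \o sw r j) +
  z * (\sum_(j < N) (cover_sign (v \o s) (s r) j * F ((v \o s) \o sw (s r) j)
    *+ descent v k) + corr * F v).
  rewrite (sum_sw (fun j => cover_sign (v \o s) (s r) j *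
    F ((v \o s) \o sw (s r) j) *+ descent v k) kN).
  have -> : corr * F v = \sum_(j < N) (if j == s r :> nat then corr * F v else 0).
    by rewrite -big_mkcond /= (big_pred1 (Ordinal srN)) // => j; rewrite -val_eqE.
  rewrite -big_split mulr_sumr -big_split; apply: eq_bigr => j _ /=.
  by rewrite -term desc_ifE; case: (descent _ _); rewrite ?mulr0n ?mulr1n; ring.
have -> : \sum_(j < N) (cover_sign (v \o s) (s r) j * F ((v \o s) \o sw (s r) j)
    *+ descent v k) = (e (s r) - y (v r)) * F (v \o s) *+ descent v k.
  by rewrite sumrMnl mulrBl (MF (v \o s)) //= ssr; congr (_ *+ _); ring.
have Ev := MF v r vI rN; rewrite desc_ifE.
have Ec : e (s r) * F v = e r * F v + z * (corr * F v).
  rewrite /corr /z; have [->|rk] := eqVneq r k; first by rewrite /s swl; ring.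
  have [->|rk1] := eqVneq r k.+1; first by rewrite /s swr; ring.
  have -> : s r = r by move/eqP: rk; move/eqP: rk1; rewrite /s; case_sw k k.+1 r; lia.
  by ring.
transitivity (e (s r) * F v + z * (e (s r) * F (v \o s) *+ descent v k)).
  by case: (descent v k); rewrite /= ?mulr0n ?mulr1n; ring.
by rewrite Ec Ev; case: (descent _ _); rewrite ?mulr0n ?mulr1n; ring.
Qed.

(** A cover term survives only if [v \o sw r j] is the identity, but then [v] is inverted at these
    two positions and swapping them is not a cover. *)
Lemma monk_base N y : monk N y (fun v => (all (fun i => v i == i) (iota 0 N))%:R) y.
Proof.
move=> v r vI rN; rewrite big1 => [|j _].
  have [/allP vid|_] := boolP (all _ _); last by rewrite !mulr0 addr0.
  by rewrite (eqP (vid r _)) ?addr0 // mem_iota.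
have [/allP vid|_] := boolP (all _ _); last by rewrite mulr0.
have Er := eqP (vid r _); have Ej := eqP (vid j _); rewrite /= !mem_iota in Er Ej.
rewrite swl in Er; rewrite swr in Ej.
have {Er} Er := Er rN; have {Ej} Ej := Ej (ltn_ord j).
rewrite /cover_sign; case: ltngtP => [rj|jr|_]; rewrite ?mul0r //.
- by rewrite (_ : covers _ _ _ = false) ?mul0r //; apply/negP => /coversP[]; lia.
- by rewrite (_ : covers _ _ _ = false) ?oppr0 ?mul0r //; apply/negP => /coversP[]; lia.
Qed.

(** Exchanges the last eigenvalue with its left neighbour [d] times. The initial spectrum [e] can be
    used throughout, since the places still to be entered have not changed. *)
Fixpoint slide N e d F : (nat -> nat) -> R :=
  if d is d'.+1 then
    cross_factor (e N.-1 - e (N.-2 - d')%N) (N.-2 - d') (slide N e d' F)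
  else F.

Definition slide_eigen N e d p : R :=
  if (p < N.-1 - d)%N then e p else if p == (N.-1 - d)%N then e N.-1 else e p.-1.

Lemma monk_slide N y e d F : (d <= N.-1)%N -> monk N y F e ->
  monk N y (slide N e d F) (slide_eigen N e d).
Proof.
elim: d => [|d IH] dN MF /=.
  move=> v r vI rN; rewrite /slide_eigen subn0.
  have -> : (if (r < N.-1)%N then e r else if r == N.-1 then e N.-1 else e r.-1) = e r.
    by case: ltnP => // ?; case: eqP => [->|] //; lia.
  exact: MF.
have kN : ((N.-2 - d).+1 < N)%N by lia.
have := monk_cross kN (IH (ltnW dN) MF).
have [E1 E2] : (N.-1 - d = (N.-2 - d).+1)%N /\ (N.-1 - d.+1 = N.-2 - d)%N by lia.
have -> : slide_eigen N e d (N.-2 - d).+1 = e N.-1.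
  by rewrite /slide_eigen E1 ltnn eqxx.
have -> : slide_eigen N e d (N.-2 - d) = e (N.-2 - d)%N.
  by rewrite /slide_eigen E1 ltnSn.
rewrite (_ : slide_eigen N e d \o _ = slide_eigen N e d.+1) //.
apply: functional_extensionality => p; rewrite /slide_eigen /=.
rewrite E1 E2; set k := (N.-2 - d)%N.
case: (swE k k.+1 p) => [[-> ->]|[_ -> ->]|[pk pk1 ->]].
- by rewrite ltnn !eqxx ltnn.
- by rewrite ltnSn ltnNge leqnSn (gtn_eqF (ltnSn k)).
- case: (ltngtP p k) => // h.
    by rewrite ltnS ltnW.
  by rewrite ltnS leqNgt h /= (introF eqP pk1).
Qed.

(** * The product over all rows and its spectrum *)

Variables (n : nat) (x : nat -> R).

Fixpoint word_sum (l : seq (nat * nat)) v : R :=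
  if l is c :: l' then cross_factor (x c.1) c.2 (word_sum l') v
  else (all (fun i => v i == i) (iota 0 n))%:R.

(* Words are listed in reverse: the head is the letter read last. *)
Definition row_letters i k : seq (nat * nat) :=
  [seq (i, k') | k' <- iota k (n.-1 - k)].

Fixpoint letters_above i : seq (nat * nat) :=
  if i is i'.+1 then row_letters i' i' ++ letters_above i' else [::].

Definition perm_on_nat v := injective v /\ forall i, (n <= i)%N -> v i = i.

Lemma perm_on_nat_lt v i : perm_on_nat v -> (v i < n)%N = (i < n)%N.
Proof.
case=> vI vn; have [lt_in|le_ni] := ltnP i n; last by rewrite vn // ltnNge le_ni.
by rewrite ltnNge; apply/negP => h; have /vI := vn _ h; lia.
Qed.

Lemma perm_on_nat_sw v a b : (a < n)%N -> (b < n)%N -> perm_on_nat v ->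
  perm_on_nat (v \o sw a b).
Proof.
move=> an bn [vI vn]; split=> [|i ni /=]; first exact: inj_comp vI (@sw_inj a b).
by rewrite /sw; do 2!(case: eqP => [?|_]; first lia); apply: vn.
Qed.

(* The eigenvalues before row [i]: the spectrum (0^n, x_(n-1), ..., x_0)
   with x_0, ..., x_(i-1) already moved to the front. *)
Definition row_eigen i p : R :=
  if (p < i)%N then x p else if (p < i + n)%N then 0 else x (i + (n.*2.-1 - p)).

(** Row [i'] slides x_i', at that time the last eigenvalue, to position [i']. At letters below
    [n.-1] it passes only zeros, so the factor there is x_i' itself; differences of two variables
    occur only at letters from [n] on. *)
Fixpoint full_sum i : (nat -> nat) -> R :=
  if i is i'.+1 then slide n.*2 (row_eigen i') (n.*2.-1 - i') (full_sum i')
  else fun v => (all (fun j => v j == j) (iota 0 n.*2))%:R.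

Lemma monk_full_sum i : (i <= n)%N ->
  monk n.*2 (row_eigen 0) (full_sum i) (row_eigen i).
Proof.
elim: i => [|i IH] le_in /=; first exact: monk_base.
have := monk_slide (leq_subr i n.*2.-1) (IH (ltnW le_in)).
have E p : (p < n.*2)%N ->
    slide_eigen n.*2 (row_eigen i) (n.*2.-1 - i) p = row_eigen i.+1 p.
  move=> pN; rewrite /slide_eigen /row_eigen (_ : n.*2.-1 - (n.*2.-1 - i) = i)%N; last by lia.
  case: (ltngtP p i) => [h|h|->]; first by rewrite (_ : (p < i.+1)%N) //; lia.
  - rewrite (_ : (p < i.+1)%N = false); last by lia.
    rewrite (_ : (p.-1 < i)%N = false); last by lia.
    rewrite (_ : (p.-1 < i + n)%N = (p < i.+1 + n)%N); last by lia.
    by case: ifP => // _; congr x; lia.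
  - rewrite ltnSn (_ : (n.*2.-1 < i)%N = false); last by lia.
    by rewrite (_ : (n.*2.-1 < i + n)%N = false); [congr x; lia | lia].
by move=> M v r vI rN; rewrite -E // M.
Qed.

(* Letters [k >= n.-1] have no effect at [v], as [v] fixes all [i >= n] and so
   has no descent there. *)
Lemma full_sum_word i v : (i <= n)%N -> perm_on_nat v ->
  full_sum i v = word_sum (letters_above i) v.
Proof.
elim: i v => [|i IH] v le_in pv /=.
  congr (_%:R); congr (nat_of_bool _).
  rewrite -addnn iotaD all_cat [X in _ && X](_ : _ = true) ?andbT //.
  by apply/allP => j; rewrite mem_iota => hj; rewrite pv.2 //; lia.
have -> : row_letters i i = row_letters i (n.*2.-1 - (n.*2.-1 - i)).
  by congr row_letters; lia.
have : (n.*2.-1 - i <= n.*2.-1 - i)%N by [].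
elim: {1 3 4}(n.*2.-1 - i)%N v pv => [|d IHd] v pv le_d /=.
  rewrite (IH v (ltnW le_in) pv) subn0 /row_letters.
  by have -> : (n.-1 - n.*2.-1)%N = 0%N by lia.
rewrite /cross_factor (IHd v pv (ltnW le_d)).
set k := (n.*2.-2 - d)%N.
have [-> ->] : (n.*2.-1 - d.+1 = k)%N /\ (n.*2.-1 - d = k.+1)%N by lia.
have [lt_kn|le_nk] := ltnP k n.-1; last first.
  have -> : descent v k = false.
    rewrite /descent (pv.2 k.+1); last lia.
    by have := perm_on_nat_lt k pv; have := pv.2 k; lia.
  rewrite addr0 /row_letters.
  by have [-> ->] : (n.-1 - k = 0)%N /\ (n.-1 - k.+1 = 0)%N by lia.
rewrite /row_letters (_ : n.-1 - k = (n.-1 - k.+1).+1)%N /=; last lia.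
rewrite /cross_factor /= -/(row_letters i k.+1) IHd; last first.
- exact: ltnW.
- by apply: perm_on_nat_sw pv; lia.
rewrite (_ : n.*2.-1 - d = k.+1)%N; last by lia.
have -> : row_eigen i n.*2.-1 = x i.
  rewrite /row_eigen; have [-> ->] :
    (n.*2.-1 < i)%N = false /\ (n.*2.-1 < i + n)%N = false by lia.
  by rewrite subnn addn0.
have -> : row_eigen i k = 0.
  by rewrite /row_eigen; have [-> ->] : (k < i)%N = false /\ (k < i + n)%N by lia.
by rewrite subr0.
Qed.

(** The position [s] keeps the sum within the first [n] positions: a cover of [r] with some [n + j]
    would have the value [v s] in between. *)
Theorem monk_word_sum v r s : perm_on_nat v -> (r < s < n)%N -> (v r < v s)%N ->
  x r * word_sum (letters_above n) v =
  \sum_(j < n) cover_sign v r j * word_sum (letters_above n) (v \o sw r j).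
Proof.
move=> pv rsn vrs.
have [r_n r_n2] : (r < n)%N /\ (r < n.*2)%N by lia.
have vr_n : (v r < n)%N by rewrite perm_on_nat_lt.
have -> : x r = row_eigen n r by rewrite /row_eigen r_n.
rewrite -(full_sum_word (leqnn n) pv) (monk_full_sum (leqnn n) pv.1 r_n2).
have -> : row_eigen 0 (v r) = 0 by rewrite /row_eigen ltn0 add0n vr_n.
rewrite mul0r add0r -addnn big_split_ord /= [X in _ + X]big1 ?addr0 => [|j _].
  apply: eq_bigr => j _; rewrite full_sum_word //.
  by apply: perm_on_nat_sw pv => //; exact: ltn_ord.
have -> : cover_sign v r (n + j)%N = 0; last by rewrite mul0r.
rewrite /cover_sign ltn_addr //.
rewrite (_ : covers v r (n + j) = false) //; apply/negP => /coversP[_ /(_ s)].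
rewrite (pv.2 (n + j)%N) ?leq_addr // => H; apply: H; first by lia.
by have := perm_on_nat_lt s pv; lia.
Qed.
End Monk.

(** * Sequences of adjacent swaps *)

(* The swapped pairs are logged, latest first. *)
Inductive chain (L : seq nat) : seq (nat * nat) -> seq nat -> Prop :=
| ChainNil : chain L [::] L
| ChainCons A q p Z lg :
    chain L lg (A ++ q :: p :: Z) -> chain L ((q, p) :: lg) (A ++ p :: q :: Z).

Definition before (L : seq nat) a b : bool := (index a L < index b L)%N.

Definition ascents (lg : seq (nat * nat)) : bool := all (fun e => e.1 < e.2)%N lg.

Definition joins a b (e : nat * nat) : bool := (e == (a, b)) || (e == (b, a)).

Lemma uniq_adjacent (A : seq nat) q p Z :
  uniq (A ++ q :: p :: Z) -> [/\ q \notin A, p \notin A & q != p].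
Proof.
rewrite cat_uniq cons_uniq inE /= !negb_or => /and3P[_ /and3P[qA pA _]].
by case/andP=> /andP[qp _] _; split.
Qed.

Lemma before_adjacent A q p Z : uniq (A ++ q :: p :: Z) ->
  before (A ++ q :: p :: Z) q p /\ ~~ before (A ++ q :: p :: Z) p q.
Proof.
case/uniq_adjacent => qA pA qp.
rewrite /before !index_cat /= (negPf qA) (negPf pA) !eqxx (negPf qp).
by rewrite ltn_add2l -leqNgt leq_add2l.
Qed.

Lemma index_swap (A : seq nat) q p Z c : uniq (A ++ q :: p :: Z) ->
  index c (A ++ p :: q :: Z) =
  sw (size A) (size A).+1 (index c (A ++ q :: p :: Z)).
Proof.
case/uniq_adjacent => qA pA qp; rewrite !index_cat /=.
case: ifP => [cA|_].
  have : (index c A < size A)%N by rewrite index_mem.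
  by case_sw (size A) (size A).+1 (index c A); lia.
have [<-|pc] := eqVneq p c; first by rewrite (negPf qp) addn0 addn1 swr.
have [_|qc] := eqVneq q c; first by rewrite addn0 addn1 swl.
by case_sw (size A) (size A).+1 (size A + (index c Z).+2)%N; lia.
Qed.

Lemma before_swap A q p Z a b : uniq (A ++ q :: p :: Z) ->
  before (A ++ p :: q :: Z) a b =
  ((a == p) && (b == q)) ||
  (~~ ((a == q) && (b == p)) && before (A ++ q :: p :: Z) a b).
Proof.
move=> u; rewrite /before !(index_swap _ u); have [qA pA qp] := uniq_adjacent u.
set L := A ++ _.
have Eq c : (c == q) = (index c L == size A).
  rewrite /L index_cat /=; case: ifP => [cA|_].
    rewrite [RHS]ltn_eqF ?index_mem //; apply: contraNF qA => /eqP<- //.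
  by rewrite eq_sym; case: (q == c); rewrite ?addn0 ?eqxx //; case: ifP => _; lia.
have Ep c : (c == p) = (index c L == (size A).+1).
  rewrite /L index_cat /=; case: ifP => [cA|_].
    by rewrite [RHS]ltn_eqF ?ltnS ?index_size //; apply: contraNF pA => /eqP<-.
  rewrite (eq_sym c); have [<-|_] := eqVneq p c; first by rewrite (negPf qp); lia.
  by case: (q == c); lia.
rewrite !Eq !Ep; move: (index a L) (index b L) => i j.
by case_sw (size A) (size A).+1 i; case_sw (size A) (size A).+1 j; subst; lia.
Qed.

Lemma chain_perm L lg L' : chain L lg L' -> perm_eq L L'.
Proof.
elim=> {lg L'} [|A q p Z lg _ /permPl->] //; rewrite perm_cat2l.
by apply/permPl; exact: (perm_catCA [:: q] [:: p] Z).
Qed.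

Lemma chain_uniq L lg L' : chain L lg L' -> uniq L -> uniq L'.
Proof. by move/chain_perm/perm_uniq->. Qed.

Lemma chain_cat L l1 L1 l2 L2 :
  chain L l1 L1 -> chain L1 l2 L2 -> chain L (l2 ++ l1) L2.
Proof.
move=> c1; elim=> {l2 L2} [|A q p Z lg _ IH] //=; exact: ChainCons.
Qed.

Lemma chain_parity L lg L' a b : uniq L -> chain L lg L' ->
  a \in L -> a != b ->
  before L' a b = before L a b (+) odd (count (joins a b) lg).
Proof.
move=> uL + aL ab; elim=> {lg L'} [|A q p Z lg cL IH] /=; first by rewrite addbF.
have u' := chain_uniq cL uL; have [bqp nbpq] := before_adjacent u'.
rewrite before_swap // oddD addbCA -IH oddb /joins !xpair_eqE.
case: (eqVneq a p) => [?|ap]; case: (eqVneq b q) => [?|bq];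
case: (eqVneq a q) => [?|aq]; case: (eqVneq b p) => [?|bp] //=; subst;
rewrite ?eqxx in ab * => //; rewrite ?(eq_sym p) ?(eq_sym q) //=.
all: try by rewrite ?bqp ?(negPf nbpq) ?(negPf ap) ?(negPf aq) ?(negPf bp) ?(negPf bq) ?andbF //=.
Qed.

Lemma sorted_before L a b : sorted ltn L -> a \in L -> b \in L ->
  before L a b = (a < b)%N.
Proof.
move=> sL aL bL; have S := sorted_ltn_index ltn_trans sL.
rewrite /before; case: (ltngtP a b) => [ab|ba|->]; last by rewrite ltnn.
- case: (ltngtP (index a L) (index b L)) => // [/(S _ _ bL aL)|E]; first by move=> /= h; lia.
  by move: ab; rewrite -(nth_index 0%N aL) -(nth_index 0%N bL) E ltnn.
- case: (ltngtP (index a L) (index b L)) => // /(S _ _ aL bL) /= h; lia.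
Qed.

(** A pair begins in increasing order, so its first swap is an ascent and a second one would be a
    descent. This serves both kinds of pipe dreams. *)
Lemma chain_reduced L lg L' : sorted ltn L -> chain L lg L' ->
  reflect (forall a b, a \in L -> b \in L -> a != b -> (count (joins a b) lg <= 1)%N)
          (ascents lg).
Proof.
move=> sL cL; have uL : uniq L by apply: (sorted_uniq ltn_trans ltnn).
apply: (iffP idP).
  move=> al a b; wlog ab : a b / (a < b)%N => [W|].
    case: (ltngtP a b) => [ab|ba|-> //] aL bL _.
      by apply: W => //; lia.
    rewrite (eq_count (a2 := joins b a)); last by move=> e; rewrite /joins orbC.
    by apply: W => //; lia.
  move=> aL bL _; have ba : b != a by lia.
  (* With ascents only, the number of swaps of [a < b] is the truth value of their being out of
     order. *)
  suff -> : count (joins a b) lg = before L' b a by case: before.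
  elim: cL al => {lg L'} [_|A q p Z lg cL IH /andP[/= qp al]] /=.
    by rewrite sorted_before // ltnNge ltnW.
  have u1 := chain_uniq cL uL; have [bqp nbpq] := before_adjacent u1.
  have nba : ((q == b) && (p == a)) = false.
    by apply/negP => /andP[/eqP qb /eqP pa]; rewrite qb pa ltnNge ltnW in qp.
  rewrite IH // [in RHS]before_swap // /joins !xpair_eqE nba orbF.
  rewrite (eq_sym b q) (eq_sym a p) nba /= (eq_sym b p) (eq_sym a q) andbC.
  case: (eqVneq p b) => [?|//]; case: (eqVneq q a) => [?|//]; subst.
  by rewrite (negPf nbpq).
move=> H; elim: cL H => {lg L'} [//|A q p Z lg cL IH] H /=.
have u1 := chain_uniq cL uL; have [bqp nbpq] := before_adjacent u1.
have mL c : c \in [:: q; p] -> c \in L.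
  by rewrite (perm_mem (chain_perm cL)) mem_cat !inE => /orP[]/eqP->; rewrite eqxx ?orbT.
have [qL pL] : q \in L /\ p \in L by rewrite !mL // !inE eqxx ?orbT.
have qp : q != p by case/uniq_adjacent: u1.
have -> : ascents lg.
  by apply: IH => a b aL bL ab; apply: leq_trans (H a b aL bL ab); rewrite /= leq_addl.
(* The head swap uses up the only one allowed for [q] and [p], so before it they still stand in
   their initial, increasing order. *)
have := chain_parity uL cL qL qp; rewrite bqp sorted_before // andbT.
have := H q p qL pL qp; rewrite /= {1}/joins eqxx /= -[X in (_ <= X)%N]addn0 leq_add2l.
by rewrite leqn0 => /eqP->; rewrite addbF.
Qed.

(** * Renaming one label *)

Definition replace (u a c : nat) := if c == u then a else c.

Definition between_before a u (L : seq nat) : bool :=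
  all (fun c => (a < c < u)%N ==> before L c u) L.

Lemma between_beforeP a u L :
  reflect (forall c, c \in L -> (a < c < u)%N -> before L c u) (between_before a u L).
Proof.
apply: (iffP allP) => H c cL; last by apply/implyP; apply: H.
by move=> acu; apply: (implyP (H c cL)).
Qed.

(** An equality of conjunctions, so that the invariant can be carried along the log from the first
    list to the last. *)
Lemma between_before_swap a u A q p Z : uniq (A ++ q :: p :: Z) -> (a < u)%N ->
  a \notin A ++ q :: p :: Z ->
  let L := A ++ q :: p :: Z in let L' := A ++ p :: q :: Z in
  ((replace u a q < replace u a p)%N && between_before a u L) =
  ((q < p)%N && between_before a u L').
Proof.
move=> uL au aL L L'; have [qA pA qp] := uniq_adjacent uL.
have [bqp nbpq] := before_adjacent uL.
have qL : q \in L by rewrite mem_cat !inE eqxx !orbT.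
have pL : p \in L by rewrite mem_cat !inE eqxx !orbT.
have qa : q <> a by move=> E; case/negP: aL; rewrite -E.
have pa : p <> a by move=> E; case/negP: aL; rewrite -E.
have mL c : (c \in L') = (c \in L) by rewrite !mem_cat !inE; congr (_ || _); rewrite orbCA.
have sw_before c : before L' c u =
    ((c == p) && (u == q)) || (~~ ((c == q) && (u == p)) && before L c u).
  exact: before_swap.
have qp' : (q == p) = false by rewrite (negPf qp).
have pq' : (p == q) = false by rewrite eq_sym.
apply/andP/andP => -[lt_qp /between_beforeP H]; rewrite /replace in lt_qp *.
- case: (eqVneq q u) lt_qp => [?|qu].
    subst q; rewrite pq' => lt_ap.
    (* As [p] stands right after [u], it is not among the labels that must precede [u]. *)
    have up : (u < p)%N.
      rewrite ltn_neqAle qp leqNgt; apply/negP => pu.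
      by move/negP: nbpq; apply; apply: H => //; rewrite lt_ap.
    split=> //; apply/between_beforeP => c; rewrite mL => cL acu.
    have -> : before L' c u = _ := sw_before c.
    by rewrite H // (ltn_eqF (_ : c < u)%N) ?orbT //; case/andP: acu.
  case: (eqVneq p u) => [?|pu] lt_qp.
    subst p; split; first exact: ltn_trans au.
    apply/between_beforeP => c; rewrite mL => cL acu; rewrite sw_before H // eqxx !andbT.
    rewrite (gtn_eqF (_ : q < c)%N) ?orbT //.
    by case/andP: acu => ac _; apply: ltn_trans ac.
  split=> //; apply/between_beforeP => c; rewrite mL => cL acu.
  by rewrite sw_before H // (eq_sym u p) (negPf pu) andbF orbT.
- have sw_before' c : (a < c < u)%N -> c \in L ->
      ((c == p) && (u == q)) || (~~ ((c == q) && (u == p)) && before L c u).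
    by move=> acu cL; rewrite -sw_before; apply: H; rewrite ?mL.
  case: (eqVneq q u) => [?|qu].
    subst q; rewrite pq'; split; first exact: ltn_trans lt_qp.
    apply/between_beforeP => c cL acu; move: (sw_before' c acu cL).
    rewrite (ltn_eqF (_ : c < p)%N) /=; first by case/andP.
    by case/andP: acu => _ /ltn_trans; apply.
  case: (eqVneq p u) => [?|pu].
    subst p; split.
      rewrite ltn_neqAle (introF eqP qa) leqNgt; apply/negP => aq.
      by have := sw_before' q; rewrite !eqxx qp' aq lt_qp qL => /(_ isT isT).
    apply/between_beforeP => c cL acu; move: (sw_before' c acu cL).
    by rewrite (eq_sym u) (negPf qu) andbF => /andP[].
  split=> //; apply/between_beforeP => c cL acu; move: (sw_before' c acu cL).
  by rewrite (eq_sym u) (negPf qu) andbF => /andP[].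
Qed.

(** Comparisons with [u] and with [a] differ only for labels strictly between them. Those start to
    the left of [u], and crossing one of them is an ascent for [u] but a descent for [a]. So the
    renaming keeps all ascents exactly when none of them gets past [u], which can be read off the
    final list. *)
Lemma chain_replace a u L lg L' : uniq L -> (a < u)%N -> a \notin L ->
  between_before a u L -> chain L lg L' ->
  ascents [seq (replace u a e.1, replace u a e.2) | e <- lg] =
  ascents lg && between_before a u L'.
Proof.
move=> uL au aL bL; elim=> {lg L'} [|A q p Z lg cL IH] /=; first by rewrite bL.
rewrite IH andbCA -andbA; case: (ascents lg) => //=; last by rewrite andbF.
apply: between_before_swap => //; first exact: chain_uniq cL uL.
by rewrite -(perm_mem (chain_perm cL)).
Qed.

(** * Bumpless pipe dreams row by row *)

Definition out_north t (h b : option nat) : option nat :=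
  match t with Cross | Vertical => b | JTile => h | _ => None end.

Definition out_east t (h b : option nat) : option nat :=
  match t with Cross | Horizontal => h | RTile => b | _ => None end.

Definition fits t (h b : option nat) : bool :=
  [&& t != Elbows, meets t West == isSome h & meets t South == isSome b].

(* A row is read from left to right: [h] is the label on the west edge of
   the current cell and [g] lists the labels on the south edges. *)
Fixpoint row_top h (g : seq (option nat)) ts : seq (option nat) :=
  match g, ts with
  | b :: g', t :: ts' => out_north t h b :: row_top (out_east t h b) g' ts'
  | _, _ => [::]
  end.

Fixpoint row_out h (g : seq (option nat)) ts : option nat :=
  match g, ts with
  | b :: g', t :: ts' => row_out (out_east t h b) g' ts'
  | _, _ => h
  end.

Fixpoint row_fits h (g : seq (option nat)) ts : bool :=
  match g, ts with
  | b :: g', t :: ts' => fits t h b && row_fits (out_east t h b) g' ts'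
  | [::], [::] => true
  | _, _ => false
  end.

Fixpoint row_log h (g : seq (option nat)) ts : seq (nat * nat) :=
  match g, ts with
  | b :: g', t :: ts' => row_log (out_east t h b) g' ts' ++
      (if t == Cross then [:: (odflt 0%N h, odflt 0%N b)] else [::])
  | _, _ => [::]
  end.

(* Rows are listed from bottom to top, so that row [size rs] comes before
   the rows [rs] above it. *)
Fixpoint grid_fits (rs : seq (seq tile)) (g : seq (option nat)) : bool :=
  if rs is ts :: rs' then
    [&& row_fits None g ts, isSome (row_out None g ts)
      & grid_fits rs' (row_top None g ts)]
  else all (pred1 None) g.

Fixpoint grid_log (rs : seq (seq tile)) (g : seq (option nat)) :=
  if rs is ts :: rs' then grid_log rs' (row_top None g ts) ++ row_log None g ts
  else [::].

Fixpoint grid_exits (rs : seq (seq tile)) (g : seq (option nat)) : seq nat :=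
  if rs is ts :: rs' then
    rcons (grid_exits rs' (row_top None g ts)) (odflt 0%N (row_out None g ts))
  else [::].

(** The list is read along a lattice path: the north edges [P] already passed, the current vertical
    edge [h], the south edges [g] ahead, then the exits [X] of lower rows. Moving the path across a
    cell changes the order of the labels only at a cross. *)
Lemma row_chain h g ts (P : seq (option nat)) (X : seq nat) : row_fits h g ts ->
  chain (pmap id (P ++ h :: g) ++ X) (row_log h g ts)
        (pmap id (P ++ rcons (row_top h g ts) (row_out h g ts)) ++ X).
Proof.
elim: g h ts P => [|b g IH] h [|t ts] P //=; first by move=> _; exact: ChainNil.
case/andP=> fit rf; have := IH _ ts (rcons P (out_north t h b)) rf.
rewrite !cat_rcons /= => c; apply: chain_cat c.
case: t fit {rf} => /=; case: h => [q|]; case: b => [p|] //= _;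
  rewrite ?pmap_cat /=; try exact: ChainNil.
rewrite -!catA /=; apply: ChainCons; exact: ChainNil.
Qed.

Lemma grid_chain rs g (X : seq nat) : grid_fits rs g ->
  chain (pmap id g ++ X) (grid_log rs g) (grid_exits rs g ++ X).
Proof.
elim: rs g X => [|ts rs IH] g X /=.
  move/all_pred1P->; rewrite (_ : pmap id _ = [::]); first exact: ChainNil.
  by elim: (size g).
case/and3P => rf; case Eo: (row_out None g ts) => [e|//] _ /IH c.
rewrite cat_rcons; have := row_chain [::] X rf; rewrite /= Eo -cats1 pmap_cat /=.
by rewrite -catA => c1; apply: chain_cat c1 (c _).
Qed.

Lemma size_row_top h g ts : size ts = size g -> size (row_top h g ts) = size g.
Proof. by elim: g h ts => [|b g IH] h [|t ts] //= [/IH->]. Qed.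

Lemma grid_perm rs g : grid_fits rs g -> perm_eq (pmap id g) (grid_exits rs g).
Proof. by move/(grid_chain [::])/chain_perm; rewrite !cats0. Qed.

Section RowReplace.
Variables u a : nat.
Let f := replace u a.
Let fo := omap f.

Lemma fits_omap t h b : fits t (fo h) (fo b) = fits t h b.
Proof. by case: h => [?|]; case: b => [?|]. Qed.

Lemma out_north_omap t h b : out_north t (fo h) (fo b) = fo (out_north t h b).
Proof. by case: t. Qed.

Lemma out_east_omap t h b : out_east t (fo h) (fo b) = fo (out_east t h b).
Proof. by case: t. Qed.

Lemma row_omap h g ts :
  [/\ row_fits (fo h) (map fo g) ts = row_fits h g ts,
      row_top (fo h) (map fo g) ts = map fo (row_top h g ts)
    & row_out (fo h) (map fo g) ts = fo (row_out h g ts)].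
Proof.
elim: g h ts => [|b g IH] h [|t ts] //=.
by rewrite out_east_omap fits_omap out_north_omap; case: (IH (out_east t h b) ts) => -> -> ->.
Qed.

Lemma row_log_omap h g ts : row_fits h g ts ->
  row_log (fo h) (map fo g) ts = [seq (f e.1, f e.2) | e <- row_log h g ts].
Proof.
elim: g h ts => [|b g IH] h [|t ts] //= /andP[fit rf].
rewrite out_east_omap map_cat IH //; congr (_ ++ _).
by case: t fit {rf} => //; case: h => [?|]; case: b => [?|].
Qed.

Lemma grid_omap rs g : grid_fits rs (map fo g) = grid_fits rs g.
Proof.
elim: rs g => [|ts rs IH] g /=; first by rewrite all_map; apply: eq_all => -[].
have [E1 E2 E3] := row_omap None g ts; rewrite /= in E1 E2 E3.
by rewrite E1 E2 E3 IH; case: row_out.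
Qed.

Lemma grid_log_omap rs g : grid_fits rs g ->
  grid_log rs (map fo g) = [seq (f e.1, f e.2) | e <- grid_log rs g] /\
  grid_exits rs (map fo g) = map f (grid_exits rs g).
Proof.
elim: rs g => [//|ts rs IH] g /= /and3P[rf].
have [E1 E2 E3] := row_omap None g ts; rewrite /= in E1 E2 E3.
rewrite E2 E3 (row_log_omap (h := None)) //.
by case: row_out => [e|//] _ /IH[-> ->]; rewrite map_cat map_rcons.
Qed.
End RowReplace.

(** * Weight sums over reduced tilings *)

Section BpdSum.
Variables (R : comRingType) (x : nat -> R).

(** The labels on the west and south edges of a cell leave at most two tiles: a blank, a turn or a
    straight segment, or an ascending cross. The continuation [K] receives the labels leaving the
    row, so that a row can be cut into ranges of columns and the rows above plugged in. *)
Fixpoint row_sum (z : R) h (g : seq (option nat)) (K : seq (option nat) -> option nat -> R)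
  {struct g} : R :=
  match g with
  | [::] => K [::] h
  | b :: g' =>
    let go h' top := row_sum z h' g' (fun tops e => K (top :: tops) e) in
    match h, b with
    | None, None => z * go None None
    | None, Some _ => go b None + go None b
    | Some _, None => go h None + go None h
    | Some q, Some p => if (q < p)%N then go h b else 0
    end
  end.

Lemma sum_tupleS (T : finType) m (F : seq T -> R) :
  \sum_(t : m.+1.-tuple T) F t = \sum_(a : T) \sum_(t : m.-tuple T) F (a :: t).
Proof.
rewrite pair_big /=.
rewrite (reindex (fun p : T * m.-tuple T => [tuple of p.1 :: p.2])) //=.
exists (fun t : m.+1.-tuple T => (thead t, [tuple of behead t])) => [[a t] _|t _] /=.
  by congr (_, _); apply: val_inj.
by rewrite -tuple_eta.
Qed.

Lemma sum_tuple0 (T : finType) (F : seq T -> R) : \sum_(t : 0.-tuple T) F t = F [::].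
Proof.
by rewrite (big_pred1 [tuple]) // => t; rewrite (tuple0 t) /= eqxx.
Qed.

Lemma sum_tile (F : tile -> R) : \sum_t F t =
  F Cross + F Horizontal + F Vertical + F RTile + F JTile + F Blank + F Elbows.
Proof.
rewrite -big_enum /= enumT.
have -> : Finite.enum tile =
    [:: Cross; Horizontal; Vertical; RTile; JTile; Blank; Elbows] by rewrite unlock.
by rewrite !big_cons big_nil addr0 !addrA.
Qed.

Lemma row_sumE z h g K : row_sum z h g K =
  \sum_(ts : (size g).-tuple tile)
    (if row_fits h g ts && ascents (row_log h g ts)
     then z ^+ count_mem Blank ts * K (row_top h g ts) (row_out h g ts) else 0).
Proof.
elim: g h K => [|b g IH] h K /=.
  by rewrite (sum_tuple0 (fun ts => if row_fits h [::] ts && ascents (row_log h [::] ts)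
     then z ^+ count_mem Blank ts * K (row_top h [::] ts) (row_out h [::] ts) else 0)) /= mul1r.
rewrite (sum_tupleS _ (fun ts => if row_fits h (b :: g) ts && ascents (row_log h (b :: g) ts)
     then z ^+ count_mem Blank ts * K (row_top h (b :: g) ts) (row_out h (b :: g) ts) else 0)).
rewrite sum_tile /=.
case: h => [q|]; case: b => [p|]; rewrite /fits /= ?big1_eq ?addr0 ?add0r ?IH.
- case: ifP => qp.
    by apply: eq_bigr => ts _; rewrite /ascents all_cat /= qp !andbT.
  by rewrite big1 // => ts _; rewrite /ascents all_cat /= qp !andbF.
- by congr (_ + _); apply: eq_bigr => ts _; rewrite cats0.
- by rewrite addrC; congr (_ + _); apply: eq_bigr => ts _; rewrite cats0.
- rewrite mulr_sumr; apply: eq_bigr => ts _; rewrite cats0 add1n exprS.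
  by case: ifP => _; rewrite ?mulr0 ?mulrA.
Qed.

Fixpoint grid_wt (rs : seq (seq tile)) : R :=
  if rs is ts :: rs' then x (size rs') ^+ count_mem Blank ts * grid_wt rs' else 1.

Definition grid_reduced (rs : seq (seq tile)) g (rho : nat -> nat) : bool :=
  [&& grid_fits rs g, ascents (grid_log rs g)
    & grid_exits rs g == [seq rho i | i <- iota 0 (size rs)]].

Definition bpd_sum n r g rho : R :=
  \sum_(rs : r.-tuple (n.-tuple tile))
    (if grid_reduced [seq val ts | ts <- rs] g rho
     then grid_wt [seq val ts | ts <- rs] else 0).

Lemma bpd_sum0 n g rho : bpd_sum n 0 g rho = (all (pred1 None) g)%:R.
Proof.
rewrite /bpd_sum (sum_tuple0 (fun rs : seq (n.-tuple tile) =>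
  if grid_reduced [seq val ts | ts <- rs] g rho
  then grid_wt [seq val ts | ts <- rs] else 0)) /grid_reduced /= andbT.
by case: all.
Qed.

Lemma bpd_sumS n r g rho : size g = n ->
  bpd_sum n r.+1 g rho = row_sum (x r) None g (fun top e =>
    if e == Some (rho r) then bpd_sum n r top rho else 0).
Proof.
move=> <-; rewrite row_sumE /bpd_sum.
rewrite (sum_tupleS _ (fun rs : seq ((size g).-tuple tile) =>
  if grid_reduced [seq val ts | ts <- rs] g rho
  then grid_wt [seq val ts | ts <- rs] else 0)).
apply: eq_bigr => ts _ /=; set h := row_out None g ts.
have -> : (if row_fits None g ts && ascents (row_log None g ts) then
    x r ^+ count_mem Blank ts *
      (if h == Some (rho r) then \sum_(rs : r.-tuple ((size g).-tuple tile))
         (if grid_reduced [seq val ts | ts <- rs] (row_top None g ts) rho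
          then grid_wt [seq val ts | ts <- rs] else 0) else 0) else 0) =
  \sum_(rs : r.-tuple ((size g).-tuple tile))
    (if [&& row_fits None g ts, ascents (row_log None g ts), h == Some (rho r)
       & grid_reduced [seq val ts | ts <- rs] (row_top None g ts) rho]
     then x r ^+ count_mem Blank ts * grid_wt [seq val ts | ts <- rs] else 0).
  case: (row_fits _ _ _) => /=; last by rewrite big1.
  case: (ascents _) => /=; last by rewrite big1.
  case: (h == _) => /=; last by rewrite mulr0 big1.
  rewrite mulr_sumr; apply: eq_bigr => rs _.
  by case: ifP; rewrite ?mulr0.
apply: eq_bigr => rs _; rewrite /= !size_map size_tuple; congr (if _ then _ else _).
rewrite /grid_reduced [size (_ :: _)]/= size_map size_tuple.
have -> : [seq rho i | i <- iota 0 r.+1] = rcons [seq rho i | i <- iota 0 r] (rho r).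
  by rewrite -addn1 iotaD map_cat cats1.
rewrite /= -/h.
rewrite /ascents all_cat eqseq_rcons.
case: h => [e|] /=; rewrite ?andbF //=.
rewrite (_ : (Some e == Some (rho r)) = (e == rho r)) //.
case: (row_fits _ _ _) => //=; case: grid_fits; rewrite ?andbF //=.
case: (all _ (row_log _ _ _)); rewrite ?andbF ?andbT //=.
by case: (e == rho r); rewrite ?andbF ?andbT.
Qed.
End BpdSum.

(** * Transition for bumpless pipe dreams *)

Section Transition.
Variables (R : comRingType) (x : nat -> R).
Implicit Types (K : seq (option nat) -> option nat -> R) (g Z : seq (option nat)).

Lemma row_sum_cat z h A B K : row_sum z h (A ++ B) K =
  row_sum z h A (fun tA hA => row_sum z hA B (fun tB e => K (tA ++ tB) e)).
Proof.
elim: A h K => [|b A IH] h K //=.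
by case: h => [q|]; case: b => [p|]; rewrite !IH.
Qed.

Lemma eq_row_sum z h g K1 K2 :
  (forall t e, size t = size g ->
     perm_eq (pmap id (h :: g)) (pmap id (rcons t e)) -> K1 t e = K2 t e) ->
  row_sum z h g K1 = row_sum z h g K2.
Proof.
move=> eqK; rewrite !row_sumE; apply: eq_bigr => ts _.
case: ifP => // /andP[rf _]; congr (_ * _); apply: eqK.
  by rewrite size_row_top // size_tuple.
by have /chain_perm := row_chain [::] [::] rf; rewrite !cats0.
Qed.

Lemma row_sum_lin z h g K1 (I : finType) (a : R) (b : I -> R) L :
  row_sum z h g (fun t e => a * K1 t e + \sum_i b i * L i t e) =
  a * row_sum z h g K1 + \sum_i b i * row_sum z h g (L i).
Proof.
rewrite row_sumE (row_sumE z h g K1) [a * _]mulr_sumr.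
rewrite (eq_bigr _ (fun i _ => congr1 (fun y => b i * y) (row_sumE z h g (L i)))).
rewrite (eq_bigr _ (fun i _ => mulr_sumr _ _ _ _)) exchange_big -big_split; apply: eq_bigr => ts _ /=.
case: ifP => _; last by rewrite mulr0 add0r big1 // => i _; rewrite mulr0.
rewrite mulrDr mulr_sumr; congr (_ + _); first by rewrite mulrCA.
by apply: eq_bigr => i _; rewrite mulrCA.
Qed.

Lemma row_sum_absent z h g K p : p \notin pmap id (h :: g) ->
  (forall t e, e <> Some p -> K t e = 0) -> row_sum z h g K = 0.
Proof.
elim: g h K => [|b g IH] h K /= ph K0.
  by apply: K0 => Eh; rewrite Eh /= inE eqxx in ph.
have K0' top t e : e <> Some p -> K (top :: t) e = 0 by apply: K0.
have IH' h' top : p \notin pmap id (h' :: g) ->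
    row_sum z h' g (fun t e => K (top :: t) e) = 0 by move=> ph'; apply: IH => // t e; exact: K0'.
case: h ph => [q|]; case: b => [c|] /= ph; rewrite !IH' ?mulr0 ?addr0 ?if_same //=;
  by move: ph; rewrite ?inE; do ?case: (p == _) => //=.
Qed.

(** If [p] turned up at an empty column, it would be missing at the east end, where [K] requires
    it. *)
Lemma row_sum_pass z p Z K : all (fun c => p < c)%N (pmap id Z) ->
  (forall t e, e <> Some p -> K t e = 0) -> row_sum z (Some p) Z K = K Z (Some p).
Proof.
elim: Z K => [|[c|] Z IH] K //= => [/andP[-> pZ]|pZ] K0.
  by rewrite IH // => t e; apply: K0.
rewrite IH //; last by move=> t e; apply: K0.
rewrite (@row_sum_absent _ _ _ _ p) ?addr0 //=; last by move=> t e; apply: K0.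
by apply/negP => /(allP pZ); rewrite ltnn.
Qed.

(** The occupied columns of [M] leave [a] no room to turn, so [a] crosses [p], and [p] leaves
    through the top instead of the east end. *)
Lemma row_sum_block z a (M : seq nat) p Z K : a != p -> p \notin M ->
  p \notin pmap id Z -> (forall t e, e <> Some p -> K t e = 0) ->
  row_sum z (Some a) (map Some M ++ Some p :: Z) K = 0.
Proof.
move=> ap; elim: M K => [|c M IH] K /=.
  move=> _ pZ K0; rewrite (@row_sum_absent _ _ _ _ p) ?if_same //=.
    by rewrite inE negb_or eq_sym ap.
  by move=> t e; apply: K0.
rewrite inE negb_or => /andP[_ pM] pZ K0; rewrite IH ?if_same // => t e; exact: K0.
Qed.

(** A pipe of [M] that turned east would block [p], so all of them go straight up; then [p] has to
    turn and runs to the end. *)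
Lemma row_sum_front z (M : seq nat) p Z K : p \notin M ->
  all (fun c => p < c)%N (pmap id Z) -> (forall t e, e <> Some p -> K t e = 0) ->
  row_sum z None (map Some M ++ Some p :: Z) K = K (map Some M ++ None :: Z) (Some p).
Proof.
have absZ : all (fun c => p < c)%N (pmap id Z) -> p \notin pmap id Z.
  by move=> pZ; apply/negP => /(allP pZ); rewrite ltnn.
elim: M K => [|c M IH] K /= pM pZ K0.
  rewrite row_sum_pass //; last by move=> t e; apply: K0.
  rewrite (@row_sum_absent _ _ _ _ p) ?addr0 //=; first exact: absZ.
  by move=> t e; apply: K0.
move: pM; rewrite inE negb_or => /andP[pc pM].
rewrite row_sum_block ?absZ // ?add0r; first by rewrite IH // => t e; apply: K0.
- by rewrite eq_sym.
- by move=> t e; apply: K0.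
Qed.

Lemma eq_bpd_sum n r g rho1 rho2 : (forall i, (i < r)%N -> rho1 i = rho2 i) ->
  bpd_sum x n r g rho1 = bpd_sum x n r g rho2.
Proof.
move=> E; apply: eq_bigr => rs _; rewrite /grid_reduced size_map size_tuple.
suff -> : [seq rho1 i | i <- iota 0 r] = [seq rho2 i | i <- iota 0 r] by [].
by apply/eq_in_map => i; rewrite mem_iota => /andP[_]; apply: E.
Qed.

Lemma bpd_sum_replace n r g rho a u :
  uniq (pmap id g) -> a \notin pmap id g -> (a < u)%N ->
  between_before a u (pmap id g) ->
  (forall i, (i < r)%N -> rho i != a) ->
  bpd_sum x n r (map (omap (replace u a)) g) (replace u a \o rho) =
  if between_before a u [seq rho i | i <- iota 0 r] then bpd_sum x n r g rho else 0.
Proof.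
move=> ug ag au bg rhoa.
have -> : (if between_before a u [seq rho i | i <- iota 0 r] then bpd_sum x n r g rho
     else 0) = \sum_(rs : r.-tuple (n.-tuple tile))
    (if grid_reduced [seq val ts | ts <- rs] g rho
        && between_before a u [seq rho i | i <- iota 0 r]
     then grid_wt x [seq val ts | ts <- rs] else 0).
  case: ifP => _; first by apply: eq_bigr => rs _; rewrite andbT.
  by rewrite big1 // => rs _; rewrite andbF.
apply: eq_bigr => rs _; congr (if _ then _ else _).
rewrite /grid_reduced grid_omap size_map size_tuple.
set l := [seq val ts | ts <- rs]; case fit: (grid_fits l g) => //=.
have [-> ->] := grid_log_omap u a fit.
have cg := grid_chain [::] fit; rewrite !cats0 in cg.
rewrite (chain_replace ug au ag bg cg) map_comp.
(* The renaming identifies only [u] with [a], and [a] occurs in neither list. *)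
have -> : (map (replace u a) (grid_exits l g) ==
    map (replace u a) [seq rho i | i <- iota 0 r]) =
    (grid_exits l g == [seq rho i | i <- iota 0 r]).
  apply/eqP/eqP => [E|-> //].
  have Hl : a \notin grid_exits l g by rewrite -(perm_mem (grid_perm fit)).
  have Hr : a \notin [seq rho i | i <- iota 0 r].
    by apply/mapP => -[i]; rewrite mem_iota => /andP[_ ir] /esym /eqP; apply/negP/rhoa.
  elim: (grid_exits l g) [seq rho i | i <- iota 0 r] E Hl Hr => [|c s IH] [|d s'] //=.
  case=> Ecd /IH{}IH; rewrite !inE !negb_or => /andP[ac /IH{}IH] /andP[ad /IH->].
  congr (_ :: _); move: Ecd ac ad; rewrite /replace.
  by case: eqP => [->|_]; case: eqP => [->|_] // ->; rewrite eqxx.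
by case: eqP => [->|_]; rewrite ?andbF ?andbT // andbC.
Qed.

Definition among r (pi : nat -> nat) c : bool := c \in [seq pi i | i <- iota 0 r].

(** The labels entering row [r - 1] from the south once the rows from [r] on are forced: a pipe that
    has not yet left still runs straight up its own column. *)
Definition labels_below n r (pi : nat -> nat) : seq (option nat) :=
  [seq (if among r pi c then Some c else None) | c <- iota 0 n].

Lemma perm_on_nat_surj n v c : perm_on_nat n v -> (c < n)%N ->
  exists2 m, (m < n)%N & v m = c.
Proof.
move=> pv cn; have vlt (i : 'I_n) : (v i < n)%N by rewrite (perm_on_nat_lt _ pv).
have fI : injective (fun i => Ordinal (vlt i)).
  by move=> i j /(congr1 val) /= /pv.1 /val_inj.
have [g _ gK] := injF_bij fI.
by exists (g (Ordinal cn)) => //; have /(congr1 val) := gK (Ordinal cn).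
Qed.

Lemma pmap_labels (P : pred nat) s :
  pmap id [seq (if P c then Some c else None) | c <- s] = filter P s.
Proof. by elim: s => //= c s ->; case: (P c). Qed.

(** Exits are listed by rows, so preceding [w i] means leaving in a higher row; the condition left
    by a renaming thereby becomes the emptiness condition of [covers]. *)
Lemma between_before_exits r w a i : injective w -> (i < r)%N ->
  between_before a (w i) [seq w m | m <- iota 0 r] =
  all (fun m => ~~ ((a < w m)%N && (w m < w i)%N)) (iota i.+1 (r - i.+1)).
Proof.
move=> wI ir; have idx m : (m < r)%N -> index (w m) [seq w j | j <- iota 0 r] = m.
  move=> mr; rewrite index_map //; have Em : nth 0%N (iota 0 r) m = m by rewrite nth_iota.
  by rewrite -{1}Em index_uniq ?size_iota ?iota_uniq.
apply/between_beforeP/allP => H.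
  move=> m; rewrite mem_iota => mir; apply/negP => aw.
  have mr : (m < r)%N by lia.
  have := H (w m) _ aw; rewrite /before !idx // => h.
  have : (m < i)%N by apply: h; rewrite map_f // mem_iota; lia.
  by lia.
move=> c /mapP[m]; rewrite mem_iota => /andP[_ mr] -> aw; rewrite /before !idx //.
rewrite ltnNge; apply/negP => im.
have im' : (i < m)%N.
  by rewrite ltn_neqAle im andbT; apply/negP => /eqP E; rewrite E in aw; lia.
by have := H m; rewrite mem_iota aw => /(_ _)/negP; apply; lia.
Qed.

(** * One transition step *)

Section Step.
Variables (n r s : nat) (pi : nat -> nat).
Hypotheses (pP : perm_on_nat n pi) (rn : (r < s < n)%N).
Let p := pi r.
Let u := pi s.
Hypotheses (up : (u < p)%N)
  (umax : forall m, (r < m < n)%N -> (pi m < p)%N -> (pi m <= u)%N).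
Let v := pi \o sw r s.

Let A := [seq (if among r.+1 pi c then Some c else None) | c <- iota 0 u].
Let M := iota u.+1 (p - u.+1).
Let Z := [seq (if among r.+1 pi c then Some c else None)
          | c <- iota p.+1 (n - p.+1)].

Let mem_pi k m : among k pi (pi m) = (m < k)%N.
Proof.
apply/mapP/idP => [[j]|mk]; first by rewrite mem_iota => /andP[_ jk] /pP.1->.
by exists m => //; rewrite mem_iota.
Qed.

Let pn : (p < n)%N. Proof. by rewrite (perm_on_nat_lt _ pP); lia. Qed.

Let cut_iota : iota 0 n =
  iota 0 u ++ u :: M ++ p :: iota p.+1 (n - p.+1).
Proof.
rewrite -[u :: _]/(iota u 1 ++ _) -[p :: _]/(iota p 1 ++ _).
have E1 : (n = u + (1 + ((p - u.+1) + (1 + (n - p.+1)))))%N by lia.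
rewrite {1}E1 !iotaD; congr (_ ++ (_ ++ (_ ++ (_ ++ _)))); congr iota; lia.
Qed.

(** By the maximality of [u], no value strictly between [u] and [p] is taken after position [r]. *)
Let M_occ c : c \in M -> among r.+1 pi c.
Proof.
rewrite mem_iota => cM; have cn : (c < n)%N by move: pn; lia.
have [m mn Em] := perm_on_nat_surj pP cn.
rewrite -Em mem_pi ltnNge; apply/negP => rm.
by have := @umax m; rewrite Em; lia.
Qed.

Let below_pi : labels_below n r.+1 pi = A ++ None :: map Some M ++ Some p :: Z.
Proof.
rewrite /labels_below cut_iota !map_cat /= map_cat /= !mem_pi ltnSn.
rewrite (_ : (s < r.+1)%N = false); last by lia.
congr (_ ++ (_ :: (_ ++ _))); apply/eq_in_map => c cM.
by rewrite M_occ.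
Qed.

(** Only the set of the first [r.+1] values matters; the general [w] covers both [v] and
    [v \o sw i r]. *)
Let mem_v (w : nat -> nat) c : (forall m, (m < r.+1)%N -> exists2 j, (j < r.+1)%N & w m = v j) ->
  (forall m, (m < r.+1)%N -> exists2 j, (j < r.+1)%N & v m = w j) ->
  among r.+1 w c =
  (c == u) || (c != p) && (among r.+1 pi c).
Proof.
move=> wv vw; have vr : v r = u by rewrite /v /= swl.
have vm m : (m < r)%N -> v m = pi m.
  by rewrite /v /= => mr; case_sw r s m => //; lia.
apply/mapP/idP => [[m]|].
  rewrite mem_iota => /andP[_ /wv[j jr ->]] ->; move: jr; rewrite ltnS leq_eqVlt.
  case/orP => [/eqP->|jr]; first by rewrite vr eqxx.
  rewrite vm // mem_pi ltnW ?ltnS // andbT orbC /p (inj_eq pP.1).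
  by rewrite (ltn_eqF jr).
case/orP => [/eqP->|/andP[cp /mapP[m]]].
  by have [j jr E] := vw r (ltnSn r); exists j; rewrite ?mem_iota // -E vr.
rewrite mem_iota => /andP[_ mr] Ec; have mr' : (m < r)%N.
  by rewrite ltn_neqAle -ltnS mr andbT; apply: contraNN cp => /eqP Em; rewrite Ec Em.
by have [j jr E] := vw m mr; exists j; rewrite ?mem_iota // -E Ec vm.
Qed.

Let below_v w : (forall m, (m < r.+1)%N -> exists2 j, (j < r.+1)%N & w m = v j) ->
  (forall m, (m < r.+1)%N -> exists2 j, (j < r.+1)%N & v m = w j) ->
  labels_below n r.+1 w = A ++ Some u :: map Some M ++ None :: Z.
Proof.
move=> wv vw; rewrite /labels_below cut_iota !map_cat /= map_cat /= !(@mem_v w _ wv vw) !eqxx /=.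
rewrite (gtn_eqF up) /=.
congr (_ ++ (_ :: (_ ++ (_ :: _)))); apply/eq_in_map => c; rewrite mem_iota => hc;
  rewrite (@mem_v w _ wv vw).
- by rewrite (ltn_eqF (_ : c < u)%N) ?(ltn_eqF (_ : c < p)%N) //; lia.
- by rewrite M_occ ?mem_iota // andbT (ltn_eqF (_ : c < p)%N) ?orbT //; lia.
- by rewrite (gtn_eqF (_ : u < c)%N) ?(gtn_eqF (_ : p < c)%N) //; lia.
Qed.

Let pmap_Some (s' : seq nat) : pmap id (map Some s') = s'.
Proof. by elim: s' => //= c s' ->. Qed.

Let Z_gt : all (fun c => p < c)%N (pmap id Z).
Proof.
rewrite pmap_labels; apply/allP => c; rewrite mem_filter mem_iota; lia.
Qed.

Let rest_gt : all (fun c => u < c)%N (pmap id (map Some M ++ None :: Z)).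
Proof.
rewrite pmap_cat pmap_Some all_cat /=; apply/andP; split.
  by apply/allP => c; rewrite mem_iota; lia.
by apply: sub_all Z_gt => c; apply: ltn_trans.
Qed.

Let notin_rest q : (q <= u)%N -> q \notin pmap id (map Some M ++ None :: Z).
Proof. by move=> qu; apply/negP => /(allP rest_gt); lia. Qed.

Let vr : v r = u. Proof. by rewrite /v /= swl. Qed.

Let vm m : (m < r)%N -> v m = pi m.
Proof. by rewrite /v /= => mr; case_sw r s m => //; lia. Qed.

Let rest_top := map Some M ++ None :: Z.

(** On the rows above, [pi] and [v \o sw i r] differ only at [i], with values [pi i] and [u].
    Renaming [u] to [pi i] compares them, and the condition on the exits is what makes [v \o sw i r]
    a cover of [v]. *)
Lemma bpd_exchange i (tA : seq (option nat)) : (i < r)%N -> (pi i < u)%N ->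
  uniq (pi i :: pmap id tA) -> all (fun c => c < u)%N (pmap id tA) ->
  bpd_sum x n r (tA ++ Some (pi i) :: rest_top) pi =
  (covers v i r)%:R * bpd_sum x n r (tA ++ Some u :: rest_top) (v \o sw i r).
Proof.
move=> ir au /= /andP[aA uA] tAu.
have aM : pi i \notin pmap id rest_top by apply: notin_rest; lia.
have uM : uniq (pmap id rest_top).
  rewrite pmap_cat pmap_Some /= cat_uniq iota_uniq pmap_labels filter_uniq ?iota_uniq // andbT.
  by apply/hasPn => c; rewrite mem_filter !mem_iota; lia.
have pmapE : pmap id (tA ++ Some u :: rest_top) = pmap id tA ++ u :: pmap id rest_top.
  by rewrite pmap_cat.
have uU : u \notin pmap id tA by apply/negP => /(allP tAu); rewrite ltnn.
have neq_u c : (u < c)%N -> (c == u) = false by move=> uc; rewrite gtn_eqF.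
have := @bpd_sum_replace n r (tA ++ Some u :: rest_top) (v \o sw i r) (pi i) u.
have -> : map (omap (replace u (pi i))) (tA ++ Some u :: rest_top) =
          tA ++ Some (pi i) :: rest_top.
  rewrite map_cat /= {2}/replace eqxx; congr (_ ++ _ :: _).
    elim: tA uU {aA uA tAu pmapE} => //= -[c|] t IH /=; last by move=> ut; rewrite IH.
    by rewrite inE negb_or => /andP[cu ut]; rewrite IH // /replace eq_sym (negPf cu).
  have := rest_gt; rewrite -/rest_top.
  elim: rest_top => //= -[c|] t IH /=; last by move=> ut; rewrite IH.
  by case/andP=> uc ut; rewrite IH // /replace neq_u.
rewrite (@eq_bpd_sum _ _ _ (replace u (pi i) \o (v \o sw i r)) pi); last first.
  move=> m mr /=; rewrite /replace; case_sw i r m.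
  - by rewrite vr eqxx; subst.
  - by lia.
  - rewrite vm //; case: eqP => // /pP.1; lia.
move=> ->; last first.
- move=> m mr /=; apply/negP => /eqP; case_sw i r m; rewrite ?vr ?vm //.
  + by move=> /pP.1; lia.
  + by subst; lia.
  + by move/pP.1; lia.
- rewrite pmapE; apply/between_beforeP => c; rewrite mem_cat inE => cL acu.
  have cA : c \in pmap id tA.
    case/or3P: cL => // [/eqP cu|/(allP rest_gt) uc]; case/andP: acu => _.
      by rewrite cu ltnn.
    by move/(ltn_trans uc); rewrite ltnn.
  rewrite /before !index_cat cA (negPf uU) /= eqxx addn0 index_mem //.
- by [].
- by rewrite pmapE mem_cat inE !negb_or aA aM andbT /=; lia.
- rewrite pmapE cat_uniq uA /= uM andbT negb_or uU /=.
  rewrite (notin_rest (leqnn u)) andbT.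
  apply/hasPn => c /(allP rest_gt) uc; apply/negP => /(allP tAu); lia.
have wI : injective (v \o sw i r).
  by apply: inj_comp (@sw_inj i r); apply: inj_comp (@sw_inj r s); case: pP.
have := @between_before_exits r (v \o sw i r) (pi i) i wI ir.
rewrite [X in between_before _ X]/= swl vr => ->.
have -> : covers v i r = all (fun m => ~~ ((pi i < (v \o sw i r) m)%N && ((v \o sw i r) m < (v \o sw i r) i)%N))
   (iota i.+1 (r - i.+1)).
  rewrite /covers vr (vm ir) au /=; apply: eq_in_all => m; rewrite mem_iota => hm.
  by rewrite swl vr; case_sw i r m => //; lia.
by case: all; rewrite ?mul1r ?mul0r.
Qed.

(* Row [r] for [pi] is compared with row [r] for [v] and for [v \o sw i r],
   which only differs at columns [u] and [p].  If no horizontal pipe enters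
   column [u], that cell is blank and the row for [v] has the same pipes above;
   if pipe [pi i] enters, it turns up there, while it crosses pipe [u] in the
   row for [v \o sw i r], whence the exchange of these two labels above. *)
Lemma bpd_transition :
  bpd_sum x n r.+1 (labels_below n r.+1 pi) pi =
  x r * bpd_sum x n r.+1 (labels_below n r.+1 v) v +
  \sum_(i < r) (covers v i r)%:R *
    bpd_sum x n r.+1 (labels_below n r.+1 (v \o sw i r)) (v \o sw i r).
Proof.
have size_below w : size (labels_below n r.+1 w) = n by rewrite size_map size_iota.
have perm_w (i : 'I_r) : labels_below n r.+1 (v \o sw i r) = A ++ Some u :: map Some M ++ None :: Z.
  have ir := ltn_ord i; apply: below_v => m mr.
    by exists (sw i r m) => //; rewrite sw_lt //; lia.
  by exists (sw i r m); rewrite ?sw_lt /= ?swK //; lia.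
rewrite !bpd_sumS // below_pi (below_v (w := v)); try by move=> m mr; exists m.
under [X in _ = _ + X]eq_bigr => i _ do rewrite bpd_sumS // perm_w.
rewrite !row_sum_cat.
under [X in _ = _ + X]eq_bigr => i _ do rewrite row_sum_cat.
rewrite -row_sum_lin; apply: eq_row_sum => tA hA _.
rewrite /= pmap_labels => pA.
have uA : uniq (pmap id (rcons tA hA)).
  by rewrite -(perm_uniq pA) filter_uniq ?iota_uniq.
have lA c : c \in pmap id (rcons tA hA) -> (c < u)%N && among r.+1 pi c.
  by rewrite -(perm_mem pA) mem_filter mem_iota /= => /andP[-> ->].
have tAu : all (fun c => c < u)%N (pmap id tA).
  apply/allP => c cA; suff /lA/andP[] : c \in pmap id (rcons tA hA) by [].
  by rewrite -cats1 pmap_cat mem_cat cA.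
have pZ : p \notin pmap id Z by apply/negP => /(allP Z_gt); rewrite ltnn.
have pM : p \notin M by rewrite mem_iota; move: up; lia.
have coverE (i : 'I_r) : covers v i r -> (pi i < u)%N.
  by case/coversP; rewrite vr vm.
have H0 (H : seq (option nat) -> R) (q : nat) t e :
    e <> Some q -> (if e == Some q then H t else 0) = 0 by case: eqP.
rewrite vr; case: hA pA uA lA => [a|] pA uA lA.
  have /lA/andP[au] : a \in pmap id (rcons tA (Some a)).
    by rewrite -cats1 pmap_cat mem_cat /= inE eqxx orbT.
  case/mapP => i0; rewrite mem_iota => /andP[_ i0r] Ea.
  have ap : a != p by apply: contraTneq au => ->; rewrite -leqNgt ltnW.
  have {}i0r : (i0 < r)%N.
    rewrite ltn_neqAle -ltnS i0r andbT; apply: contraNneq ap => E.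
    by rewrite Ea E.
  (* Going straight through column [u], the pipe [a] would meet only occupied columns up to [p] and
     block it. *)
  rewrite row_sum_block //; last by move=> t e; apply: (H0 (fun t => _)).
  rewrite row_sum_front ?Z_gt //; last by move=> t e; apply: (H0 (fun t => _)).
  rewrite eqxx add0r au (@row_sum_absent _ _ _ _ u); first last.
  - by move=> t e; apply: (H0 (fun t => _)).
  - by rewrite /= inE negb_or (gtn_eqF au) notin_rest.
  (* Only the summand with [pi i = a] survives: in the others the pipe that has to exit is absent
     from the rest of the row, or there is no cover. *)
  rewrite mulr0 add0r (bigD1 (Ordinal i0r)) //= big1 ?addr0 => [|i ne_i].
    rewrite row_sum_pass; first last.
    + by move=> t e; rewrite /= swr vm // -Ea; apply: (H0 (fun t => _)).
    + by apply: sub_all rest_gt => c; apply: ltn_trans.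
    rewrite swr vm // -Ea eqxx Ea bpd_exchange -?Ea //.
    by move: uA; rewrite -cats1 pmap_cat cats1 rcons_uniq /= => /andP[-> ->].
  have [/coverE iu|_] := boolP (covers v i r); last by rewrite mul0r.
  rewrite (@row_sum_absent _ _ _ _ (pi i)) ?mulr0 //.
    rewrite /= inE negb_or notin_rest 1?ltnW // andbT Ea (inj_eq pP.1).
    by move: ne_i; rewrite -val_eqE.
  by move=> t e; rewrite /= swr vm //; apply: (H0 (fun t => _)).
rewrite row_sum_front ?Z_gt //; last by move=> t e; apply: (H0 (fun t => _)).
rewrite eqxx row_sum_pass ?rest_gt //; last by move=> t e; apply: (H0 (fun t => _)).
rewrite eqxx (@row_sum_absent _ _ _ _ u) ?notin_rest //; last first.
  by move=> t e; apply: (H0 (fun t => _)).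
rewrite addr0 [X in _ = _ + X]big1 ?addr0 => [|i _].
  by congr (_ * _); apply: eq_bpd_sum => m mr; rewrite vm.
have [/coverE iu|_] := boolP (covers v i r); last by rewrite mul0r.
rewrite !(@row_sum_absent _ _ _ _ (pi i)) ?addr0 ?mulr0 //.
- by rewrite /= notin_rest // ltnW.
- by move=> t e; rewrite /= swr vm //; apply: (H0 (fun t => _)).
- by rewrite /= inE negb_or (ltn_eqF iu) notin_rest // ltnW.
- by move=> t e; rewrite /= swr vm //; apply: (H0 (fun t => _)).
Qed.
End Step.
End Transition.

(** * The two recursions agree *)

Section Agreement.
Variables (R : comRingType) (x : nat -> R) (n : nat).

Lemma increasing_perm_id v : perm_on_nat n v ->
  (forall i j, (i < j < n)%N -> (v i < v j)%N) -> forall i, v i = i.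
Proof.
move=> pv incr i; have [ni|lt_in] := leqP n i; first exact: pv.2.
apply/eqP; rewrite eqn_leq; apply/andP; split.
  have [d def_d] : exists d, (n = i + d.+1)%N by exists (n - i.+1)%N; lia.
  elim: d i lt_in def_d => [|d IH] i lt_in def_d.
    by have := perm_on_nat_lt i pv; lia.
  by have := IH i.+1; have := incr i i.+1; lia.
elim: i lt_in => // i IH lt_in.
by have := IH (ltnW lt_in); have := incr i i.+1; lia.
Qed.

Lemma word_sum_id l v : (forall i, v i = i) -> word_sum n x l v = 1.
Proof.
move=> vid; elim: l => [|c l IH] /=; last by rewrite /cross_factor /descent !vid ltnNge leqnSn addr0.
by rewrite (_ : all _ _) //; apply/allP => i _; rewrite vid.
Qed.

Lemma among_last r pi c : among r.+1 pi c = (c == pi r) || among r pi c.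
Proof.
by rewrite /among -addn1 iotaD map_cat mem_cat /= add0n inE orbC.
Qed.

(** All values below [pi r] are taken before [r], so every column to the left of [pi r] is occupied
    and [row_sum_front] determines the row, without a blank. *)
Lemma bpd_sum_forced r pi : perm_on_nat n pi -> (r < n)%N ->
  (forall m, (r < m < n)%N -> (pi r < pi m)%N) ->
  bpd_sum x n r.+1 (labels_below n r.+1 pi) pi =
  bpd_sum x n r (labels_below n r pi) pi.
Proof.
move=> pP rn gt_r; rewrite bpd_sumS ?size_map ?size_iota //.
have pn : (pi r < n)%N by rewrite (perm_on_nat_lt _ pP).
have nr : ~~ among r pi (pi r).
  by apply/mapP => -[j]; rewrite mem_iota => hj /pP.1; lia.
have occ c : (c < pi r)%N -> among r pi c.
  move=> cr; have [m mn Em] := perm_on_nat_surj pP (ltn_trans cr pn).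
  have mr : m <> r by move=> E; rewrite -Em E ltnn in cr.
  by rewrite /among -Em; apply: map_f; rewrite mem_iota; have := gt_r m; lia.
have cutn : iota 0 n = iota 0 (pi r) ++ pi r :: iota (pi r).+1 (n - (pi r).+1).
  have En : n = (pi r + (1 + (n - (pi r).+1)))%N by lia.
  by rewrite {1}En !iotaD add0n addn1.
have split_labels k : (r <= k)%N -> labels_below n k pi =
    map Some (iota 0 (pi r)) ++
    (if among k pi (pi r) then Some (pi r) else None) ::
    [seq (if among k pi c then Some c else None) | c <- iota (pi r).+1 (n - (pi r).+1)].
  move=> rk; rewrite /labels_below cutn map_cat /=; congr (_ ++ _).
  apply/eq_in_map => c; rewrite mem_iota add0n => /andP[_ /occ/mapP[j]].
  rewrite mem_iota => hj ->; suff -> : among k pi (pi j) by [].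
  by apply: map_f; rewrite mem_iota; lia.
rewrite (split_labels r.+1) // (split_labels r) // among_last eqxx (negPf nr) /=.
rewrite row_sum_front ?eqxx; last by move=> t e; case: eqP.
- congr (bpd_sum _ _ _ (_ ++ _ :: _) _); apply/eq_in_map => c; rewrite mem_iota => hc.
  by rewrite among_last gtn_eqF //; case/andP: hc.
- by rewrite mem_iota add0n ltnn andbF.
- by rewrite pmap_labels; apply/allP => c; rewrite mem_filter mem_iota => /and3P[].
Qed.

Theorem bpd_sum_word_sum r pi : (r <= n)%N -> perm_on_nat n pi ->
  (forall i j, (r <= i)%N -> (i < j < n)%N -> (pi i < pi j)%N) ->
  bpd_sum x n r (labels_below n r pi) pi = word_sum n x (letters_above n n) pi.
Proof.
elim: r pi => [|r IHr] pi rn pP incr.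
  have pid := increasing_perm_id pP (fun i j => incr i j (leq0n i)).
  rewrite word_sum_id // bpd_sum0 (_ : all _ _) //.
  by apply/allP => e /mapP[c _ ->].
(* The value at [r] drops to [pi s] for [v], and to [v i < pi s] for [v \o sw i r]. *)
have [k] := ubnP (pi r); elim: k pi pP incr => // k IHk pi pP incr pik.
have [/hasP[s0 s0I s0lt]|/hasPn no_s] :=
  boolP (has (fun s => pi s < pi r)%N (iota r.+1 (n - r.+1))); last first.
  have gt_r m : (r < m < n)%N -> (pi r < pi m)%N.
    move=> hm; have /no_s : m \in iota r.+1 (n - r.+1) by rewrite mem_iota; lia.
    by rewrite -leqNgt leq_eqVlt => /orP[/eqP/pP.1|//]; lia.
  rewrite bpd_sum_forced // IHr // 1?ltnW // => i j ri ij.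
  case: (ltngtP r i) ri => // [ri|Er] _; first by apply: incr.
  by rewrite -Er; apply: gt_r; rewrite Er.
pose P s := (r < s < n)%N && (pi s < pi r)%N.
have exP : exists s, P s by exists s0; move: s0I; rewrite /P mem_iota; lia.
have ubP s : P s -> (s <= n)%N by case/andP; lia.
case: (ex_maxnP exP ubP) => s /andP[rsn us] smax {s0 s0I s0lt exP}.
have umax m : (r < m < n)%N -> (pi m < pi r)%N -> (pi m <= pi s)%N.
  move=> hm mr; have := smax m; rewrite /P hm mr => /(_ isT).
  rewrite leq_eqVlt => /orP[/eqP-> //|ms]; apply: ltnW; apply: incr; lia.
set v := pi \o sw r s.
have pv : perm_on_nat n v by apply: perm_on_nat_sw => //; lia.
have vr : v r = pi s by rewrite /v /= swl.
have vs : v s = pi r by rewrite /v /= swr.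
have vo m : m <> r -> m <> s -> v m = pi m by rewrite /v /=; case_sw r s m.
have ne_m m m' : m <> m' -> pi m <> pi m' by move=> h /pP.1.
(* The value [pi r], moved to position [s], fits there: it exceeds [pi s], and by the maximality of
   [s] it is below all later values. *)
have incrv i j : (r < i)%N -> (i < j < n)%N -> (v i < v j)%N.
  move=> ri ij; have [Ei|Ei] := eqVneq i s.
    rewrite Ei vs vo; [|lia|lia]; rewrite Ei in ij.
    rewrite ltnNge leq_eqVlt; apply/negP => /orP[/eqP/pP.1|jr]; first lia.
    by have := smax j; rewrite /P jr; lia.
  have voi : v i = pi i by apply: vo; [lia|exact/eqP].
  have [Ej|Ej] := eqVneq j s.
    rewrite Ej vs voi; apply: leq_ltn_trans us; apply: ltnW; apply: incr; lia.
  have voj : v j = pi j by apply: vo; [lia|exact/eqP].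
  by rewrite voi voj; apply: incr; lia.
have [rn' [sn rs]] : (r < n)%N /\ ((s < n)%N /\ (r < s)%N) by lia.
have covs : covers v r s.
  apply/coversP; rewrite vr vs; split=> // m hm; rewrite vo; [|lia|lia].
  by have := incr m s; lia.
rewrite (bpd_transition x pP rsn us umax) -/v (IHk v pv incrv); last by lia.
have := @monk_word_sum _ n x v r s pv rsn; rewrite vr vs => /(_ us) ->.
rewrite (bigID (fun j : 'I_n => (j < r)%N)) /= addrAC.
(* To the right of [r] only [j = s] gives a cover: before [s] the values are below [v r], and after
   [s] the value [v s] lies in between. *)
have -> : \sum_(j < n | ~~ (j < r)%N) cover_sign R v r j *
    word_sum n x (letters_above n n) (v \o sw r j) = word_sum n x (letters_above n n) pi.
  rewrite (bigD1 (Ordinal sn)) /=; last by rewrite -leqNgt ltnW.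
  rewrite big1 ?addr0 => [|j /andP[rj js]].
    by rewrite /cover_sign rs covs mul1r comp_swK.
  rewrite -val_eqE /= in js; rewrite -leqNgt in rj.
  have [Ejr|Ejr] := eqVneq (j : nat) r; first by rewrite Ejr /cover_sign !ltnn mul0r.
  have rj' : (r < j)%N by rewrite ltn_neqAle eq_sym Ejr.
  rewrite /cover_sign rj' (_ : covers v r j = false) ?mul0r //.
  apply/negP => /coversP[]; rewrite vr vo; [|lia|exact/eqP] => uj H.
  have jn := ltn_ord j.
  case: (ltngtP j s) => [h|h|/eqP h].
  - by have := incr j s; lia.
  - apply: (H s); first lia.
    rewrite vs; split=> //; rewrite ltnNge; apply/negP => jr.
    by have := umax j; have := ne_m j r; move/eqP: Ejr; lia.
  - by rewrite h in js.
rewrite -[RHS]add0r; congr (_ + _).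
rewrite -(big_ord_widen n (fun j => cover_sign R v r j *
    word_sum n x (letters_above n n) (v \o sw r j))) ?(ltnW rn') //.
rewrite -big_split big1 // => i _ /=.
have ir := ltn_ord i.
rewrite /cover_sign (leq_gtF (ltnW ir)) ir (swC r i) mulNr.
have [cov|_] := boolP (covers v i r); last by rewrite !mul0r oppr0 addr0.
have iu : (v i < pi s)%N by case/coversP: cov; rewrite vr.
rewrite IHk ?addNr //.
- by apply: perm_on_nat_sw => //; lia.
- have sw_id m : (r < m)%N -> sw i r m = m by case_sw (i : nat) r m; lia.
  by move=> j j' rj jj'; rewrite /= !sw_id; [apply: incrv|lia|].
- by rewrite /= swr; apply: leq_trans iu _; lia.
Qed.
End Agreement.

(** * Pipes of a pipe dream *)

Fixpoint word_state (l : seq (nat * nat)) (bs : seq bool) : nat -> nat :=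
  match l, bs with
  | c :: l', b :: bs' =>
    if b then word_state l' bs' \o sw c.2 c.2.+1 else word_state l' bs'
  | _, _ => id
  end.

Fixpoint word_log (l : seq (nat * nat)) (bs : seq bool) : seq (nat * nat) :=
  match l, bs with
  | c :: l', b :: bs' =>
    (if b then [:: (word_state l' bs' c.2, word_state l' bs' c.2.+1)] else [::]) ++
    word_log l' bs'
  | _, _ => [::]
  end.

Lemma word_chain n l bs : all (fun c => c.2.+1 < n)%N l ->
  chain (iota 0 n) (word_log l bs) [seq word_state l bs i | i <- iota 0 n].
Proof.
elim: l bs => [|[i k] l IH] [|b bs] /=; rewrite ?map_id; try by move=> _; exact: ChainNil.
case/andP=> kn ln; have := IH bs ln; case: b => //=.
set w := word_state l bs => c.
have cut : iota 0 n = iota 0 k ++ k :: k.+1 :: iota k.+2 (n - k.+2).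
  have En : n = (k + (2 + (n - k.+2)))%N by lia.
  by rewrite {1}En !iotaD add0n addn2.
have -> : [seq (w \o sw k k.+1) j | j <- iota 0 n] =
    [seq w j | j <- iota 0 k] ++ w k.+1 :: w k :: [seq w j | j <- iota k.+2 (n - k.+2)].
  rewrite cut map_cat /= swl swr; congr (_ ++ _ :: _ :: _);
    apply/eq_in_map => j; rewrite mem_iota => hj /=; congr w;
    case_sw k k.+1 j => //; lia.
by apply: ChainCons; move: c; rewrite cut map_cat.
Qed.

Section MaskSum.
Variables (R : comRingType) (x : nat -> R) (n : nat).

Fixpoint word_wt (l : seq (nat * nat)) (bs : seq bool) : R :=
  match l, bs with
  | c :: l', b :: bs' => (if b then x c.1 else 1) * word_wt l' bs'
  | _, _ => 1
  end.

Definition word_reduced l bs (v : nat -> nat) : bool :=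
  ascents (word_log l bs) && all (fun i => word_state l bs i == v i) (iota 0 n).

(** A mask picks one term from each factor. A descent of [v] at the head letter says that the two
    labels about to be swapped there, those of [v] before the swap, ascend. *)
Lemma word_sumE l v : all (fun c => c.2.+1 < n)%N l ->
  word_sum n x l v = \sum_(bs : (size l).-tuple bool)
    (if word_reduced l bs v then word_wt l bs else 0).
Proof.
elim: l v => [|c l IH] v /=.
  move=> _; rewrite (sum_tuple0 (fun bs => if word_reduced [::] bs v then word_wt [::] bs else 0)).
  rewrite /word_reduced /=; under eq_all => i do rewrite eq_sym.
  by case: all.
case/andP=> cn ln.
rewrite (sum_tupleS _ (fun bs => if word_reduced (c :: l) bs v then word_wt (c :: l) bs else 0)).
rewrite big_bool /= addrC /cross_factor IH //; congr (_ + _).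
  by apply: eq_bigr => bs _; rewrite /word_reduced /= mul1r.
have E bs : word_reduced (c :: l) (true :: bs) v =
            descent v c.2 && word_reduced l bs (v \o sw c.2 c.2.+1).
  rewrite /word_reduced /=.
  set w := word_state l bs.
  have -> : all (fun i => (w \o sw c.2 c.2.+1) i == v i) (iota 0 n) =
            all (fun i => w i == (v \o sw c.2 c.2.+1) i) (iota 0 n).
    have sw_in i : (i \in iota 0 n) -> sw c.2 c.2.+1 i \in iota 0 n.
      by rewrite !mem_iota !add0n /= => hi; rewrite sw_lt //; lia.
    by apply/allP/allP => H i hi; have := H _ (sw_in i hi); rewrite /= swK.
  case: allP => H; last by rewrite !andbF.
  rewrite !andbT; congr (_ && _); rewrite /descent.
  have := H c.2; have := H c.2.+1; rewrite !mem_iota /= swl swr => h1 h2.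
  by rewrite (eqP (h1 _)) ?(eqP (h2 _)) //; lia.
case: ifP => dv.
  rewrite IH // mulr_sumr; apply: eq_bigr => bs _; rewrite E dv /=.
  by case: ifP; rewrite ?mulr0.
by rewrite big1 // => bs _; rewrite E dv.
Qed.
End MaskSum.

(* [lab] names the pipe running through each state; [mu] measures how far
   the state is from the start of its pipe. *)
Lemma connect_label (S : finType) (X : eqType) (e : rel S) (lab : S -> option X)
    (mu : S -> nat) (x0 : S) a :
  (forall x y, e x y -> lab x = Some a -> lab y = Some a) ->
  lab x0 = Some a ->
  (forall y, lab y = Some a ->
     y = x0 \/ exists x, [/\ e x y, lab x = Some a & (mu x < mu y)%N]) ->
  forall y, connect e x0 y = (lab y == Some a).
Proof.
move=> fwd lab0 bwd y; apply/idP/eqP.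
  case/connectP => p; elim: p x0 lab0 {bwd} => [|z p IH] x labx /=; first by move=> _ ->.
  by case/andP=> /fwd/(_ labx) labz; apply: IH.
have [m] := ubnP (mu y); elim: m y => // m IH y mum laby.
case: (bwd y laby) => [->//|[x [exy labx lt_xy]]].
by apply: connect_trans (connect1 exy); apply: IH labx; apply: leq_trans lt_xy _.
Qed.

Section PipeDream.
Variables (n : nat) (B : nat -> nat -> bool).

Definition mask (l : seq (nat * nat)) := [seq B c.1 c.2 | c <- l].

Definition letters_from i k := row_letters n i k ++ letters_above n i.

(* The arrangement of the pipes once row [i] has been read down to letter [k]. *)
Definition pd_state i k := word_state (letters_from i k) (mask (letters_from i k)).

Lemma letters_from_cons i k : (k < n.-1)%N ->
  letters_from i k = (i, k) :: letters_from i k.+1.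
Proof.
move=> kn; rewrite /letters_from /row_letters.
by have -> : (n.-1 - k = (n.-1 - k.+1).+1)%N by lia.
Qed.

Lemma letters_from_top i k : (n.-1 <= k)%N -> letters_from i k = letters_above n i.
Proof.
by move=> nk; rewrite /letters_from /row_letters; have -> : (n.-1 - k = 0)%N by lia.
Qed.

Lemma pd_state_step i k : (k < n.-1)%N ->
  pd_state i k = if B i k then pd_state i k.+1 \o sw k k.+1 else pd_state i k.+1.
Proof. by move=> kn; rewrite /pd_state letters_from_cons. Qed.

Lemma pd_state_top i k : (n.-1 <= k)%N -> pd_state i k = pd_state i n.-1.
Proof. by move=> nk; rewrite /pd_state !letters_from_top. Qed.

Lemma pd_state_row i k : (n.-1 <= k)%N -> pd_state i.+1 k = pd_state i i.
Proof. by move=> nk; rewrite /pd_state letters_from_top. Qed.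

Lemma pd_state0 k : (n.-1 <= k)%N -> pd_state 0 k = id.
Proof. by move=> nk; rewrite /pd_state letters_from_top. Qed.

(** A row reads its letters in decreasing order, and the letters below [k] touch positions up to [k]
    only. *)
Lemma pd_state_right i k k' p : (k' <= k)%N -> (k < p)%N ->
  pd_state i k' p = pd_state i k p.
Proof.
move=> k'k kp; rewrite -(subKn k'k); elim: (k - k')%N (leq_subr k' k) => [|d IH] dk.
  by rewrite subn0.
have [kn|nk] := ltnP (k - d.+1)%N n.-1; last first.
  by rewrite pd_state_top // (pd_state_top i (k := k)) //; lia.
rewrite pd_state_step // (_ : (k - d.+1).+1 = k - d)%N; last lia.
have IH' := IH (ltnW dk); have swp : sw (k - d.+1) (k - d) p = p.
  by case_sw (k - d.+1)%N (k - d)%N p => //; lia.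
by case: (B _ _) => //=; rewrite swp.
Qed.

Lemma pd_state_left i k m p : (k <= m)%N -> (p < k)%N ->
  pd_state i k p = pd_state i m p.
Proof.
move=> km pk; have def_m : m = (k + (m - k))%N by lia.
rewrite def_m; elim: (m - k)%N => [|d ->]; first by rewrite addn0.
have [kn|nk] := ltnP (k + d)%N n.-1; last first.
  by rewrite (pd_state_top i nk) (pd_state_top i (k := k + d.+1)) //; lia.
rewrite addnS (pd_state_step i kn); case: (B _ _) => //=.
by have -> // : sw (k + d) (k + d).+1 p = p; case_sw (k + d)%N (k + d).+1 p => //; lia.
Qed.

(** The letters of a row are at least its index, so the rows from [i] on leave the positions below
    [i] alone. *)
Lemma pd_state_final i p m : (p < i)%N -> (i <= m)%N ->
  pd_state i n.-1 p = pd_state m n.-1 p.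
Proof.
move=> pi im; rewrite -(subnKC im); elim: (m - i)%N => [|d ->]; first by rewrite addn0.
rewrite addnS pd_state_row //; have [h|h] := leqP (i + d) n.-1.
  by rewrite (pd_state_left _ h) //; lia.
by rewrite (pd_state_top _ (ltnW h)).
Qed.

Lemma pd_state0_id k p : (p < k)%N -> pd_state 0 k p = p.
Proof.
move=> pk; have [h|h] := leqP k n.-1; first by rewrite (pd_state_left _ h) // pd_state0.
by rewrite pd_state_top 1?pd_state0 // ltnW.
Qed.

Lemma pd_stateE k : (n.-1 <= k)%N ->
  pd_state n k = word_state (letters_above n n) (mask (letters_above n n)).
Proof. by move=> nk; rewrite /pd_state letters_from_top. Qed.

Variable T : tiling n.
Hypothesis TE : forall c, T c =
  if (c.1 + c.2 < n.-1)%N && B c.1 (c.1 + c.2) then Cross else Elbows.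

(** The cell in row [i] and column [j] reads the letter [k = i + j]: just before, the pipe at
    position [k] enters it from the north and the one at [k.+1] from the east. The bounds discard
    the states beyond the staircase, which no numbered pipe reaches. *)
Definition pd_label (y : state n) : option nat :=
  let i : nat := y.1.1 in let k := (y.1.1 + y.1.2)%N in
  match y.2 with
  | North => if (k < n)%N then Some (pd_state i k.+1 k) else None
  | East => if (k < n.-1)%N then Some (pd_state i k.+1 k.+1) else None
  | _ => None
  end.

Definition pd_out i k (s : side) : option nat :=
  match s with
  | West => if (k < n)%N then Some (pd_state i k k) else None
  | South => if (k < n.-1)%N then Some (pd_state i k k.+1) else None
  | _ => None
  end.

Lemma pd_label_link (y : state n) s : link (T y.1) y.2 = Some s ->
  pd_out y.1.1 (y.1.1 + y.1.2) s = pd_label y.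
Proof.
case: y => [[i j] s0] /=; rewrite /pd_label TE /=; set k := (i + j)%N.
have [kn|nk] := ltnP k n.-1; last first.
  case: s0 => //= -[<-] //=.
  - by rewrite (pd_state_top i nk) (pd_state_top i (leqW nk)).
  - by rewrite ltnNge nk.
have kn' : (k < n)%N by lia.
by rewrite /=; case EB: (B i k) s0 => -[] //= [<-] /=;
  rewrite ?kn ?kn' ?(pd_state_step i kn) ?EB /= ?swl ?swr.
Qed.

Lemma pd_out_neighbor (c c' : cell n) s : neighbor c s c' ->
  pd_out c.1 (c.1 + c.2) s = pd_label (c', opposite s).
Proof.
case: c c' => [i j] [i' j'] /=; case: s => //= /andP[/eqP Ei /eqP Ej]; rewrite /pd_label /=.
- rewrite Ei Ej; set k := (i + j)%N; rewrite (_ : i.+1 + j = k.+1)%N //.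
  rewrite (_ : (k.+1 < n) = (k < n.-1))%N; last by lia.
  case: ifP => // kn; congr Some; rewrite -(@pd_state_right i k i) ?leq_addr //.
  rewrite -(@pd_state_row i n.-1) //.
  have [h|h] := leqP k.+2 n.-1; first by rewrite (pd_state_left _ h).
  by rewrite (pd_state_top _ (ltnW h)).
- rewrite Ei -Ej addnS (_ : ((i + j').+1 < n) = (i + j' < n.-1))%N //; lia.
Qed.

Lemma link_sym (c : cell n) s s' : link (T c) s = Some s' -> link (T c) s' = Some s.
Proof. by rewrite TE; case: ifP => _; case: s => /= -[<-]. Qed.

Definition pd_start (j : 'I_n) : state n := (((Ordinal (leq_ltn_trans (leq0n j) (ltn_ord j))), j), North).

Lemma pd_label_start j : pd_label (pd_start j) = Some (j : nat).
Proof.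
by rewrite /pd_label /= add0n ltn_ord pd_state0_id.
Qed.

Lemma pd_pred (y : state n) (j : 'I_n) : pd_label y = Some (j : nat) ->
  y = pd_start j \/ exists x, [/\ Defs.next T x y, pd_label x = Some (j : nat)
    & (x.1.1 * n + (n - x.1.2) < y.1.1 * n + (n - y.1.2))%N].
Proof.
move=> laby.
have step c s : neighbor c s y.1 -> y.2 = opposite s ->
    (c.1 * n + (n - c.2) < y.1.1 * n + (n - y.1.2))%N ->
    exists x, [/\ Defs.next T x y, pd_label x = Some (j : nat)
    & (x.1.1 * n + (n - x.1.2) < y.1.1 * n + (n - y.1.2))%N].
  move=> nb opp lt_mu; have out : pd_out c.1 (c.1 + c.2) s = Some (j : nat).
    by rewrite (pd_out_neighbor nb) -opp -surjective_pairing.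
  have [s' Es'] : exists s', link (T c) s = Some s'.
    by rewrite TE; case: ifP => _; case: (s); eexists; reflexivity.
  have Es := link_sym Es'.
  exists (c, s'); split=> //; first by rewrite /Defs.next /= Es nb opp eqxx.
  by rewrite -(@pd_label_link (c, s') s).
case: y laby step => [[i j'] s] /=; rewrite {1}/pd_label /=; case: s => //; case: ifP => // kn.
- case Ei: (i : nat) => [|i0] [E] step; [left|right].
    rewrite add0n pd_state0_id // in E.
    by rewrite /pd_start; congr (_, _, _); apply: val_inj.
  have i0n : (i0 < n)%N by have := ltn_ord i; lia.
  apply: (step (Ordinal i0n, j') South) => //=; first by rewrite Ei !eqxx.
  by rewrite mulSn; have := ltn_ord j'; lia.
- move=> _ step; right; have jn : (j'.+1 < n)%N by lia.
  apply: (step (i, Ordinal jn) West) => //=; first by rewrite !eqxx.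
  by have := ltn_ord j'; lia.
Qed.

Lemma pd_connect (j : 'I_n) y : connect (Defs.next T) (pd_start j) y = (pd_label y == Some (j : nat)).
Proof.
(* Pipes move south and west only, so this measure grows along them. *)
apply: (@connect_label (state n) nat (Defs.next T) pd_label
  (fun y => (y.1.1 * n + (n - y.1.2))%N)).
- move=> x y'; rewrite /Defs.next; case El: link => [s|//] /andP[nb /eqP opp] <-.
  by rewrite -(pd_label_link El) (pd_out_neighbor nb) -opp -surjective_pairing.
- exact: pd_label_start.
- by move=> y' laby'; exact: pd_pred.
Qed.

Lemma pd_startE j x : starts North j x = (x == pd_start j).
Proof.
case: x => [[i j'] s]; rewrite /starts /= !xpair_eqE -!val_eqE /=.
by rewrite !andbA.
Qed.
Definition crossing_at (c : nat * nat) : nat * nat :=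
  (pd_state c.1 c.2.+1 c.2, pd_state c.1 c.2.+1 c.2.+1).

Lemma word_logE m : word_log (letters_above n m) (mask (letters_above n m)) =
  [seq crossing_at c | c <- letters_above n m & B c.1 c.2].
Proof.
elim: m => [//|m IH]; rewrite -[letters_above n m.+1]/(letters_from m m).
suff H k : word_log (letters_from m k) (mask (letters_from m k)) =
  [seq crossing_at c | c <- letters_from m k & B c.1 c.2] by [].
have [d] := ubnP (n.-1 - k)%N; elim: d k => // d IHd k dk.
have [kn|nk] := ltnP k n.-1; last by rewrite letters_from_top.
rewrite letters_from_cons //= IHd; last by lia.
by case: (B m k).
Qed.

Lemma mem_row_letters i k c : (c \in row_letters n i k) =
  (c.1 == i) && (k <= c.2 < n.-1)%N.
Proof.
apply/mapP/idP => [[k']|].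
  by rewrite mem_iota => hk -> /=; rewrite eqxx; lia.
case: c => [i' k'] /= /andP[/eqP-> hk]; exists k' => //; rewrite mem_iota; lia.
Qed.

Lemma mem_letters m c : (c \in letters_above n m) = (c.1 < m)%N && (c.1 <= c.2 < n.-1)%N.
Proof.
elim: m => [|m IH] //=; rewrite mem_cat mem_row_letters IH.
case: c {IH} => i k /=; rewrite ltnS (leq_eqVlt i m); case: (eqVneq i m) => [->|_] //=.
by rewrite ltnn /= orbF.
Qed.

Lemma uniq_letters m : uniq (letters_above n m).
Proof.
elim: m => [|m IH] //=; rewrite cat_uniq IH andbT.
rewrite map_inj_uniq ?iota_uniq => [|k k' [] //]; apply/hasPn => c.
by rewrite mem_letters mem_row_letters; case: eqP => //= ->; rewrite ltnn.
Qed.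

Lemma letters_lt m : all (fun c => c.2.+1 < n)%N (letters_above n m).
Proof. by apply/allP => -[i k]; rewrite mem_letters /=; lia. Qed.

Lemma crossings_letter (j k : 'I_n) c : j != k ->
  (c \in crossings T North j k) =
  [&& (c.1 + c.2 < n.-1)%N, B c.1 (c.1 + c.2)
    & joins j k (crossing_at (c.1 : nat, c.1 + c.2)%N)].
Proof.
move=> jk; rewrite inE TE; case: ifP => [/andP[kn Bk]|nB]; last by rewrite andbA nB.
have visits (a : 'I_n) : pipe_visits T (pd_start a) c =
    (pd_state c.1 (c.1 + c.2).+1 (c.1 + c.2) == a) ||
    (pd_state c.1 (c.1 + c.2).+1 (c.1 + c.2).+1 == a).
  have kn' : (c.1 + c.2 < n)%N by lia.
  apply/existsP/orP => [[s]|[] h].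
  - by rewrite pd_connect /pd_label /=; case: s; rewrite ?kn ?kn' //; [left|right].
  - by exists North; rewrite pd_connect /pd_label /= kn'.
  - by exists East; rewrite pd_connect /pd_label /= kn.
rewrite eqxx kn Bk /=.
have -> : [exists x, exists y, [&& starts North j x, starts North k y,
    pipe_visits T x c & pipe_visits T y c]] =
    pipe_visits T (pd_start j) c && pipe_visits T (pd_start k) c.
  apply/existsP/andP => [[x /existsP[y]]|[vj vk]].
    by rewrite !pd_startE => /and4P[/eqP-> /eqP->].
  by exists (pd_start j); apply/existsP; exists (pd_start k); rewrite !pd_startE !eqxx vj vk.
rewrite !visits /joins /crossing_at !xpair_eqE /=.
move: jk; rewrite -val_eqE /=; set p := pd_state _ _ _; set q := pd_state _ _ _ => jk.
have n1 : ~~ ((p == j) && (p == k)) by apply: contraNN jk => /andP[/eqP<-].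
have n2 : ~~ ((q == j) && (q == k)) by apply: contraNN jk => /andP[/eqP<-].
by move: n1 n2; case: (p == j); case: (p == k); case: (q == j); case: (q == k).
Qed.

Lemma card_crossings (j k : 'I_n) : j != k ->
  #|crossings T North j k| =
  count (joins j k) (word_log (letters_above n n) (mask (letters_above n n))).
Proof.
move=> jk; rewrite word_logE count_map count_filter -size_filter cardE.
rewrite -(size_map (fun c : cell n => (c.1 : nat, c.1 + c.2)%N)).
apply/perm_size/uniq_perm.
- rewrite map_inj_uniq ?enum_uniq // => -[i1 i2] [k1 k2] /= [/val_inj-> /addnI/val_inj->] //.
- exact: filter_uniq (uniq_letters n).
move=> c; rewrite mem_filter mem_letters; apply/mapP/idP => [[c']|].
  rewrite mem_enum crossings_letter // => /and3P[h1 h2 h3] -> /=.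
  by rewrite h2 h3 ltn_ord leq_addr h1.
case: c => i k' /= /and3P[/andP[h1 h2] ii /andP[ik kn]].
have k'n : (k' - i < n)%N by lia.
have Ek : (i + (k' - i) = k')%N by lia.
exists (Ordinal ii, Ordinal k'n) => /=; last by rewrite Ek.
by rewrite mem_enum crossings_letter //= Ek kn h2 h1.
Qed.

Lemma pd_reduced : reduced T North =
  ascents (word_log (letters_above n n) (mask (letters_above n n))).
Proof.
apply/idP/(chain_reduced (iota_ltn_sorted 0 n) (word_chain _ (letters_lt n))).
  move/forallP => H a b; rewrite !mem_iota !add0n /= => an bn ab.
  have := H (Ordinal an); move/forallP/(_ (Ordinal bn))/implyP/(_ ab).
  by rewrite card_crossings.
move=> H; apply/forallP => j; apply/forallP => k; apply/implyP => jk.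
by rewrite card_crossings // H // mem_iota ltn_ord.
Qed.

Lemma pd_state_exit i : (i < n)%N ->
  word_state (letters_above n n) (mask (letters_above n n)) i = pd_state i i i.
Proof.
move=> ii; rewrite -(@pd_stateE n.-1) // -(@pd_state_final i.+1) //.
by rewrite pd_state_row.
Qed.

Lemma pd_has_perm (pi : 'S_n) : has_perm T North West pi =
  [forall i : 'I_n, word_state (letters_above n n) (mask (letters_above n n)) i == pi i].
Proof.
apply: eq_forallb => i; rewrite pd_state_exit //.
have n0 : (0 < n)%N by apply: leq_ltn_trans (ltn_ord i).
apply/existsP/eqP => [[x /existsP[c /and3P[]]]|E].
  rewrite pd_startE => /eqP-> /eqP ci /andP[/= /eqP c0 /existsP[s' /andP[]]].
  rewrite pd_connect => /eqP lab /eqP /(pd_label_link (y := (c, s'))) /=.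
  by rewrite lab ci c0 addn0 ltn_ord => -[].
exists (pd_start (pi i)); apply/existsP; exists (i, Ordinal n0).
rewrite pd_startE !eqxx /pipe_exits /=; apply/existsP.
have [s' Es'] : exists s', link (T (i, Ordinal n0)) West = Some s'.
  by rewrite TE; case: ifP => _; eexists; reflexivity.
have Es := link_sym Es'; exists s'; rewrite Es eqxx andbT pd_connect.
by rewrite -(pd_label_link (y := (_, s')) Es) /= addn0 ltn_ord E.
Qed.

End PipeDream.

Definition perm_nat n (pi : 'S_n) (i : nat) : nat :=
  if insub i is Some j then val (pi j) else i.

Lemma perm_nat_ord n (pi : 'S_n) (i : 'I_n) : perm_nat pi i = pi i.
Proof. by rewrite /perm_nat valK. Qed.

Lemma perm_nat_perm n (pi : 'S_n) : perm_on_nat n (perm_nat pi).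
Proof.
split=> [i j|i ni]; last by rewrite /perm_nat insubF // ltnNge ni.
rewrite /perm_nat; case: (insubP 'I_n i) => [i' _ <-|]; case: (insubP 'I_n j) => [j' _ <-|] //.
- by move/val_inj/perm_inj->.
- by move=> hj E; have := ltn_ord (pi i'); rewrite E (negPf hj).
- by move=> hi E; have := ltn_ord (pi j'); rewrite -E (negPf hi).
Qed.

Lemma pd_reduced_withE n (B : nat -> nat -> bool) (T : tiling n) (pi : 'S_n) :
  (forall c, T c =
    if (c.1 + c.2 < n.-1)%N && B c.1 (c.1 + c.2)%N then Cross else Elbows) ->
  pd_reduced_with T pi =
  word_reduced n (letters_above n n) (mask B (letters_above n n)) (perm_nat pi).
Proof.
move=> TE; rewrite /pd_reduced_with (pd_reduced TE) (pd_has_perm TE) /word_reduced.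
congr (_ && _); apply/forallP/allP => [H i|H i].
  by rewrite mem_iota add0n => ii; have := H (Ordinal ii); rewrite -perm_nat_ord.
by rewrite -perm_nat_ord; apply: H; rewrite mem_iota ltn_ord.
Qed.

(** * Pipes of a bumpless pipe dream *)

Lemma row_out_take h g ts j : (j < size g)%N -> size ts = size g ->
  row_out h (take j.+1 g) (take j.+1 ts) =
  out_east (nth Blank ts j) (row_out h (take j g) (take j ts)) (nth None g j).
Proof.
elim: g h ts j => [|b g IH] h [|t ts] [|j] //= jg [sz]; first by rewrite !take0.
exact: IH.
Qed.

Lemma nth_row_top h g ts j : (j < size g)%N -> size ts = size g ->
  nth None (row_top h g ts) j =
  out_north (nth Blank ts j) (row_out h (take j g) (take j ts)) (nth None g j).
Proof.
elim: g h ts j => [|b g IH] h [|t ts] [|j] //= jg [sz]; exact: IH.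
Qed.

Lemma row_fitsP h g ts : size ts = size g ->
  reflect (forall j, (j < size g)%N ->
     fits (nth Blank ts j) (row_out h (take j g) (take j ts)) (nth None g j))
    (row_fits h g ts).
Proof.
elim: g h ts => [|b g IH] h [|t ts] //= => [_|[sz]]; first by constructor.
apply: (iffP andP) => [[fit /(IH _ _ sz) H] [|j] //= /H //|H].
by split; [exact: (H 0%N) | apply/(IH _ _ sz) => j jg; exact: (H j.+1)].
Qed.

Lemma count_row_log a h g ts : size ts = size g ->
  count a (row_log h g ts) = (\sum_(j < size g)
    ((nth Blank ts j == Cross) && a (odflt 0 (row_out h (take j g) (take j ts)),
                                  odflt 0 (nth None g j))))%N.
Proof.
elim: g h ts => [|b g IH] h [|t ts] //= => [_|[sz]]; first by rewrite big_ord0.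
rewrite count_cat IH // addnC big_ord_recl /= ; congr (_ + _)%N.
by case: ifP => _ //=; rewrite addn0.
Qed.

Lemma fits_meets t h b : fits t h b ->
  [/\ t != Elbows, meets t West = isSome h, meets t South = isSome b,
      meets t East = isSome (out_east t h b)
    & meets t North = isSome (out_north t h b)].
Proof. by case: t => //; case: h => [?|]; case: b => [?|]. Qed.

Section BumplessPipeDream.
Variables (n : nat) (tau : nat -> nat -> tile).

Definition tile_row i := [seq tau i j | j <- iota 0 n].

Fixpoint tile_rows r := if r is r'.+1 then tile_row r' :: tile_rows r' else [::].

Fixpoint labels_up m : seq (option nat) :=
  if m is m'.+1 then row_top None (labels_up m') (tile_row (n - m'.+1))
  else map Some (iota 0 n).

Definition south_label i j := nth None (labels_up (n - i.+1)) j.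
Definition west_label i j :=
  row_out None (take j (labels_up (n - i.+1))) (take j (tile_row i)).

Lemma size_tile_row i : size (tile_row i) = n.
Proof. by rewrite size_map size_iota. Qed.

Lemma size_tile_rows r : size (tile_rows r) = r.
Proof. by elim: r => //= r ->. Qed.

Lemma nth_tile_rows r i : (i < r)%N -> nth [::] (tile_rows r) i = tile_row (r - i.+1).
Proof. by elim: r i => // r IH [_|i hi] /=; [rewrite subn1 | rewrite IH]. Qed.

Lemma nth_tile_row i j : (j < n)%N -> nth Blank (tile_row i) j = tau i j.
Proof. by move=> jn; rewrite (nth_map 0%N) ?size_iota // nth_iota. Qed.

Lemma size_labels_up m : size (labels_up m) = n.
Proof.
by elim: m => [|m IH] /=; rewrite ?size_map ?size_iota // size_row_top // size_tile_row.
Qed.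

Lemma west_label0 i : west_label i 0 = None.
Proof. by rewrite /west_label !take0. Qed.

Lemma west_labelS i j : (j < n)%N ->
  west_label i j.+1 = out_east (tau i j) (west_label i j) (south_label i j).
Proof.
by move=> jn; rewrite /west_label row_out_take ?size_tile_row ?size_labels_up // nth_tile_row.
Qed.

Lemma south_label_last j : (j < n)%N -> south_label n.-1 j = Some j.
Proof.
move=> jn; rewrite /south_label (_ : n - n.-1.+1 = 0)%N; last lia.
by rewrite (nth_map 0%N) ?size_iota // nth_iota.
Qed.

Lemma south_labelS i j : (i.+1 < n)%N -> (j < n)%N ->
  south_label i j = out_north (tau i.+1 j) (west_label i.+1 j) (south_label i.+1 j).
Proof.
move=> hi jn; rewrite /south_label (_ : n - i.+1 = (n - i.+2).+1)%N; last lia.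
have E : (n - (n - i.+2).+1 = i.+1)%N by lia.
by rewrite /= E nth_row_top ?size_tile_row ?size_labels_up // nth_tile_row.
Qed.

Lemma labels_upS i : (i < n)%N ->
  labels_up (n - i) = row_top None (labels_up (n - i.+1)) (tile_row i).
Proof.
move=> hi; rewrite (_ : n - i = (n - i.+1).+1)%N /=; last lia.
by rewrite (_ : n - (n - i.+1).+1 = i)%N //; lia.
Qed.

Lemma row_fits_tile i : (i < n)%N ->
  reflect (forall j, (j < n)%N -> fits (tau i j) (west_label i j) (south_label i j))
    (row_fits None (labels_up (n - i.+1)) (tile_row i)).
Proof.
move=> hi; apply: (iffP (row_fitsP _ _)) => [|H j hj|H j].
- by rewrite size_tile_row size_labels_up.
- by have := H j; rewrite size_labels_up nth_tile_row //; apply.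
- by rewrite size_labels_up => hj; rewrite nth_tile_row //; apply: H.
Qed.

Lemma tile_rows_fits r : (r <= n)%N ->
  reflect [/\ forall i j, (i < r)%N -> (j < n)%N ->
                fits (tau i j) (west_label i j) (south_label i j),
              forall i, (i < r)%N -> isSome (west_label i n)
            & all (pred1 None) (labels_up n)]
    (grid_fits (tile_rows r) (labels_up (n - r))).
Proof.
elim: r => [|r IH] rn /=.
  by rewrite subn0; apply: (iffP idP) => [h|[]] //; split.
have Ew : row_out None (labels_up (n - r.+1)) (tile_row r) = west_label r n.
  by rewrite /west_label !take_oversize ?size_labels_up ?size_tile_row.
rewrite Ew -labels_upS //; apply: (iffP and3P).
  case=> /(row_fits_tile rn) H1 H2 /(IH (ltnW rn))[H3 H4 H5]; split=> //.
    move=> i j; rewrite ltnS leq_eqVlt => /orP[/eqP->|]; [exact: H1|exact: H3].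
  by move=> i; rewrite ltnS leq_eqVlt => /orP[/eqP->|/H4].
case=> H1 H2 H3; split; first by apply/(row_fits_tile rn) => j; apply: H1.
  exact: H2.
by apply/(IH (ltnW rn)); split=> // i *; [apply: H1|apply: H2] => //; apply: ltnW.
Qed.

Lemma tile_rows_exits r : (r <= n)%N ->
  grid_exits (tile_rows r) (labels_up (n - r)) =
  [seq odflt 0%N (west_label i n) | i <- iota 0 r].
Proof.
elim: r => [//|r IH] rn; rewrite [tile_rows _]/= [grid_exits _ _]/= -labels_upS //.
rewrite IH 1?ltnW // -[in RHS]addn1 iotaD map_cat cats1 add0n /=; congr (rcons _ (odflt _ _)).
by rewrite /west_label !take_oversize ?size_labels_up ?size_tile_row.
Qed.

Lemma count_tile_rows_log a r : (r <= n)%N ->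
  count a (grid_log (tile_rows r) (labels_up (n - r))) =
  (\sum_(i < r) \sum_(j < n) ((tau i j == Cross) &&
     a (odflt 0%N (west_label i j), odflt 0%N (south_label i j))))%N.
Proof.
elim: r => [|r IH] rn; first by rewrite big_ord0.
rewrite /= -labels_upS // count_cat IH 1?ltnW // big_ord_recr /=; congr (_ + _)%N.
rewrite count_row_log ?size_tile_row ?size_labels_up //; apply: eq_bigr => j _.
by rewrite nth_tile_row.
Qed.

Variable T : tiling n.
Hypothesis TE : forall c, T c = tau c.1 c.2.

Lemma bpd_fits : is_bpd T = grid_fits (tile_rows n) (labels_up 0).
Proof.
rewrite -(subnn n); apply/idP/(tile_rows_fits (leqnn n)).
  case/and3P => /forallP nE /forallP nb /forallP bd.
  have nbP (c : cell n) s c' : neighbor c s c' -> meets (T c) s = meets (T c') (opposite s).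
    by move/forallP: (nb c) => /(_ s)/forallP/(_ c')/implyP H /H/eqP.
  have bdP (c : cell n) s : on_border c s -> meets (T c) s = (s == South) || (s == East).
    by move/forallP: (bd c) => /(_ s)/implyP H /H/eqP.
  (* The invariant is that an edge is used by its tiles exactly when it carries a label; it spreads
     from the bottom row upwards and within a row from the left. *)
  have F i j : (i < n)%N -> (j < n)%N -> fits (tau i j) (west_label i j) (south_label i j).
    have [m] := ubnP (n - i)%N; elim: m i j => // m IHm i j im hi.
    have fitE k (hk : (k < n)%N) : (meets (tau i k) West = isSome (west_label i k)) ->
        fits (tau i k) (west_label i k) (south_label i k).
      move=> EW; have := nE (Ordinal hi, Ordinal hk); rewrite TE /fits EW /= => ->.
      rewrite eqxx /=; have [lt_i|le_n] := ltnP i.+1 n.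
        have := @nbP (Ordinal hi, Ordinal hk) South (Ordinal lt_i, Ordinal hk).
        rewrite /= !eqxx !TE /= => -> //; rewrite south_labelS //.
        have im' : (n - i.+1 < m)%N by lia.
        by have [_ _ _ _ <-] := fits_meets (IHm i.+1 k im' lt_i hk).
      have Ei : i = n.-1 by lia.
      have := bdP (Ordinal hi, Ordinal hk) South; rewrite TE /= => -> /=; last lia.
      by rewrite [in south_label i]Ei south_label_last.
    elim: j => [|j IHj] hj; apply: fitE => //.
      have := bdP (Ordinal hi, Ordinal hj) West; rewrite TE /= west_label0 => -> //.
    have hj' := ltnW hj.
    have := @nbP (Ordinal hi, Ordinal hj) West (Ordinal hi, Ordinal hj').
    rewrite /= !eqxx !TE /= => -> //; rewrite west_labelS //.
    by have /fits_meets[_ _ _ <- _] := IHj hj'.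
  split=> //.
    move=> i hi; have n0 : (n.-1 < n)%N by lia.
    have := bdP (Ordinal hi, Ordinal n0) East; rewrite TE /= => E.
    have := west_labelS i n0; rewrite prednK; last by lia.
    move=> ->; have /fits_meets[_ _ _ <- _] := F i n.-1 hi n0.
    by rewrite E //; lia.
  apply/(all_nthP None) => j; rewrite size_labels_up => hj.
  have n0 : (0 < n)%N by apply: leq_ltn_trans hj.
  have E0 : labels_up n = row_top None (labels_up (n - 1)) (tile_row 0).
    by rewrite -labels_upS // subn0.
  rewrite E0 nth_row_top ?size_labels_up ?size_tile_row // nth_tile_row //.
  have /fits_meets[_ _ _ _] := F 0%N j n0 hj; rewrite /west_label /south_label.
  have := bdP (Ordinal n0, Ordinal hj) North; rewrite TE /= => -> //.
  by rewrite /= ; case: out_north.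
case=> F exitF top.
have M (c : cell n) := fits_meets (F _ _ (ltn_ord c.1) (ltn_ord c.2)).
have nbS (c c' : cell n) : neighbor c South c' -> meets (T c) South = meets (T c') North.
  case: c c' => [i j] [i' j'] /= /andP[/eqP Ei /eqP Ej]; rewrite !TE /=.
  have [_ _ -> _ _] := M (i, j); have [_ _ _ _ ->] := M (i', j').
  rewrite /= Ei Ej south_labelS //; have := ltn_ord i'; lia.
have nbE (c c' : cell n) : neighbor c East c' -> meets (T c) East = meets (T c') West.
  case: c c' => [i j] [i' j'] /= /andP[/eqP Ei /eqP Ej]; rewrite !TE /=.
  have [_ _ _ -> _] := M (i, j); have [_ -> _ _ _] := M (i', j').
  by rewrite /= Ei Ej west_labelS.
apply/and3P; split.
- by apply/forallP => c; rewrite TE; have [] := M c.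
- apply/forallP => c; apply/forallP => s; apply/forallP => c'; apply/implyP.
  case: s => nb; apply/eqP; rewrite /=.
  + apply/esym/nbS; move: nb => /= /andP[/eqP-> /eqP->]; by rewrite !eqxx.
  + exact: nbS.
  + exact: nbE.
  + apply/esym/nbE; move: nb => /= /andP[/eqP-> /eqP->]; by rewrite !eqxx.
apply/forallP => -[i j]; apply/forallP => s; apply/implyP.
have [_ mW mS mE mN] := M (i, j); rewrite /= in mW mS mE mN.
case: s => /= bd; rewrite TE /= ?mN ?mS ?mE ?mW.
- have n0 : (0 < n)%N by apply: leq_ltn_trans (ltn_ord i).
  have := all_nthP None top j; rewrite size_labels_up => /(_ (ltn_ord j)) /=.
  have E0 : labels_up n = row_top None (labels_up (n - 1)) (tile_row 0).
    by rewrite -labels_upS // subn0.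
  rewrite E0 nth_row_top ?size_labels_up ?size_tile_row // nth_tile_row //.
  by rewrite /west_label /south_label (eqP bd) => /eqP->.
- have -> : (i : nat) = n.-1 by have := eqP bd; lia.
  by rewrite south_label_last.
- by rewrite -west_labelS // (eqP bd) exitF.
- by rewrite (eqP bd) west_label0.
Qed.

Definition bpd_label (y : state n) : option nat :=
  match y.2 with
  | South => south_label y.1.1 y.1.2
  | West => west_label y.1.1 y.1.2
  | _ => None
  end.

Definition bpd_out (i j : nat) (s : side) : option nat :=
  match s with
  | North => out_north (tau i j) (west_label i j) (south_label i j)
  | East => out_east (tau i j) (west_label i j) (south_label i j)
  | _ => None
  end.

Hypothesis bT : is_bpd T.

Lemma bpd_not_elbows c : T c != Elbows.
Proof. by case/and3P: bT => /forallP. Qed.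

Lemma bpd_label_link (y : state n) s : link (T y.1) y.2 = Some s ->
  bpd_out y.1.1 y.1.2 s = bpd_label y.
Proof.
case: y => [[i j] s0] /=; have := bpd_not_elbows (i, j); rewrite TE /bpd_label /=.
by case Et: (tau i j) s0 => -[] //= _ [<-] //=; rewrite Et.
Qed.

Lemma bpd_out_neighbor (c c' : cell n) s : neighbor c s c' ->
  bpd_out c.1 c.2 s = bpd_label (c', opposite s).
Proof.
case: c c' => [i j] [i' j'] /=; case: s => //= /andP[/eqP Ei /eqP Ej]; rewrite /bpd_label /=.
- by rewrite Ej -Ei (@south_labelS i' j) // Ei.
- by rewrite Ei Ej west_labelS.
Qed.

Lemma bpd_out_link (c : cell n) s a : bpd_out c.1 c.2 s = Some a ->
  exists2 s', link (T c) s' = Some s & bpd_label (c, s') = Some a.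
Proof.
move=> out; have [s' Es'] : exists s', link (T c) s' = Some s.
  move: out; rewrite TE; case: s => //=; case: (tau _ _) => //= _;
  by [exists South | exists West].
by exists s'; rewrite // -(bpd_label_link (y := (c, s')) Es').
Qed.

Definition bpd_start (j : 'I_n) : state n := ((rev_ord (Ordinal (leq_ltn_trans (leq0n j) (ltn_ord j))), j), South).

Lemma bpd_label_start j : bpd_label (bpd_start j) = Some (j : nat).
Proof. by rewrite /bpd_label /= subn1 south_label_last. Qed.

Lemma bpd_pred (y : state n) (j : 'I_n) : bpd_label y = Some (j : nat) ->
  y = bpd_start j \/ exists x, [/\ Defs.next T x y, bpd_label x = Some (j : nat)
    & ((n - x.1.1) * n + x.1.2 < (n - y.1.1) * n + y.1.2)%N].
Proof.
move=> laby.
have step c s : neighbor c s y.1 -> y.2 = opposite s ->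
    ((n - c.1) * n + c.2 < (n - y.1.1) * n + y.1.2)%N ->
    exists x, [/\ Defs.next T x y, bpd_label x = Some (j : nat)
    & ((n - x.1.1) * n + x.1.2 < (n - y.1.1) * n + y.1.2)%N].
  move=> nb opp lt_mu; have out : bpd_out c.1 c.2 s = Some (j : nat).
    by rewrite (bpd_out_neighbor nb) -opp -surjective_pairing.
  have [s' Es' lab] := bpd_out_link out.
  by exists (c, s'); split=> //; rewrite /Defs.next /= Es' nb opp eqxx.
case: y laby step => [[i j'] s] /=; rewrite {1}/bpd_label /=; case: s => //.
- move=> E step; have [hi|hi] := ltnP i.+1 n; [right|left].
    apply: (step (Ordinal hi, j') North) => //=; first by rewrite !eqxx.
    have := ltn_ord j'; have -> : (n - i = (n - i.+1).+1)%N by lia.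
    by rewrite mulSn; lia.
  have Ei : (i : nat) = n.-1 by have := ltn_ord i; lia.
  rewrite Ei south_label_last // in E; case: E => E.
  rewrite /bpd_start; congr (_, _, _); apply: val_inj => //=; rewrite ?Ei; lia.
- case Ej: (j' : nat) => [|j0]; first by rewrite west_label0.
  move=> _ step; right; have hj : (j0 < n)%N by have := ltn_ord j'; lia.
  by apply: (step (i, Ordinal hj) East) => //=; rewrite ?Ej ?eqxx //; lia.
Qed.

Lemma bpd_connect (j : 'I_n) y :
  connect (Defs.next T) (bpd_start j) y = (bpd_label y == Some (j : nat)).
Proof.
(* Here pipes move north and east only. *)
apply: (@connect_label (state n) nat (Defs.next T) bpd_label
  (fun y => ((n - y.1.1) * n + y.1.2)%N)).
- move=> x y'; rewrite /Defs.next; case El: link => [s|//] /andP[nb /eqP opp] <-.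
  by rewrite -(bpd_label_link El) (bpd_out_neighbor nb) -opp -surjective_pairing.
- exact: bpd_label_start.
- by move=> y' laby'; exact: bpd_pred.
Qed.

Lemma bpd_startE j x : starts South j x = (x == bpd_start j).
Proof.
case: x => [[i j'] s]; rewrite /starts /= !xpair_eqE -!val_eqE /= andbA.
by congr (_ && _ && _); have := ltn_ord i; lia.
Qed.
Lemma bpd_local_fit i j : (i < n)%N -> (j < n)%N ->
  fits (tau i j) (west_label i j) (south_label i j).
Proof.
by move: bT; rewrite bpd_fits -(subnn n) => /(tile_rows_fits (leqnn n))[F _ _]; apply: F.
Qed.

Lemma crossings_bpd (j k : 'I_n) c : j != k ->
  (c \in crossings T South j k) = (tau c.1 c.2 == Cross) &&
    joins j k (odflt 0%N (west_label c.1 c.2), odflt 0%N (south_label c.1 c.2)).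
Proof.
move=> jk; rewrite inE TE; case: eqP => //= Ec.
have := bpd_local_fit (ltn_ord c.1) (ltn_ord c.2); rewrite Ec.
case Ew: (west_label _ _) => [p|//]; case Es: (south_label _ _) => [q|//] _ /=.
have visits (a : 'I_n) : pipe_visits T (bpd_start a) c = (p == a) || (q == a).
  apply/existsP/orP => [[s]|[] h].
  - by rewrite bpd_connect /bpd_label /=; case: s; rewrite ?Ew ?Es //; [right|left].
  - by exists West; rewrite bpd_connect /bpd_label /= Ew.
  - by exists South; rewrite bpd_connect /bpd_label /= Es.
have -> : [exists x, exists y, [&& starts South j x, starts South k y,
    pipe_visits T x c & pipe_visits T y c]] =
    pipe_visits T (bpd_start j) c && pipe_visits T (bpd_start k) c.
  apply/existsP/andP => [[x /existsP[y]]|[vj vk]].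
    by rewrite !bpd_startE => /and4P[/eqP-> /eqP->].
  by exists (bpd_start j); apply/existsP; exists (bpd_start k); rewrite !bpd_startE !eqxx vj vk.
rewrite !visits /joins !xpair_eqE /=; move: jk; rewrite -val_eqE /= => jk.
have n1 : ~~ ((p == j) && (p == k)) by apply: contraNN jk => /andP[/eqP<-].
have n2 : ~~ ((q == j) && (q == k)) by apply: contraNN jk => /andP[/eqP<-].
by move: n1 n2; case: (p == j); case: (p == k); case: (q == j); case: (q == k).
Qed.

Lemma card_crossings_bpd (j k : 'I_n) : j != k ->
  #|crossings T South j k| = count (joins j k) (grid_log (tile_rows n) (labels_up 0)).
Proof.
move=> jk; rewrite -(subnn n) count_tile_rows_log // -sum1_card pair_big /=.
by rewrite big_mkcond /=; apply: eq_bigr => c _; rewrite crossings_bpd.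
Qed.

Lemma bpd_chain :
  chain (iota 0 n) (grid_log (tile_rows n) (labels_up 0))
    (grid_exits (tile_rows n) (labels_up 0)).
Proof.
have := grid_chain [::] (etrans (esym bpd_fits) bT); rewrite !cats0.
by rewrite (_ : pmap id _ = iota 0 n) //= ; elim: (iota 0 n) => //= c s ->.
Qed.

Lemma bpd_reduced : reduced T South = ascents (grid_log (tile_rows n) (labels_up 0)).
Proof.
apply/idP/(chain_reduced (iota_ltn_sorted 0 n) bpd_chain).
  move/forallP => H a b; rewrite !mem_iota !add0n => /= an bn ab.
  have := H (Ordinal an); move/forallP/(_ (Ordinal bn))/implyP/(_ ab).
  by rewrite card_crossings_bpd.
move=> H; apply/forallP => j; apply/forallP => k; apply/implyP => jk.
by rewrite card_crossings_bpd // H // mem_iota ltn_ord.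
Qed.

Lemma bpd_has_perm (pi : 'S_n) : has_perm T South East pi =
  (grid_exits (tile_rows n) (labels_up 0) == [seq perm_nat pi i | i <- iota 0 (size (tile_rows n))]).
Proof.
rewrite size_tile_rows; have exits := tile_rows_exits (leqnn n); rewrite subnn in exits; rewrite {}exits.
have out i : (i < n)%N -> isSome (west_label i n).
  by move: bT; rewrite bpd_fits -(subnn n) => /(tile_rows_fits (leqnn n))[_ F _]; apply: F.
have out_last i : (0 < n)%N -> west_label i n = bpd_out i n.-1 East.
  by move=> n0; rewrite /= -west_labelS ?prednK.
apply/forallP/eqP => [H|/eq_in_map H i].
  apply/eq_in_map => i; rewrite mem_iota add0n => /= hi.
  have n0 : (n.-1 < n)%N by lia.
  have /existsP[x /existsP[c /and3P[]]] := H (Ordinal hi).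
  rewrite bpd_startE => /eqP-> /eqP ci /andP[/= /eqP cn /existsP[s' /andP[]]].
  rewrite bpd_connect => /eqP lab /eqP /(bpd_label_link (y := (c, s'))).
  have -> : bpd_out c.1 c.2 East = west_label i n.
    by rewrite out_last ?ci; [rewrite (congr1 predn cn : (c.2 : nat) = n.-1) | lia].
  by rewrite lab => ->; rewrite /= -(perm_nat_ord pi (Ordinal hi)).
have n0 : (n.-1 < n)%N by have := ltn_ord i; lia.
have := H i; rewrite mem_iota add0n ltn_ord perm_nat_ord => /(_ isT).
case Eo: (west_label i n) (out i (ltn_ord i)) => [a|//] _ /= Ea.
move: Eo; rewrite out_last ?Ea; last lia.
move/(@bpd_out_link (i, Ordinal n0) East) => [s' Es' lab].
apply/existsP; exists (bpd_start (pi i)); apply/existsP; exists (i, Ordinal n0).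
rewrite bpd_startE !eqxx /pipe_exits /=; apply/andP; split; first by apply/eqP; lia.
by apply/existsP; exists s'; rewrite bpd_connect lab Es' !eqxx.
Qed.

End BumplessPipeDream.

Definition tile_at n (T : tiling n) (i j : nat) : tile :=
  match insub i, insub j with
  | Some i', Some j' => T (i', j')
  | _, _ => Blank
  end.

Lemma tile_atE n (T : tiling n) c : T c = tile_at T c.1 c.2.
Proof. by rewrite /tile_at !valK; case: c. Qed.

Lemma bpd_reduced_withE n (T : tiling n) (pi : 'S_n) :
  is_bpd T && bpd_reduced_with T pi =
  grid_reduced (tile_rows n (tile_at T) n) (map Some (iota 0 n)) (perm_nat pi).
Proof.
have TE := tile_atE T; rewrite /grid_reduced -[map Some _]/(labels_up n (tile_at T) 0).
rewrite -(bpd_fits TE) /bpd_reduced_with; case bT: (is_bpd T) => //=.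
by rewrite (bpd_reduced TE bT) (bpd_has_perm TE bT).
Qed.

Section TilingSum.
Variables (R : comRingType) (x : nat -> R) (n : nat).

Definition tiling_wt (T : tiling n) : R := \prod_(c | T c == Blank) x c.1.

Lemma grid_wt_tiling (T : tiling n) :
  grid_wt x (tile_rows n (tile_at T) n) = tiling_wt T.
Proof.
have E r : grid_wt x (tile_rows n (tile_at T) r) =
    \prod_(i < r) \prod_(j < n) (if tile_at T i j == Blank then x i else 1).
  elim: r => [|r IH] /=; first by rewrite big_ord0.
  rewrite size_tile_rows IH big_ord_recr /= mulrC; congr (_ * _).
  rewrite /tile_row -(big_mkord xpredT (fun j => if tile_at T r j == Blank then x r else 1)).
  rewrite /index_iota subn0; elim: (iota 0 n) => [|j s IHs] /=; first by rewrite big_nil.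
  by rewrite big_cons -IHs; case: eqP => _; rewrite ?exprS ?mul1r // add1n exprS.
rewrite E pair_big /= /tiling_wt [RHS]big_mkcond; apply: eq_bigr => c _.
by rewrite tile_atE.
Qed.

Lemma sum_tilings (F : seq (seq tile) -> R) :
  \sum_(T : tiling n) F (tile_rows n (tile_at T) n) =
  \sum_(rs : n.-tuple (n.-tuple tile)) F [seq val ts | ts <- rs].
Proof.
(* The reversal is due to rows being listed from the bottom. *)
pose f (rs : n.-tuple (n.-tuple tile)) : tiling n :=
  [ffun c => tnth (tnth rs (rev_ord c.1)) c.2].
have fE rs : tile_rows n (tile_at (f rs)) n = [seq val ts | ts <- rs].
  apply: (@eq_from_nth _ [::]) => [|i]; first by rewrite size_tile_rows size_map size_tuple.
  rewrite size_tile_rows => hi; pose i' := Ordinal hi.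
  have -> : nth [::] (tile_rows n (tile_at (f rs)) n) i = tile_row n (tile_at (f rs)) (rev_ord i').
    by rewrite nth_tile_rows.
  rewrite (nth_map (tnth rs i')) ?size_tuple // -(tnth_nth _ rs i').
  apply: (@eq_from_nth _ Blank) => [|j]; first by rewrite size_tile_row size_tuple.
  rewrite size_tile_row => hj; rewrite nth_tile_row //.
  rewrite (_ : j = Ordinal hj) // -(tile_atE (f rs) (rev_ord i', Ordinal hj)).
  by rewrite ffunE /= rev_ordK (tnth_nth Blank).
rewrite (reindex f) /=; first by apply: eq_bigr => rs _; rewrite fE.
exists (fun T : tiling n => [tuple [tuple T (rev_ord i, j) | j < n] | i < n]) => [rs _|T _].
  apply: eq_from_tnth => i; rewrite tnth_mktuple; apply: eq_from_tnth => j.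
  by rewrite tnth_mktuple ffunE /= rev_ordK.
by apply/ffunP => -[i j]; rewrite ffunE /= !tnth_mktuple rev_ordK.
Qed.

Theorem sum_bpd (pi : 'S_n) :
  \sum_(T : tiling n | is_bpd T && bpd_reduced_with T pi) tiling_wt T =
  bpd_sum x n n (map Some (iota 0 n)) (perm_nat pi).
Proof.
rewrite big_mkcond /bpd_sum /= -(sum_tilings (fun rs =>
  if grid_reduced rs (map Some (iota 0 n)) (perm_nat pi) then grid_wt x rs else 0)).
by apply: eq_bigr => T _; rewrite bpd_reduced_withE grid_wt_tiling.
Qed.
End TilingSum.

(** * Alternating sign matrices *)

Definition asm_of n (T : tiling n) : 'M[int]_n :=
  \matrix_(i, j) (if T (i, j) == RTile then 1 else if T (i, j) == JTile then -1 else 0).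

(** Since an entry is the difference of the occupancies of opposite edges, partial sums of a row or
    column telescope to the occupancy of an edge. Unit sums, alternation and the weight condition
    all follow from this. *)
Lemma meets_asm (t : tile) : t != Elbows ->
  ((if t == RTile then 1 else if t == JTile then -1 else 0) =
    (meets t East)%:R - (meets t West)%:R :> int) /\
  ((if t == RTile then 1 else if t == JTile then -1 else 0) =
    (meets t South)%:R - (meets t North)%:R :> int).
Proof. by case: t. Qed.

Lemma telescope_ord n (f : 'I_n -> int) (e : nat -> int) (i : 'I_n) :
  (forall j : 'I_n, f j = e j.+1 - e j) -> \sum_(j < n | (j <= i)%N) f j = e i.+1 - e 0%N.
Proof.
move=> fE; rewrite (eq_bigr (fun j : 'I_n => e j.+1 - e j)) //.
rewrite -(big_ord_widen n (fun j => e j.+1 - e j) (ltn_ord i)).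
by rewrite -(big_mkord xpredT (fun j => e j.+1 - e j)) telescope_sumr.
Qed.

(** Between consecutive nonzero entries [e] is constant, so the second step of [e] undoes the
    first. *)
Lemma alternates_bool n (f : 'I_n -> int) (e : nat -> bool) :
  (forall j : 'I_n, f j = (e j.+1)%:R - (e j)%:R) -> alternates f.
Proof.
move=> fE; apply/forallP => j; apply/forallP => k; apply/implyP.
case/and4P => jk fj fk /forallP mid.
have same m : (j < m <= k)%N -> e m = e j.+1.
  elim: m => // m IH; rewrite ltnS => /andP[jm mk].
  case: (ltngtP j m) jm => // [jm _|-> //].
  have mn : (m < n)%N by apply: leq_trans (ltn_ord k); apply: ltnW.
  have := mid (Ordinal mn); rewrite /= jm mk => /eqP.
  rewrite fE /= -IH ?jm 1?ltnW //; by case: (e m.+1); case: (e m).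
move: fj fk; rewrite !fE (same k) ?jk ?leqnn //.
by case: (e j.+1); case: (e j); case: (e k.+1).
Qed.

Section AsmOfBpd.
Variables (n : nat) (T : tiling n).
Hypothesis bT : is_bpd T.

Let nE c : T c != Elbows. Proof. by case/and3P: bT => /forallP. Qed.

Let nb (c c' : cell n) s : neighbor c s c' -> meets (T c) s = meets (T c') (opposite s).
Proof.
by case/and3P: bT => _ /forallP/(_ c)/forallP/(_ s)/forallP/(_ c')/implyP H _ /H/eqP.
Qed.

Let bd (c : cell n) s : on_border c s -> meets (T c) s = (s == South) || (s == East).
Proof. by case/and3P: bT => _ _ /forallP/(_ c)/forallP/(_ s)/implyP H /H/eqP. Qed.

Definition west_edge (i : 'I_n) (j : nat) : bool :=
  if j is j'.+1 then (if insub j' is Some j0 then meets (T (i, j0)) East else false) else false.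

Definition north_edge (j : 'I_n) (i : nat) : bool :=
  if i is i'.+1 then (if insub i' is Some i0 then meets (T (i0, j)) South else false) else false.

Lemma west_edgeS i (j : 'I_n) : west_edge i j.+1 = meets (T (i, j)) East.
Proof. by rewrite /= valK. Qed.

Lemma north_edgeS j (i : 'I_n) : north_edge j i.+1 = meets (T (i, j)) South.
Proof. by rewrite /= valK. Qed.

Lemma asm_of_row i j : asm_of T i j = (west_edge i j.+1)%:R - (west_edge i j)%:R.
Proof.
rewrite mxE (meets_asm (nE _)).1 west_edgeS; congr (_ - (nat_of_bool _)%:R).
case Ej: (j : nat) => [|j']; first by rewrite bd //= Ej.
have hj : (j' < n)%N by have := ltn_ord j; lia.
rewrite -[j'](erefl : val (Ordinal hj) = _) west_edgeS.
by rewrite (nb (c' := (i, Ordinal hj))) //= Ej !eqxx.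
Qed.

Lemma asm_of_col i j : asm_of T i j = (north_edge j i.+1)%:R - (north_edge j i)%:R.
Proof.
rewrite mxE (meets_asm (nE _)).2 north_edgeS; congr (_ - (nat_of_bool _)%:R).
case Ei: (i : nat) => [|i']; first by rewrite bd //= Ei.
have hi : (i' < n)%N by have := ltn_ord i; lia.
rewrite -[i'](erefl : val (Ordinal hi) = _) north_edgeS.
by rewrite (nb (c' := (Ordinal hi, j))) //= Ei !eqxx.
Qed.

Lemma asm_of_row_sum (i j : 'I_n) :
  \sum_(k < n | (k <= j)%N) asm_of T i k = (meets (T (i, j)) East)%:R.
Proof.
rewrite (telescope_ord (e := fun k => (west_edge i k)%:R) j (asm_of_row i)).
by rewrite west_edgeS subr0.
Qed.

Lemma asm_of_col_sum (i j : 'I_n) :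
  \sum_(k < n | (k <= i)%N) asm_of T k j = (meets (T (i, j)) South)%:R.
Proof.
rewrite (telescope_ord (e := fun k => (north_edge j k)%:R) i (fun k => asm_of_col k j)).
by rewrite north_edgeS subr0.
Qed.

Lemma asm_of_is_asm : is_asm (asm_of T).
Proof.
apply/and5P; split.
- by apply/forallP => i; apply/forallP => j; rewrite mxE; case: (T (i, j)).
- apply/forallP => i; have n0 : (n.-1 < n)%N by have := ltn_ord i; lia.
  have := asm_of_row_sum i (Ordinal n0); rewrite bd /=; last by apply/eqP; lia.
  move=> E; apply/eqP; apply: etrans E; apply: eq_bigl => k; have := ltn_ord k; lia.
- apply/forallP => j; have n0 : (n.-1 < n)%N by have := ltn_ord j; lia.
  have := asm_of_col_sum (Ordinal n0) j; rewrite bd /=; last by apply/eqP; lia.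
  move=> E; apply/eqP; apply: etrans E; apply: eq_bigl => k; have := ltn_ord k; lia.
- by apply/forallP => i; apply: (alternates_bool (e := west_edge i)) => j; apply: asm_of_row.
- by apply/forallP => j; apply: (alternates_bool (e := north_edge j)) => i; apply: asm_of_col.
Qed.

Lemma asm_of_bpd : asm_bpd (asm_of T) T.
Proof.
rewrite /asm_bpd bT; apply/forallP => -[i j]; rewrite mxE /=.
by case: (T (i, j)).
Qed.

Lemma asm_wt_of : asm_wt (asm_of T) = \prod_(c | T c == Blank) 'X_(c.1).
Proof.
apply: eq_bigl => -[i j]; rewrite /= asm_of_col_sum asm_of_row_sum mxE.
by have := nE (i, j); case: (T (i, j)).
Qed.
End AsmOfBpd.

(** A tile is determined by its entry and the occupancies of its south and east edges, which are
    partial sums of the matrix. *)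
Lemma asm_of_inj n (T T' : tiling n) : is_bpd T -> is_bpd T' ->
  asm_of T = asm_of T' -> T = T'.
Proof.
move=> bT bT' E; apply/ffunP => -[i j].
have := asm_of_row_sum bT i j; rewrite E (asm_of_row_sum bT').
have := asm_of_col_sum bT i j; rewrite E (asm_of_col_sum bT').
have := congr1 (fun A : 'M_n => A i j) E; rewrite !mxE.
have /and3P[/forallP/(_ (i, j)) nE _ _] := bT.
have /and3P[/forallP/(_ (i, j)) nE' _ _] := bT'.
by move: nE nE'; case: (T (i, j)); case: (T' (i, j)).
Qed.

Lemma asm_bpd_asm_of n (A : 'M[int]_n) T : is_asm A -> asm_bpd A T -> A = asm_of T.
Proof.
case/and5P => /forallP ent _ _ _ _ /andP[_ /forallP H].
apply/matrixP => i j; rewrite mxE; have /andP[/= /eqP-> /eqP->] := H (i, j).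
have /forallP/(_ j) := ent i; rewrite !inE => /or3P[]/eqP-> //.
Qed.

Definition BPDred n (pi : 'S_n) := {T : tiling n | is_bpd T && bpd_reduced_with T pi}.

Lemma asm_of_red n (pi : 'S_n) (T : BPDred pi) : asm_red pi (asm_of (val T)).
Proof.
have /andP[bT rT] := valP T; rewrite /asm_red asm_of_is_asm //=.
by apply/existsP; exists (val T); rewrite asm_of_bpd.
Qed.

Definition asm_of_BPDred n (pi : 'S_n) (T : BPDred pi) : ASMred pi :=
  exist _ (asm_of (val T)) (asm_of_red T).

Lemma asm_of_BPDred_bij n (pi : 'S_n) : bijective (@asm_of_BPDred n pi).
Proof.
have exT (A : ASMred pi) : exists T, asm_bpd (val A) T && bpd_reduced_with T pi.
  by have /andP[_ /existsP] := valP A.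
have redT A : is_bpd (xchoose (exT A)) && bpd_reduced_with (xchoose (exT A)) pi.
  by have /andP[/andP[-> _] ->] := xchooseP (exT A).
exists (fun A => exist _ (xchoose (exT A)) (redT A)) => [T|A]; apply: val_inj => /=.
  have /andP[aT _] := xchooseP (exT (asm_of_BPDred T)).
  have /andP[bT _] := valP T; have /andP[bT' _] := aT.
  by apply: (asm_of_inj bT' bT); rewrite -(asm_bpd_asm_of _ aT) //= asm_of_is_asm.
have /andP[aT _] := xchooseP (exT A).
by rewrite -(asm_bpd_asm_of _ aT) //; have /andP[] := valP A.
Qed.

(** * Avoiding 1432 *)

Section Pattern.
Variables (n : nat) (B : nat -> nat -> bool).
Let st := pd_state n B.

Lemma word_state_perm l bs : all (fun c => c.2.+1 < n)%N l ->
  perm_on_nat n (word_state l bs).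
Proof.
elim: l bs => [|c l IH] [|b bs] /=; try by move=> _; split.
case/andP=> cn ln; case: b; last exact: IH.
by apply: perm_on_nat_sw (IH bs ln) => //; lia.
Qed.

Lemma pd_state_perm i k : perm_on_nat n (st i k).
Proof.
apply: word_state_perm; rewrite all_cat letters_lt andbT.
by apply/allP => -[i' k']; rewrite mem_row_letters /=; lia.
Qed.

Lemma pd_state_inj i k a b : st i k a = st i k b -> a = b.
Proof. exact: (pd_state_perm i k).1. Qed.

Lemma pd_state_ind (P : nat -> (nat -> nat) -> Prop) i k0 k1 : (k0 <= k1)%N ->
  (forall k, (k0 <= k < k1)%N -> P k.+1 (st i k.+1) -> P k (st i k.+1) /\
     (B i k -> (k < n.-1)%N -> P k (st i k.+1 \o sw k k.+1))) ->
  P k1 (st i k1) -> P k0 (st i k0).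
Proof.
move=> k01 step P1.
suff H d : (d <= k1 - k0)%N -> P (k1 - d)%N (st i (k1 - d)) by rewrite -(subKn k01); apply: H.
elim: d => [|d IH] dk; first by rewrite subn0.
have Ek : ((k1 - d.+1).+1 = k1 - d)%N by lia.
have Pd : P (k1 - d.+1).+1 (st i (k1 - d.+1).+1) by rewrite Ek; apply: IH; apply: ltnW.
have [stay cross] : _ /\ _ := step (k1 - d.+1)%N ltac:(lia) Pd.
have [kn|nk] := ltnP (k1 - d.+1) n.-1; last first.
  by rewrite /st (pd_state_top B i nk) -(pd_state_top B i (leqW nk)).
rewrite /st pd_state_step //; case Bk: (B _ _) => //.
exact: cross.
Qed.

(** A pipe moves right at most once per row: after the step from [k] to [k.+1], the remaining
    letters are too small to move it. *)
Lemma label_drift i l : exists2 a, (a <= l + i)%N & st i n.-1 a = l.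
Proof.
elim: i => [|i [a al Ea]]; first by exists l; rewrite ?addn0 // /st pd_state0.
rewrite /st pd_state_row //; have [hi|hi] := leqP i n.-1; last first.
  by exists a; [lia | rewrite pd_state_top // ltnW].
pose P k (w : nat -> nat) :=
  exists2 a', (a' <= a)%N \/ a' = a.+1 /\ (k <= a)%N & w a' = l.
suff [a' Ha' E] : P i (st i i) by exists a' => //; lia.
apply: (pd_state_ind hi) => [k hk [a' Ha' E]|]; last by exists a; [left|].
split; first by exists a' => //; lia.
move=> _ _; exists (sw k k.+1 a'); last by rewrite /= swK.
by case_sw k k.+1 a'; lia.
Qed.

Definition inverted (w : nat -> nat) g l := exists a b, [/\ (a < b)%N, w a = g & w b = l].

Lemma inverted_swap w k g l : (l < g)%N -> (w k < w k.+1)%N ->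
  inverted w g l -> inverted (w \o sw k k.+1) g l.
Proof.
move=> lg wk [a [b [ab Ea Eb]]]; exists (sw k k.+1 a), (sw k k.+1 b).
rewrite /= !swK; split=> //; move: wk lg; rewrite -Ea -Eb.
by case_sw k k.+1 a; case_sw k k.+1 b; subst; lia.
Qed.

Hypothesis asc : ascents (word_log (letters_above n n) (mask B (letters_above n n))).

Lemma ascending i k : (i <= k < n.-1)%N -> B i k -> (st i k.+1 k < st i k.+1 k.+1)%N.
Proof.
move=> ik Bk; move: asc; rewrite word_logE => /allP/(_ (crossing_at n B (i, k))).
apply; apply: map_f; rewrite mem_filter mem_letters /= Bk; lia.
Qed.

Lemma inverted_row i k0 k1 g l : (l < g)%N -> (i <= k0 <= k1)%N ->
  inverted (st i k1) g l -> inverted (st i k0) g l.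
Proof.
move=> lg /andP[ik k01]; apply: (pd_state_ind (P := fun _ w => inverted w g l) k01) => k hk inv.
split=> // Bk kn; apply: inverted_swap => //; apply: ascending => //; lia.
Qed.

Lemma inverted_final q m g l : (l < g)%N -> (q <= m)%N -> (q <= n)%N ->
  inverted (st q m) g l -> inverted (st n n.-1) g l.
Proof.
move=> lg qm qn inv.
have [q_lt|] := ltnP q n; last first.
  move=> nq; have Eq : q = n by lia.
  by move: inv; rewrite Eq /st (pd_state_top B n (k := m)) //; lia.
have inv1 : inverted (st q.+1 n.-1) g l.
  by rewrite /st pd_state_row //; apply: (inverted_row lg _ inv); lia.
suff H d : inverted (st (q.+1 + d) n.-1) g l by have := H (n - q.+1)%N; rewrite subnKC.
elim: d => [|d IH]; first by rewrite addn0.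
rewrite addnS /st pd_state_row //.
have [h|h] := leqP (q.+1 + d) n.-1; first by apply: (inverted_row lg _ IH); lia.
by rewrite (pd_state_top B _ (ltnW h)).
Qed.

Lemma final_state i a : (a < i <= n)%N -> st n n.-1 a = st i n.-1 a.
Proof. by case/andP=> ai le_in; rewrite /st -(@pd_state_final n B i a n). Qed.

(* What survives from just after the crossing of letter [m] in row [p] until
   just before the next one: the pipe [y] at position [m] and the set of
   labels to its left. *)
Definition settled m y (w0 w : nat -> nat) :=
  w m = y /\ forall l, (exists2 a, (a < m)%N & w a = l) <-> (exists2 a, (a < m)%N & w0 a = l).

Lemma settled_swap m y w0 w k : (k != m) -> (k.+1 != m) ->
  settled m y w0 w -> settled m y w0 (w \o sw k k.+1).
Proof.
move=> km k1m [wm H]; split; first by rewrite /= -wm; congr w; case_sw k k.+1 m; lia.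
move=> l; rewrite -H; split=> -[a am Ea]; exists (sw k k.+1 a); rewrite /= ?swK //.
  by case_sw k k.+1 a; lia.
by case_sw k k.+1 a; lia.
Qed.

Lemma settled_row m y w0 i k0 k1 : (k0 <= k1)%N ->
  (forall k, (k0 <= k < k1)%N -> B i k -> (k != m) && (k.+1 != m)) ->
  settled m y w0 (st i k1) -> settled m y w0 (st i k0).
Proof.
move=> k01 H; apply: (pd_state_ind (P := fun _ w => settled m y w0 w) k01) => k hk Sk.
by split=> // Bk _; have /andP[km k1m] := H k hk Bk; apply: settled_swap.
Qed.

(** Letter [m.-1] is excluded in row [p] but not in row [q], because within a row it is read after
    [m]. *)
Lemma between_crossings p q m : (p < q <= m)%N -> (m < n.-1)%N ->
  B p m -> B q m -> (forall r, (p < r < q)%N -> ~~ B r m) ->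
  (forall r, (p <= r < q)%N -> ~~ B r m.-1) ->
  exists a b c d, [/\ (a < b)%N, (b < c)%N, (c < d)%N & (d < n)%N] /\
    [/\ (st n n.-1 a < st n n.-1 d)%N, (st n n.-1 d < st n n.-1 c)%N
      & (st n n.-1 c < st n n.-1 b)%N].
Proof.
move=> pqm mn Bp Bq no_m no_m1.
(* In row [p] the pipes [X < Y] cross and [Y] comes to position [m]; it waits there until it crosses
   [Z] in row [q]. *)
pose X := st p m.+1 m; pose Y := st p m.+1 m.+1; pose Z := st q m.+1 m.+1.
have XY : (X < Y)%N by apply: ascending => //; lia.
have stpm : st p m = st p m.+1 \o sw m m.+1 by rewrite /st pd_state_step // Bp.
have settle_row i k0 : (p <= i < q)%N -> (k0 <= m)%N ->
    settled m Y (st p m.+1) (st i m) -> settled m Y (st p m.+1) (st i k0).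
  move=> hi k0m; apply: settled_row => // k hk Bk.
  have /negP := no_m1 i hi; case: (eqVneq k m.-1) Bk => [->|km] // _ _; lia.
have settle_p : settled m Y (st p m.+1) (st p m).
  rewrite stpm; split; first by rewrite /= swl.
  by move=> l; split=> -[a am Ea]; exists a => //; rewrite -Ea /=; congr (st p m.+1 _);
     case_sw m m.+1 a; lia.
have settle r : (p < r <= q)%N -> settled m Y (st p m.+1) (st r n.-1).
  elim: r => // r IH hr; rewrite /st pd_state_row // -/(st r r).
  case: (ltngtP p r) => [pr|rp|<-]; last 2 first.
  - by lia.
  - by apply: settle_row settle_p; lia.
  apply: settle_row; [lia|lia|].
  have /IH S0 : (p < r <= q)%N by lia.
  apply: settled_row S0; first by lia.
  move=> k hk Bk; case: (eqVneq k m) Bk => [->|km] Bk /=; last by lia.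
  by have := no_m r; rewrite Bk; lia.
have [Ym Lq] : settled m Y (st p m.+1) (st q m.+1).
  have /settle S0 : (p < q <= q)%N by lia.
  apply: settled_row S0 => [|k hk _]; first by lia.
  by apply/andP; split; lia.
have YZ : (Y < Z)%N by rewrite -Ym; apply: ascending => //; lia.
have stqm : st q m = st q m.+1 \o sw m m.+1 by rewrite /st pd_state_step // Bq.
have qmZ : st q m m = Z by rewrite stqm /= swl.
have qmY : st q m m.+1 = Y by rewrite stqm /= swr.
have q_n : (q < n)%N by lia.
have [x xn Ex] : exists2 x, (x < n)%N & st q m x = X.
  apply: perm_on_nat_surj (pd_state_perm q m) _.
  by rewrite (perm_on_nat_lt _ (pd_state_perm p m.+1)); lia.
(* The labels to the left of [m] are those from just after the first crossing, so [X] is not among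
   them; [Z], [Y], [X] now stand in this decreasing order and will form the 432 of the pattern. *)
have m1x : (m.+1 < x)%N.
  case: (ltngtP x m) => [xm|mx|E]; last by move: Ex; rewrite E qmZ; lia.
    have [/(_ _)[|a am Ea]] := Lq X.
      by exists x => //; rewrite -Ex stqm /=; congr (st q m.+1 _); case_sw m m.+1 x; lia.
    by have := pd_state_inj Ea; lia.
  have xm1 : x <> m.+1 by move=> E; move: Ex; rewrite E qmY; lia.
  by lia.
have qm : (q <= m)%N by lia.
have invZY : inverted (st q m) Z Y by exists m, m.+1.
have invYX : inverted (st q m) Y X by exists m.+1, x.
have [z [y [zy Ez Ey]]] := inverted_final YZ qm (ltnW q_n) invZY.
have [y' [x' [yx Ey' Ex']]] := inverted_final XY qm (ltnW q_n) invYX.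
have Eyy : y' = y by apply: (@pd_state_inj n n.-1); rewrite Ey.
subst y'.
have stable a : (a < q)%N -> st n n.-1 a = st q m a.
  move=> aq; rewrite (final_state (i := q.+1)); last by lia.
  rewrite /st pd_state_row //.
  have := @pd_state_ind (fun _ w => w a = st q m a) q q m; apply; [lia| |by []].
  move=> k hk E; split=> // _ _; rewrite /= -E; congr (st q k.+1 _).
  by case_sw k k.+1 a; lia.
have qz : (q <= z)%N.
  rewrite leqNgt; apply/negP => zq; move: Ez; rewrite stable // -qmZ => /pd_state_inj; lia.
(* The bound [m - p] comes from [label_drift]: before row [p] a smaller label has moved at most [p]
   places, so it is left of [m] and remains there. Only [m - q] of these positions are not yet
   frozen. *)
have [a aq aW] : exists2 a, (a < q)%N & (st q m a < m - p)%N.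
  have [/hasP[a]|/hasPn none] := boolP (has (fun a => st q m a < m - p)%N (iota 0 q)).
    by rewrite mem_iota => aq aW; exists a.
  have : (size (iota 0 (m - p)) <= size [seq st q m a | a <- iota q (m - q)])%N.
    apply: uniq_leq_size; first exact: iota_uniq.
    move=> l; rewrite mem_iota add0n => /= lmp.
    have [a al Ea] := label_drift p l.
    have [_ /(_ _)[|b bm Eb]] := Lq l.
      exists a; first by lia.
      by rewrite -Ea /st; apply: pd_state_left; lia.
    apply/mapP; exists b; last first.
      by rewrite -Eb stqm /=; congr (st q m.+1 _); case_sw m m.+1 b; lia.
    rewrite mem_iota; have := none b; rewrite mem_iota.
    rewrite stqm /= (_ : sw m m.+1 b = b); last by case_sw m m.+1 b; lia.
    by rewrite Eb; lia.
  by rewrite size_map !size_iota; lia.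
(* By the same drift bound, a label below [m - p] could not be at position [m] in row [p]. *)
have XW : (m - p <= X)%N.
  rewrite leqNgt; apply/negP => hX.
  have [b bX Eb] := label_drift p X.
  have : st p m.+1 b = X by rewrite -Eb /st; apply: pd_state_left; lia.
  by move/pd_state_inj; lia.
exists a, z, y, x'; split.
  split=> //; first by lia.
  have := perm_on_nat_lt x' (pd_state_perm n n.-1); rewrite Ex' => <-.
  by rewrite -Ex (perm_on_nat_lt _ (pd_state_perm q m)).
rewrite Ez Ey Ex' stable //; split=> //; lia.
Qed.

End Pattern.

(** * Counting *)

(** Each place of [f] except the first is charged to a place of [g] in the gap that ends there, and
    these gaps are disjoint. *)
Lemma leq_sum_interlaced (f g : nat -> bool) j i : (j <= i)%N ->
  (forall a b, (j <= a < b)%N -> (b <= i)%N -> f a -> f b ->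
     (forall c, (a < c < b)%N -> ~~ f c) -> exists2 c, (a < c <= b)%N & g c) ->
  (\sum_(j <= k < i.+1) f k <= 1 + \sum_(j.+1 <= k < i.+1) g k)%N.
Proof.
have [m] := ubnP i; elim: m i => // m IH i im ji H.
have mono a : (j <= a <= i)%N ->
    (\sum_(j.+1 <= k < a.+1) g k <= \sum_(j.+1 <= k < i.+1) g k)%N.
  by move=> ha; rewrite (@big_cat_nat _ _ _ a.+1 _ i.+1) //= ?leq_addr //; lia.
rewrite big_nat_recr //=; case fi: (f i); last first.
  rewrite addn0; case: (ltngtP j i) ji => // [ji _|<- _]; last by rewrite big_geq.
  have [i' Ei] : exists i', i = i'.+1 by exists i.-1; lia.
  subst i; apply: leq_trans (IH i' _ _ _) _; [lia|lia| |by rewrite leq_add2l mono //; lia].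
  by move=> a b ab bi; apply: H => //; lia.
have [/hasP[a0 a0I fa0]|/hasPn none] := boolP (has f (iota j (i - j))); last first.
  rewrite big_nat_cond big1 => [|k]; first by lia.
  by rewrite andbT => hk; apply/eqP; rewrite eqb0; apply: none; rewrite mem_iota; lia.
pose P a := (j <= a < i)%N && f a.
have exP : exists a, P a by exists a0; move: a0I; rewrite /P fa0 mem_iota; lia.
have ubP a : P a -> (a <= i)%N by case/andP; lia.
case: (ex_maxnP exP ubP) => a /andP[ja fa] amax.
have none c : (a < c < i)%N -> ~~ f c.
  by move=> hc; apply/negP => fc; have := amax c; rewrite /P fc; lia.
have [c ac gc] : exists2 c, (a < c <= i)%N & g c by apply: H => //; lia.
have -> : (\sum_(j <= k < i) f k = \sum_(j <= k < a.+1) f k)%N.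
  rewrite (@big_cat_nat _ _ _ a.+1 _ i) /=; [|lia|lia].
  rewrite [X in (_ + X)%N]big_nat_cond [X in (_ + X)%N]big1 ?addn0 // => k.
  by rewrite andbT => hk; apply/eqP; rewrite eqb0; apply: none; lia.
have IHa : (\sum_(j <= k < a.+1) f k <= 1 + \sum_(j.+1 <= k < a.+1) g k)%N.
  by apply: IH; [lia|lia|] => b d bd dl; apply: H => //; lia.
rewrite (@big_cat_nat _ _ _ a.+1 _ i.+1) /=; [|lia|lia].
have : (1 <= \sum_(a.+1 <= k < i.+1) g k)%N.
  rewrite (@big_cat_nat _ _ _ c _ i.+1) /=; [|lia|lia].
  by rewrite [X in (_ + X)%N]big_ltn ?gc; lia.
lia.
Qed.

(** * Bijections from equal fibre sizes *)

Section Fibres.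
Variable M : eqType.

(** Fibres over the same point are matched by rank in their enumerations. *)
Definition transfer (X Y : finType) (f : X -> M) (g : Y -> M) (y0 : Y) (x : X) : Y :=
  nth y0 (enum [pred y | g y == f x]) (index x (enum [pred x' | f x' == f x])).

Lemma transferP (X Y : finType) (f : X -> M) (g : Y -> M) x0 y0 :
  (forall k, #|[pred x | f x == k]| = #|[pred y | g y == k]|) ->
  (forall x, g (transfer f g y0 x) = f x) /\
  cancel (transfer f g y0) (transfer g f x0).
Proof.
move=> E; have lt_x x : (index x (enum [pred x' | f x' == f x]) <
    size (enum [pred y | g y == f x]))%N.
  by rewrite -cardE -E cardE index_mem mem_enum inE /= eqxx.
have gE x : g (transfer f g y0 x) = f x.
  by have := mem_nth y0 (lt_x x); rewrite mem_enum inE => /eqP.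
split=> // x; rewrite {1}/transfer gE {1}/transfer index_uniq ?enum_uniq //.
by rewrite nth_index // mem_enum inE /= eqxx.
Qed.

Lemma fibre_bijection (X Y : finType) (f : X -> M) (g : Y -> M) :
  (forall k, #|[pred x | f x == k]| = #|[pred y | g y == k]|) ->
  exists2 h : X -> Y, bijective h & forall x, g (h x) = f x.
Proof.
move=> E; have [x0 _|noX] := pickP (@predT X).
  have [y0 _|noY] := pickP (@predT Y).
    have [gE hK] := transferP x0 y0 E.
    have [_ hK'] := transferP y0 x0 (fun k => esym (E k)).
    by exists (transfer f g y0) => //; exists (transfer g f x0).
  have : x0 \in [pred x | f x == f x0] by rewrite inE /=.
  have c0 : #|[pred x | f x == f x0]| = 0%N by rewrite E; apply: eq_card0 => y; have := noY y.
  by rewrite (card0_eq c0).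
have noX' (x : X) : False by have := noX x.
have noY' (y : Y) : False.
  have : y \in [pred z | g z == g y] by rewrite inE /=.
  have c0 : #|[pred z | g z == g y]| = 0%N by rewrite -E; apply: eq_card0 => x; have := noX x.
  by rewrite (card0_eq c0).
exists (fun x => False_rect Y (noX' x)) => [|x]; last by case: (noX' x).
by exists (fun y => False_rect X (noY' y)) => z; [case: (noX' z) | case: (noY' z)].
Qed.
End Fibres.

(** The coefficient of a monomial is the size of its fibre, and integer coefficients lose nothing of
    that number. *)
Lemma monomial_bijection n (X Y : finType) (f : X -> 'X_{1..n}) (g : Y -> 'X_{1..n}) :
  \sum_x 'X_[f x] = \sum_y 'X_[g y] :> {mpoly int[n]} ->
  exists2 h : X -> Y, bijective h & forall x, g (h x) = f x.
Proof.
move=> E; apply: fibre_bijection => k.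
have coef (Z : finType) (d : Z -> 'X_{1..n}) :
    (\sum_z 'X_[d z] : {mpoly int[n]})@_k = (#|[pred z | d z == k]|)%:R.
  rewrite raddf_sum /= -sum1_card natr_sum [RHS]big_mkcond /=.
  by apply: eq_bigr => z _; rewrite mcoeffX inE; case: eqP.
by apply/eqP; rewrite -(Num.Theory.eqr_nat int) -!coef E.
Qed.

(** * Triangles as choices of crossings *)

Section Triangles.
Variable n : nat.

Definition monomial_var (i : nat) : {mpoly int[n]} :=
  if insub i is Some j then 'X_j else 0.

Lemma monomial_var_ord (i : 'I_n) : monomial_var i = 'X_i.
Proof. by rewrite /monomial_var valK. Qed.

(** Rows and letters count from 0 here, triangle indices from 1. *)
Definition cross_row (b : triangle n) (i k : nat) : bool := entry b (n - i.+1) k.+1.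

Definition letter_of (p : tri_index n) : nat * nat :=
  (n - (val p).1.+1, (val p).2.-1)%N.

Lemma letter_of_inj : injective letter_of.
Proof.
move=> [[i j] /= h] [[i' j'] /= h'] [Ei Ej]; apply: val_inj => /=.
have := ltn_ord i; have := ltn_ord i'.
by move=> *; congr (_, _); apply: val_inj => /=; lia.
Qed.

Lemma perm_letters : perm_eq [seq letter_of p | p <- enum (tri_index n)] (letters_above n n).
Proof.
apply: uniq_perm; [|exact: uniq_letters|].
  by rewrite map_inj_uniq ?enum_uniq //; exact: letter_of_inj.
move=> [i k]; rewrite mem_letters /=; apply/mapP/idP => [[[[i' j'] /= hp] _ [-> ->]]|h].
  by have := ltn_ord i'; have := ltn_ord j'; lia.
have hi : (n - i.+1 < n)%N by lia.
have hk : (k.+1 < n)%N by lia.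
have hp : (0 < (Ordinal hi, Ordinal hk).1)%N &&
          (n - (Ordinal hi, Ordinal hk).1 <= (Ordinal hi, Ordinal hk).2)%N by rewrite /=; lia.
exists (exist _ (Ordinal hi, Ordinal hk) hp); first by rewrite mem_enum.
by rewrite /letter_of /=; congr (_, _); lia.
Qed.

Lemma entryE (b : triangle n) (p : tri_index n) :
  entry b (val p).1 (val p).2 = b p.
Proof.
apply/existsP/idP => [[q /and3P[bq /eqP E1 /eqP E2]]|bp]; last by exists p; rewrite bp !eqxx.
suff <- : q = p by []; apply: val_inj.
by rewrite [LHS]surjective_pairing [RHS]surjective_pairing; congr (_, _); apply: val_inj.
Qed.

Lemma cross_row_letter b p : cross_row b (letter_of p).1 (letter_of p).2 = b p.
Proof.
rewrite -entryE /cross_row /=; case: p => [[i j] /= hp].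
by have := ltn_ord i => *; congr entry; lia.
Qed.

Lemma tsscpp_pdE (b : triangle n) c : tsscpp_pd b c =
  if (c.1 + c.2 < n.-1)%N && cross_row b c.1 (c.1 + c.2) then Cross else Elbows.
Proof.
rewrite ffunE /cross_row; case: c => i j /=.
rewrite (_ : i.+1 + j.+1 - 1 = (i + j).+1)%N; last by lia.
rewrite andbA; congr (if _ && _ then _ else _); apply/idP/idP; have := ltn_ord i; lia.
Qed.

Lemma tsscpp_wtE (b : triangle n) : tsscpp_wt b =
  word_wt monomial_var (letters_above n n) (mask (cross_row b) (letters_above n n)).
Proof.
have -> l : word_wt monomial_var l (mask (cross_row b) l) =
    \prod_(c <- l) (if cross_row b c.1 c.2 then monomial_var c.1 else 1).
  by elim: l => [|c l IH] /=; rewrite ?big_nil ?big_cons ?IH.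
rewrite -(perm_big _ perm_letters) big_map big_enum /= /tsscpp_wt big_mkcond /=.
apply: eq_bigr => p _; rewrite cross_row_letter; case: ifP => // _.
by rewrite -monomial_var_ord.
Qed.

Lemma sum_triangles (R : comRingType) (F : seq bool -> R) :
  \sum_(b : triangle n) F (mask (cross_row b) (letters_above n n)) =
  \sum_(bs : (size (letters_above n n)).-tuple bool) F bs.
Proof.
set L := letters_above n n.
pose f (bs : (size L).-tuple bool) : triangle n :=
  [ffun p => nth false bs (index (letter_of p) L)].
have memL p : letter_of p \in L by rewrite -(perm_mem perm_letters) map_f ?mem_enum.
have fE bs : mask (cross_row (f bs)) L = bs.
  apply: (@eq_from_nth _ false); first by rewrite size_map size_tuple.
  rewrite size_map => i hi; rewrite (nth_map (0, 0)%N) //.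
  have : nth (0, 0)%N L i \in L by apply: mem_nth.
  rewrite -(perm_mem perm_letters) => /mapP[p _ Ep].
  rewrite Ep cross_row_letter ffunE -Ep index_uniq ?uniq_letters //.
rewrite (reindex f) /=; first by apply: eq_bigr => bs _; rewrite fE.
have szm b : size (mask (cross_row b) L) == size L by rewrite size_map.
exists (fun b => Tuple (szm b)) => [bs _|b _].
  by apply: val_inj; rewrite /= fE.
apply/ffunP => p; rewrite ffunE /= (nth_map (0, 0)%N) ?index_mem //.
by rewrite nth_index // cross_row_letter.
Qed.

Theorem sum_pipe_dreams (pi : 'S_n) :
  \sum_(b : triangle n | pd_reduced_with (tsscpp_pd b) pi) tsscpp_wt b =
  word_sum n monomial_var (letters_above n n) (perm_nat pi).
Proof.
rewrite word_sumE ?letters_lt // -(sum_triangles (fun bs =>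
  if word_reduced n (letters_above n n) bs (perm_nat pi)
  then word_wt monomial_var (letters_above n n) bs else 0)) big_mkcond /=.
apply: eq_bigr => b _; rewrite tsscpp_wtE.
by rewrite (pd_reduced_withE _ (tsscpp_pdE b)).
Qed.

Lemma tsscpp_of_avoids1432 (pi : 'S_n) (b : triangle n) : avoids1432 pi ->
  pd_reduced_with (tsscpp_pd b) pi -> is_tsscpp b.
Proof.
move=> av; rewrite (pd_reduced_withE _ (tsscpp_pdE b)) => /andP[asc /allP st_pi].
have final i : (i < n)%N -> pd_state n (cross_row b) n n.-1 i = perm_nat pi i.
  by move=> hi; rewrite pd_stateE //; apply/eqP/st_pi; rewrite mem_iota.
apply/forallP => i; apply/forallP => j; apply/implyP => /andP[j1 ji].
apply: (leq_sum_interlaced (f := fun k => entry b k (n - j))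
  (g := fun k => entry b k (n - j - 1))); first exact: ltnW.
move=> a a' ja a'i fa fa' none; have hi := ltn_ord i.
have [/hasP[c cI gc]|/hasPn no_g] := boolP (has (fun k => entry b k (n - j - 1)) (iota a.+1 (a' - a))).
  by exists c => //; move: cI; rewrite mem_iota; lia.
(* The first triangle index decreases as the row goes down, so the smaller [a] yields the lower row
   [q]; the range [a < c <= a'] becomes the rows from [p] up to but not including [q]. *)
case: av; pose m := (n - j - 1)%N; pose p := (n - a'.+1)%N; pose q := (n - a.+1)%N.
have [E1 [E2 [E3 E4]]] : (n - p.+1 = a' /\ (n - q.+1 = a /\ (m.+1 = n - j /\ m.-1.+1 = n - j - 1)))%N.
  by rewrite /m /p /q; lia.
have [||||r hr|r hr|x1 [x2 [x3 [x4 [[h1 h2 h3 h4] [g1 g2 g3]]]]]] :=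
    @between_crossings n (cross_row b) asc p q m.
- by rewrite /m /p /q; lia.
- by rewrite /m; lia.
- by rewrite /cross_row E1 E3.
- by rewrite /cross_row E2 E3.
- by rewrite /cross_row E3; apply: none; move: hr; rewrite /p /q; lia.
- rewrite /cross_row E4; apply: no_g; rewrite mem_iota; move: hr; rewrite /p /q; lia.
rewrite !final in g1 g2 g3; try lia.
have k1 : (x1 < n)%N by lia.
have k2 : (x2 < n)%N by lia.
have k3 : (x3 < n)%N by lia.
exists (Ordinal k1), (Ordinal k2), (Ordinal k3), (Ordinal h4); rewrite /=.
by rewrite -!perm_nat_ord; split.
Qed.
End Triangles.

Lemma labels_below_full n (pi : 'S_n) :
  labels_below n n (perm_nat pi) = map Some (iota 0 n).
Proof.
apply/eq_in_map => c; rewrite mem_iota add0n => /= cn.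
have [m mn <-] := perm_on_nat_surj (perm_nat_perm pi) cn.
by rewrite /among map_f // mem_iota.
Qed.

Definition PDred n (pi : 'S_n) := {b : triangle n | pd_reduced_with (tsscpp_pd b) pi}.

Lemma monomialE n (I : finType) (P : pred I) (r : I -> 'I_n) :
  \prod_(c | P c) 'X_(r c) = 'X_[\big[mnm_add/mnm0]_(c | P c) U_(r c)%MM] :> {mpoly int[n]}.
Proof.
by apply/esym/(big_morph (fun m : 'X_{1..n} => 'X_[m] : {mpoly int[n]}));
  [exact: mpolyXD | exact: mpolyX0].
Qed.

Lemma sum_sig (R : comRingType) (I : finType) (P : pred I) (F : I -> R) :
  \sum_(i | P i) F i = \sum_(y : {i | P i}) F (val y).
Proof.
rewrite (reindex_omap (val : {i | P i} -> I) insub); last by move=> i Pi; rewrite insubT.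
by apply: eq_bigl => -[i iP] /=; rewrite insubT iP eqxx.
Qed.

Lemma PDred_BPDred n (pi : 'S_n) : exists2 h : PDred pi -> BPDred pi, bijective h &
  forall b, asm_wt (asm_of (val (h b))) = tsscpp_wt (val b).
Proof.
pose fwt (b : PDred pi) := \big[mnm_add/mnm0]_(p | val b p) U_(rev_ord (val p).1)%MM.
pose gwt (T : BPDred pi) := \big[mnm_add/mnm0]_(c | val T c == Blank) U_(c.1)%MM.
have fE b : 'X_[fwt b] = tsscpp_wt (val b) by rewrite /tsscpp_wt monomialE.
have gE T : 'X_[gwt T] = asm_wt (asm_of (val T)).
  by rewrite asm_wt_of ?monomialE //; have /andP[] := valP T.
have [|h hB hE] := @monomial_bijection n _ _ fwt gwt; last first.
  by exists h => // b; rewrite -gE hE fE.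
rewrite (eq_bigr _ (fun b _ => fE b)) -(sum_sig _ (fun b => tsscpp_wt b)) sum_pipe_dreams.
(* At [r = n] the monotonicity hypothesis is vacuous and every column carries its pipe. *)
rewrite -(@bpd_sum_word_sum _ _ n n) //; last 2 first.
- exact: perm_nat_perm.
- by move=> i j ni /andP[ij jn]; lia.
rewrite labels_below_full -sum_bpd sum_sig; apply: eq_bigr => T _.
rewrite gE asm_wt_of; last by have /andP[] := valP T.
by apply: eq_bigr => c _; rewrite monomial_var_ord.
Qed.

Theorem theorem1p1 (n : nat) (hn : (1 <= n)%N) (pi : 'S_n) :
  exists phi : TSSCPPred pi -> ASMred pi,
    [/\ injective phi,
        forall b : TSSCPPred pi, asm_wt (sval (phi b)) = tsscpp_wt (sval b)
      & avoids1432 pi -> bijective phi].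
Proof.
have [h hB hE] := PDred_BPDred pi.
have redb (b : TSSCPPred pi) : pd_reduced_with (tsscpp_pd (val b)) pi.
  by have /andP[] := valP b.
pose incl (b : TSSCPPred pi) : PDred pi := exist _ (val b) (redb b).
have inclI : injective incl by move=> b b' /(congr1 val) E; apply: val_inj.
have aB := asm_of_BPDred_bij pi.
exists (fun b => asm_of_BPDred (h (incl b))); split.
- by move=> b b' /(bij_inj aB)/(bij_inj hB)/inclI.
- by move=> b; apply: hE.
move=> av; apply: (bij_comp aB); apply: (bij_comp hB).
have tss (b : PDred pi) : tsscpp_red pi (val b).
  by rewrite /tsscpp_red (valP b) (tsscpp_of_avoids1432 av (valP b)).
by exists (fun b => exist _ (val b) (tss b)) => b; apply: val_inj.
Qed.
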